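(* Let $m$ be a nonzero integer, $a=\mathrm{diag}(im,-im)$, and $J_0=e^{-(x+y)a}$, the Ward map associated to the extended solution $\psi(x,y,t,\lambda)=e^{((1-\lambda)x+(1+\lambda-\lambda^2)u-v)a}$. Let $N\ge1$ and choose $(j_{2k-1},l_{2k-1})\in\mathbb{Z}^2$, $1\le k\le N$, such that $$(j_{2k-1}-m)^2+(l_{2k-1}-m)^2<m^2,\qquad m<l_{2k-1},$$ and $(j_{2k-1},l_{2k-1})\neq(j_{2h-1},l_{2h-1})$ for $1\le k<h\le N$. Let $(j_{2k},l_{2k})=(j_{2k-1},2m-l_{2k-1})$, and for $s=1,\dots,2N$ let $z_s=\sqrt{\frac{2m-j_s}{j_s}}\,e^{i\theta_s}$ with $$\cos\theta_s=\mathrm{sgn}(m)\frac{l_s-m}{\sqrt{j_s(2m-j_s)}},\qquad \sin\theta_s=\mathrm{sgn}(m)\sqrt{1-\cos^2\theta_s}.$$ Let $\pi_s$ be the Hermitian projection of $\mathbb{C}^2$ onto $\mathbb{C}\begin{pmatrix}1\\ f_s(w_s)\end{pmatrix}$, where $f_s(w_s)=e^{i(2m-j_s-2mz_s)w_s}$ and $w_s=x+z_su+z_s^{-1}v$. Let $$J_{2N}(x,y,t)=h_{z_{2N},\pi_{2N}}*(\cdots*(h_{z_1,\pi_1}*J_0(x,y,t))\cdots)$$ be the Ward map obtained by applying $2N$ Bäcklund transformations to $J_0$ (starting from the extended solution $\psi$). Then $J_{2N}$ is a homoclinic Ward map from $T^2\times\mathbb{R}$ to $SU(2)$. Moreover,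 $J_{2N}\to(-1)^NJ_0$ as $t\to\pm\infty$.
   Context: A Ward map is a smooth map $J$ from $\mathbb{R}^{2,1}$ (coordinates $x,y,t$) to $SU(n)$ (here $n=2$) satisfying the Ward equation $(J^{-1}J_t)_t-(J^{-1}J_x)_x-(J^{-1}J_y)_y-[J^{-1}J_t,J^{-1}J_y]=0$. A Ward map from $T^2\times\mathbb{R}$ is one that is $2\pi$-periodic in $x$ and in $y$. Set $u=\frac{t+y}{2}$, $v=\frac{t-y}{2}$. An extended Ward map (extended solution) is a map $\psi(x,y,t,\lambda)\in GL(n,\mathbb{C})$ such that $(\lambda\psi_x-\psi_u)\psi^{-1}$ and $(\lambda\psi_v-\psi_x)\psi^{-1}$ are independent of $\lambda$ and $\psi(x,y,t,\bar\lambda)^*\psi(x,y,t,\lambda)=I$; the associated Ward map is $\psi(\cdot,0)^{-1}$, up to a constant normalizing the determinant to $1$. For a Hermitian projection $\pi$, $\pi^\perp=I-\pi$ and $h_{z,\pi}(\lambda)=\pi^\perp+\frac{\lambda-z}{\lambda-\bar z}\pi$. Bäcklund transformation: let $\psi$ be an extended solution with associated Ward map $J$, holomorphic and non-degenerate at $\lambda=z\in\mathbb{C}\setminus\mathbb{R}$, and let $\pi(x,y,t)$ be the Hermitian projection onto the line spanned by $q(w)$, $q$ meromorphic in $w=x+zu+z^{-1}v$. Let $\tilde\pi(x,y,t)$ be the Hermitian projection onto $\psi(x,y,t,z)\,\mathrm{Im}(\pi(x,y,t))$. Then $h_{z,\pi}*\psi:=h_{z,\tilde\pi}\psi$ is a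 new extended solution and, for $n=2$, the new Ward map is $h_{z,\pi}*J:=\frac{1}{|z|}J\left(\bar z\tilde\pi+z\tilde\pi^\perp\right)$. The transformations are iterated on the extended solutions. Linearization: with $\eta=J^{-1}\delta J:T^2\times\mathbb{R}\to su(n)$, the linearization of the Ward equation at a Ward map $J$ is $$(\eta_t+[J^{-1}J_t,\eta])_t-(\eta_x+[J^{-1}J_x,\eta])_x-(\eta_y+[J^{-1}J_y,\eta])_y-[\eta_t+[J^{-1}J_t,\eta],J^{-1}J_y]-[J^{-1}J_t,\eta_y+[J^{-1}J_y,\eta]]=0.$$ A mode is a nonzero solution of the form $\eta=Xe^{\gamma t+i(jx+ly)}-X^*e^{\bar\gamma t-i(jx+ly)}$ with $X\in sl(n,\mathbb{C})$, $(j,l)\in\mathbb{Z}^2$, $\gamma\in\mathbb{C}$; it is stable if $\mathrm{Re}\,\gamma<0$ and unstable if $\mathrm{Re}\,\gamma>0$. The stable (unstable) subspace is the real span of the stable (unstable) modes. Homoclinic: a Ward map $J:T^2\times\mathbb{R}\to SU(n)$ is homoclinic if there is a stationary (i.e. $t$-independent) Ward map $u_0$ on $T^2$ such that $J\to u_0$ uniformly on $T^2$ as $t\to+\infty$ and as $t\to-\infty$, $J$ is tangent to the stable subspace of the linearization at $u_0$ as $t\to+\infty$, and tangent to the unstable subspace as $t\to-\infty$. Tangent as $t\to\pm\infty$ means: there is a nonzero element $\eta$ of the subspace with $\sup_{T^2}\|u_0^{-1}J(\cdot,t)-I-\eta(\cdot,t)\|=o\left(\sup_{T^2}\|\eta(\cdot,t)\|\right)$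 as $t\to\pm\infty$. *)

(* Defs.v *)
From mathcomp Require Import all_boot all_order all_algebra.
From mathcomp Require Import spectral sesquilinear.
From mathcomp Require Import complex.
From mathcomp Require Import all_classical all_reals all_analysis.
Set Implicit Arguments.
Unset Strict Implicit.
Unset Printing Implicit Defensive.
Import Order.TTheory GRing.Theory Num.Theory.
Import numFieldNormedType.Exports.
Local Open Scope classical_set_scope.
Local Open Scope complex_scope.
Local Open Scope ring_scope.
Local Open Scope sesquilinear_scope.

Section Scalars.
Variable R : realType.

Definition cexp (z : R[i]) : R[i] :=
  (expR (complex.Re z) * cos (complex.Im z))
    +i* (expR (complex.Re z) * sin (complex.Im z)).

Definition cabs (z : R[i]) : R := ComplexField.Normc.normc z.

End Scalars.

Section Fields.
Variables (R : realType) (n : nat).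
Local Notation M := 'M[R[i]]_n.

(* Matrix-valued fields on R^{2,1}, as functions of x, y, t. *)
Definition stfield := R -> R -> R -> M.

Definition comm (A B : M) : M := A *m B - B *m A.

(* Frobenius norm. *)
Definition mnorm (A : M) : R := Num.sqrt (\sum_i \sum_j cabs (A i j) ^+ 2).

Definition SUmx (A : M) : Prop := A \is unitarymx /\ \det A = 1.

(* Derivatives of a curve of complex matrices, taken on the real and imaginary
   parts of the entries. *)
Definition mderivable (g : R -> M) (s : R) : Prop := forall i j,
  derivable (fun r => complex.Re (g r i j)) s 1 /\
  derivable (fun r => complex.Im (g r i j)) s 1.

Definition mderive (g : R -> M) (s : R) : M := \matrix_(i, j)
  ((derive1 (fun r => complex.Re (g r i j)) s)
     +i* (derive1 (fun r => complex.Im (g r i j)) s)).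

Definition Dx (F : stfield) : stfield := fun x y t => mderive (fun s => F s y t) x.
Definition Dy (F : stfield) : stfield := fun x y t => mderive (fun s => F x s t) y.
Definition Dt (F : stfield) : stfield := fun x y t => mderive (fun s => F x y s) t.

Definition fcontinuous (F : stfield) : Prop := forall i j,
  continuous (fun p : R * R * R => complex.Re (F p.1.1 p.1.2 p.2 i j)) /\
  continuous (fun p : R * R * R => complex.Im (F p.1.1 p.1.2 p.2 i j)).

Definition has_partials (F : stfield) : Prop := forall x y t,
  [/\ mderivable (fun s => F s y t) x,
      mderivable (fun s => F x s t) y
    & mderivable (fun s => F x y s) t].

Fixpoint classC (k : nat) (F : stfield) : Prop :=
  if k is k'.+1 then
    [/\ fcontinuous F, has_partials F,
        classC k' (Dx F), classC k' (Dy F) & classC k' (Dt F)]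
  else fcontinuous F.

Definition smooth (F : stfield) : Prop := forall k, classC k F.

(* J^{-1} dJ, for dJ one of the partial derivatives of J. *)
Definition lder (J dJ : stfield) : stfield :=
  fun x y t => invmx (J x y t) *m dJ x y t.

Definition ward_eq (J : stfield) : Prop := forall x y t,
  Dt (lder J (Dt J)) x y t - Dx (lder J (Dx J)) x y t
  - Dy (lder J (Dy J)) x y t
  - comm (lder J (Dt J) x y t) (lder J (Dy J) x y t) = 0.

Definition ward_map (J : stfield) : Prop :=
  [/\ smooth J, forall x y t, SUmx (J x y t) & ward_eq J].

Definition periodic_xy (F : stfield) : Prop := forall x y t,
  F (x + 2 * pi) y t = F x y t /\ F x (y + 2 * pi) t = F x y t.

Definition ward_map_T2 (J : stfield) : Prop := ward_map J /\ periodic_xy J.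

Definition stationary (F : stfield) : Prop := forall x y t t', F x y t = F x y t'.

(* eta_* + [J^{-1} J_*, eta], given the fields eta, deta = eta_*, dJ = J_*. *)
Definition covder (J dJ eta deta : stfield) : stfield :=
  fun x y t => deta x y t + comm (lder J dJ x y t) (eta x y t).

Definition lin_ward_eq (J eta : stfield) : Prop :=
  let cx := covder J (Dx J) eta (Dx eta) in
  let cy := covder J (Dy J) eta (Dy eta) in
  let ct := covder J (Dt J) eta (Dt eta) in
  forall x y t,
    Dt ct x y t - Dx cx x y t - Dy cy x y t
    - comm (ct x y t) (lder J (Dy J) x y t)
    - comm (lder J (Dt J) x y t) (cy x y t) = 0.

Definition mode_field (X : M) (g : R[i]) (j l : int) : stfield := fun x y t =>
  let phase := 'i%C * (j%:~R * x%:C + l%:~R * y%:C) in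
  cexp (g * t%:C + phase) *: X - cexp (g^*%C * t%:C - phase) *: X^t*.

Definition nonzero_field (F : stfield) : Prop := exists x y t, F x y t <> 0.

(* eta is a mode of growth rate g of the linearization at J. *)
Definition is_mode (J : stfield) (g : R[i]) (eta : stfield) : Prop :=
  (exists (X : M) (j l : int), \tr X = 0 /\ eta = mode_field X g j l)
  /\ nonzero_field eta /\ lin_ward_eq J eta.

Definition real_span (S : set stfield) : set stfield := [set eta |
  exists (k : nat) (c : 'I_k -> R) (e : 'I_k -> stfield),
    (forall i, S (e i)) /\
    (forall x y t, eta x y t = \sum_(i < k) (c i)%:C *: e i x y t)].

Definition stable_subspace (J : stfield) : set stfield :=
  real_span [set eta | exists g, complex.Re g < 0 /\ is_mode J g eta].

Definition unstable_subspace (J : stfield) : set stfield :=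
  real_span [set eta | exists g, 0 < complex.Re g /\ is_mode J g eta].

Definition supT2 (F : stfield) (t : R) : R :=
  sup [set mnorm (F p.1 p.2 t) | p in `[0, 2 * pi] `*` `[0, 2 * pi]].

(* In the next two definitions T is the filter of neighbourhoods of +oo or -oo
   in the time variable.  For fields that are 2 pi-periodic in x and y,
   uniformity on R^2 is uniformity on the torus. *)
Definition unif_cvg (T : set_system R) (J u0 : stfield) : Prop :=
  forall e : R, 0 < e ->
    \forall t \near T, forall x y, mnorm (J x y t - u0 x y t) < e.

Definition tangent_to (T : set_system R) (J u0 : stfield) (S : set stfield) : Prop :=
  exists eta, [/\ S eta, nonzero_field eta &
    forall e : R, 0 < e -> \forall t \near T,
      supT2 (fun x y t => invmx (u0 x y t) *m J x y t - 1%:M - eta x y t) t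
        <= e * supT2 eta t].

Definition homoclinic (J : stfield) : Prop :=
  ward_map_T2 J /\
  exists u0, [/\ ward_map_T2 u0 /\ stationary u0,
    unif_cvg (pinfty_nbhs R) J u0,
    unif_cvg (ninfty_nbhs R) J u0,
    tangent_to (pinfty_nbhs R) J u0 (stable_subspace u0)
  & tangent_to (ninfty_nbhs R) J u0 (unstable_subspace u0)].

(* The Hermitian projection of C^n onto the column space of A.  The library's
   [proj_ortho] acts on row vectors, whence the transpositions. *)
Definition hproj (k : nat) (A : 'M[R[i]]_(n, k)) : M := (proj_ortho A^T)^T.

Lemma hproj_idem k (A : 'M[R[i]]_(n, k)) : hproj A *m hproj A = hproj A.
Proof. by rewrite /hproj -trmx_mul proj_ortho_proj. Qed.

Lemma hproj_colspace k (A : 'M[R[i]]_(n, k)) : ((hproj A)^T :=: A^T)%MS.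
Proof. by rewrite /hproj trmxK; exact: proj_orthoE. Qed.

Lemma hproj_herm k (A : 'M[R[i]]_(n, k)) : (hproj A)^t* = hproj A.
Proof.
set P := proj_ortho A^T.
have PP : P *m P^t* = P^t*.
  have /submxP[D PD] : (P <= A^T)%MS by rewrite proj_orthoE.
  have /orthomx1P := proj_ortho_compl_sub A^T 1%:M.
  rewrite mul1mx -/P => e0; apply/esym/eqP; rewrite -subr_eq0.
  by rewrite -[X in X - _]mul1mx -mulmxBl {2}PD trmx_mul map_mxM mulmxA e0 mul0mx.
rewrite /hproj -/P; move: P PP => P PP.
have PH : P^t* = P.
  have := congr1 (fun B : M => B^t*) PP.
  by rewrite trmx_mul map_mxM !map_trmx !trmxK map_mxCK PP.
by rewrite -[in RHS]PH map_trmx.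
Qed.

(* The exponential of c a for the diagonal matrix a = diag_mx d. *)
Definition exp_diag (c : R[i]) (d : 'rV[R[i]]_n) : M :=
  diag_mx (map_mx (@cexp R) (c *: d)).

(* Fields depending also on the spectral parameter lambda. *)
Definition ext_field := R -> R -> R -> R[i] -> M.

Definition hfactor (z : R[i]) (P : M) (lam : R[i]) : M :=
  (1%:M - P) + ((lam - z) / (lam - z^*%C)) *: P.

(* The projection onto psi(x,y,t,z) Im(pi(x,y,t)). *)
Definition pi_tilde (z : R[i]) (P : stfield) (psi : ext_field) : stfield :=
  fun x y t => hproj (psi x y t z *m P x y t).

Definition bt_ext (z : R[i]) (P : stfield) (psi : ext_field) : ext_field :=
  fun x y t lam => hfactor z (pi_tilde z P psi x y t) lam *m psi x y t lam.

End Fields.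

Section Backlund.
Variable R : realType.

(* h_{z,pi} * J for n = 2; psi is the extended solution associated to J. *)
Definition bt_map (z : R[i]) (P : stfield R 2) (psi : ext_field R 2)
    (J : stfield R 2) : stfield R 2 := fun x y t =>
  let Q := pi_tilde z P psi x y t in
  (cabs z)^-1%:C *: (J x y t *m (z^*%C *: Q + z *: (1%:M - Q))).

(* The transformations of indices 1, ..., s, in this order; index 0 of z and P
   is not used. *)
Fixpoint bt_iter (z : nat -> R[i]) (P : nat -> stfield R 2)
    (psi : ext_field R 2) (J : stfield R 2) (s : nat)
    : ext_field R 2 * stfield R 2 :=
  if s is s'.+1 then
    let: (psi', J') := bt_iter z P psi J s' in
    (bt_ext (z s) (P s) psi', bt_map (z s) (P s) psi' J')
  else (psi, J).

Definition coord_u (y t : R) : R[i] := ((t + y) / 2)%:C.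
Definition coord_v (y t : R) : R[i] := ((t - y) / 2)%:C.
Definition coord_w (z : R[i]) (x y t : R) : R[i] :=
  x%:C + z * coord_u y t + z^-1 * coord_v y t.

(* Diagonal of a = diag(im, -im). *)
Definition a_diag (m : int) : 'rV[R[i]]_2 :=
  \row_k (if k == ord0 then 'i%C * m%:~R else - ('i%C * m%:~R)).

Definition J_vac (m : int) : stfield R 2 :=
  fun x y t => exp_diag (- (x + y)%:C) (a_diag m).

Definition psi_vac (m : int) : ext_field R 2 := fun x y t lam =>
  exp_diag ((1 - lam) * x%:C + (1 + lam - lam ^+ 2) * coord_u y t
            - coord_v y t) (a_diag m).

(* The projection onto C (1, f(w))^T with
   f(w) = exp (i (2m - j - 2mz) w), w = x + z u + z^-1 v. *)
Definition pi_exp (m j : int) (z : R[i]) : stfield R 2 := fun x y t =>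
  let f := cexp ('i%C * ((2 * m - j)%:~R - 2 * m%:~R * z) * coord_w z x y t) in
  hproj (\col_(k < 2) (if k == ord0 then 1 else f)).

End Backlund.

(* Main.v *)
(* Write psi_s = G_s psi_vac and J_s = J_0 U_s.  The direction psi_vac(z_s) (1, f_s)
   is that of (1, q_s) with q_s = exp (- i (j x + l y + m t) + Gamma t), where
   j z = (l - m) + i Gamma and Gamma^2 = m^2 - (j - m)^2 - (l - m)^2, so G_s is a
   rational expression in the periodic functions q_1, ..., q_s.

   The sum K of the terms (conj z - z) pi over all steps satisfies
   J^-1 J_u = K_x - a and J^-1 J_x = K_v - a, which propagates through one
   Backlund step because the new line solves the linear system at lambda = z; the
   Ward equation for J is then K_xv = K_vx.

   As t --> +oo the lines tend to that of e_2, with errors of the size of the 1/q_s.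
   The diagonal of G(0) is 1 up to quadratic errors.  The entry G_12 times
   prod (lambda - conj z_i) is a polynomial of degree < 2N in lambda, and
   G(z_i) (1, q_i) = 0 gives its values at the 2N nodes; interpolation at 0 shows
   that G_12(0) is, to first order, a combination of the 1/q_i with nonzero
   coefficients.  These are modes with growth rates - Gamma_i + i m, and those of
   smallest Gamma_i give the tangent vector.  The end t --> -oo follows by exchanging
   the two coordinates of C^2. *)
Require Import Defs.
From mathcomp Require Import all_boot all_order all_algebra.
From mathcomp Require Import spectral sesquilinear.
From mathcomp Require Import complex.
From mathcomp Require Import all_classical all_reals all_analysis.
From mathcomp Require Import ring lra zify.
Set Implicit Arguments.
Unset Strict Implicit.
Unset Printing Implicit Defensive.
Import Order.TTheory GRing.Theory Num.Theory.
Import numFieldNormedType.Exports.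

(** * Smooth fields *)

Section ComplexCurves.
Local Open Scope classical_set_scope.
Local Open Scope ring_scope.
Local Open Scope complex_scope.
Variable R : realType.
Implicit Types (f g : R -> R[i]) (s : R) (d e : R[i]).

(** Every field below is built from exponentials of affine functions by sums, products, conjugation
    and inversion of nowhere vanishing functions. This class is closed under partial derivatives, so
    smoothness and the symmetry of mixed derivatives are inductions on generators. The conditions on
    the data keep the construction nondegenerate. All nodes lie strictly on one side of the real
    axis, so no pole conj z_k meets a node or 0; and m < l_{2k-1} makes the two nodes of a pair
    distinct. The pairing z_{2k} = - conj z_{2k-1} fixes the constant phase of U G(0), which is the
    origin of (-1)^N. Tangency asks for an error that is small against exp (- Gamma |t|) for the
    slowest Gamma, not merely small; hence the diagonal entries must be quadratic. The two modes of
    a pair share their Gamma, so the slowest rate is never attained by one mode alone: the tangent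
    vector keeps all of them, and the linear independence of the characters of the torus bounds its
    sup norm from below. *)

Lemma Re_add (x y : R[i]) : complex.Re (x + y) = complex.Re x + complex.Re y.
Proof. by case: x; case: y. Qed.

Lemma Im_add (x y : R[i]) : complex.Im (x + y) = complex.Im x + complex.Im y.
Proof. by case: x; case: y. Qed.

Lemma Re_opp (x : R[i]) : complex.Re (- x) = - complex.Re x.
Proof. by case: x. Qed.

Lemma Im_opp (x : R[i]) : complex.Im (- x) = - complex.Im x.
Proof. by case: x. Qed.

Lemma Re_mul (x y : R[i]) : complex.Re (x * y) =
  complex.Re x * complex.Re y - complex.Im x * complex.Im y.
Proof. by case: x; case: y. Qed.

Lemma Im_mul (x y : R[i]) : complex.Im (x * y) =
  complex.Re x * complex.Im y + complex.Im x * complex.Re y.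
Proof. by case: x; case: y. Qed.

Lemma Re_inv (x : R[i]) : complex.Re x^-1 =
  complex.Re x * (complex.Re x * complex.Re x + complex.Im x * complex.Im x)^-1.
Proof. by case: x => a b /=; rewrite !expr2. Qed.

Lemma Im_inv (x : R[i]) : complex.Im x^-1 =
  - complex.Im x * (complex.Re x * complex.Re x + complex.Im x * complex.Im x)^-1.
Proof. by case: x => a b /=; rewrite !expr2 ?mulNr. Qed.

Lemma Re_conj (x : R[i]) : complex.Re x^*%C = complex.Re x.
Proof. by case: x. Qed.

Lemma Im_conj (x : R[i]) : complex.Im x^*%C = - complex.Im x.
Proof. by case: x. Qed.

Lemma complex_ext (x y : R[i]) :
  complex.Re x = complex.Re y -> complex.Im x = complex.Im y -> x = y.
Proof. by case: x; case: y => a b c e /= -> ->. Qed.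

Lemma cnorm2_gt0 (x : R[i]) : x != 0 ->
  0 < complex.Re x * complex.Re x + complex.Im x * complex.Im x.
Proof.
case: x => a b; rewrite eq_complex /= negb_and => /orP[h|h].
  by apply: ltr_pwDl; rewrite -?expr2 ?sqr_ge0 // exprn_even_gt0.
by apply: ltr_wpDl; rewrite -?expr2 ?sqr_ge0 // exprn_even_gt0.
Qed.

Definition cderiv f s : R[i] :=
  (derive1 (fun r => complex.Re (f r)) s) +i* (derive1 (fun r => complex.Im (f r)) s).

Definition is_cderiv f s d : Prop :=
  is_derive s 1 (fun r => complex.Re (f r)) (complex.Re d) /\
  is_derive s 1 (fun r => complex.Im (f r)) (complex.Im d).

Lemma is_cderivE f s d : is_cderiv f s d -> cderiv f s = d.
Proof.
move=> [h1 h2]; rewrite /cderiv !derive1E.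
by apply: complex_ext => /=; rewrite derive_val.
Qed.

Lemma is_cderiv_cst (c : R[i]) s : is_cderiv (fun=> c) s 0.
Proof. by split; apply: is_derive_cst. Qed.

Lemma is_cderivD f g s d e : is_cderiv f s d -> is_cderiv g s e ->
  is_cderiv (fun r => f r + g r) s (d + e).
Proof.
move=> [f1 f2] [g1 g2]; split.
  have -> : (fun r => complex.Re (f r + g r)) =
    (fun r => complex.Re (f r)) + (fun r => complex.Re (g r)).
    by apply/funext => r; rewrite Re_add.
  by rewrite Re_add; apply: is_deriveD.
have -> : (fun r => complex.Im (f r + g r)) =
  (fun r => complex.Im (f r)) + (fun r => complex.Im (g r)).
  by apply/funext => r; rewrite Im_add.
by rewrite Im_add; apply: is_deriveD.
Qed.

Lemma is_cderivM f g s d e : is_cderiv f s d -> is_cderiv g s e ->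
  is_cderiv (fun r => f r * g r) s (d * g s + f s * e).
Proof.
move=> [f1 f2] [g1 g2]; split.
  have -> : (fun r => complex.Re (f r * g r)) =
    (fun r => complex.Re (f r)) * (fun r => complex.Re (g r))
    - (fun r => complex.Im (f r)) * (fun r => complex.Im (g r)).
    by apply/funext => r; rewrite Re_mul.
  apply: is_derive_eq; rewrite !(Re_add, Re_mul) /GRing.scale /=.
  by ring.
have -> : (fun r => complex.Im (f r * g r)) =
  (fun r => complex.Re (f r)) * (fun r => complex.Im (g r))
  + (fun r => complex.Im (f r)) * (fun r => complex.Re (g r)).
  by apply/funext => r; rewrite Im_mul.
apply: is_derive_eq; rewrite !(Im_add, Im_mul) /GRing.scale /=.
by ring.
Qed.

Lemma is_cderiv_conj f s d : is_cderiv f s d ->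
  is_cderiv (fun r => (f r)^*%C) s d^*%C.
Proof.
move=> [f1 f2]; split.
  have -> : (fun r => complex.Re (f r)^*%C) = (fun r => complex.Re (f r)).
    by apply/funext => r; rewrite Re_conj.
  by rewrite Re_conj.
have -> : (fun r => complex.Im (f r)^*%C) = - (fun r => complex.Im (f r)).
  by apply/funext => r; rewrite Im_conj.
by rewrite Im_conj; apply: is_deriveN.
Qed.

Lemma is_cderivV f s d : f s != 0 -> is_cderiv f s d ->
  is_cderiv (fun r => (f r)^-1) s (- d * (f s)^-1 * (f s)^-1).
Proof.
move=> f0 [f1 f2].
pose n r := complex.Re (f r) * complex.Re (f r) + complex.Im (f r) * complex.Im (f r).
have n0 : n s != 0 by rewrite gt_eqF // cnorm2_gt0.
have dn : is_derive s 1 n (2 * (complex.Re (f s) * complex.Re d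
                                + complex.Im (f s) * complex.Im d)).
  have -> : n = (fun r => complex.Re (f r)) * (fun r => complex.Re (f r))
    + (fun r => complex.Im (f r)) * (fun r => complex.Im (f r)) by [].
  by apply: is_derive_eq; rewrite /GRing.scale /=; ring.
have dV := is_deriveV n0 dn.
split.
  have -> : (fun r => complex.Re (f r)^-1) =
    (fun r => complex.Re (f r)) * (fun r => (n r)^-1).
    by apply/funext => r; rewrite Re_inv.
  apply: is_derive_eq; rewrite !(Re_mul, Im_mul, Re_inv, Im_inv).
  move: n0; rewrite /n /GRing.scale /= => n0.
  rewrite Im_opp Re_opp.
  by field.
have dN : is_derive s 1 (fun r => - complex.Im (f r)) (- complex.Im d).
  exact: is_deriveN.
have -> : (fun r => complex.Im (f r)^-1) =
  (fun r => - complex.Im (f r)) * (fun r => (n r)^-1).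
  by apply/funext => r; rewrite Im_inv.
apply: is_derive_eq; rewrite !(Re_mul, Im_mul, Re_inv, Im_inv).
move: n0; rewrite /n /GRing.scale /= => n0.
rewrite Im_opp Re_opp.
by field.
Qed.

(** Affine exponents suffice: every exponential in the construction has an exponent affine in x, y
    and t. *)
Lemma is_cderiv_cexp (a b : R[i]) s :
  is_cderiv (fun r => cexp (a * r%:C + b)) s (a * cexp (a * s%:C + b)).
Proof.
have hRe r : complex.Re (a * r%:C + b) = complex.Re a * r + complex.Re b.
  by rewrite Re_add Re_mul /=; ring.
have hIm r : complex.Im (a * r%:C + b) = complex.Im a * r + complex.Im b.
  by rewrite Im_add Im_mul /=; ring.
have aff (c e : R) : is_derive s 1 (fun r => c * r + e) c.
  have -> : (fun r => c * r + e) = (c \*: id) + cst e by [].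
  by apply: is_derive_eq; rewrite addr0 /GRing.scale /= mulr1.
have dE := is_derive1_comp (is_derive_expR _) (aff (complex.Re a) (complex.Re b)).
have dC := is_derive1_comp (is_derive_cos _) (aff (complex.Im a) (complex.Im b)).
have dS := is_derive1_comp (is_derive_sin _) (aff (complex.Im a) (complex.Im b)).
split.
  have -> : (fun r => complex.Re (cexp (a * r%:C + b))) =
    (expR \o (fun r => complex.Re a * r + complex.Re b))
    * (cos \o (fun r => complex.Im a * r + complex.Im b)).
    by apply/funext => r; rewrite /cexp hRe hIm.
  apply: is_derive_eq; rewrite Re_mul /cexp hRe hIm /= /GRing.scale /=.
  by ring.
have -> : (fun r => complex.Im (cexp (a * r%:C + b))) =
  (expR \o (fun r => complex.Re a * r + complex.Re b))
  * (sin \o (fun r => complex.Im a * r + complex.Im b)).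
  by apply/funext => r; rewrite /cexp hRe hIm.
apply: is_derive_eq; rewrite Im_mul /cexp hRe hIm /= /GRing.scale /=.
by ring.
Qed.

End ComplexCurves.

(** * The algebra of elementary scalar fields *)

Section ScalarFields.
Local Open Scope classical_set_scope.
Local Open Scope ring_scope.
Local Open Scope complex_scope.
Variable R : realType.

Definition sfield := R -> R -> R -> R[i].
Implicit Types (f g : sfield) (k : nat).

(* The coordinates x, y, t are numbered 0, 1, 2. *)
Definition slice U k (f : R -> R -> R -> U) x y t : R -> U :=
  match k with
  | 0 => fun s => f s y t
  | 1 => fun s => f x s t
  | _ => fun s => f x y s
  end.

Definition coord k (x y t : R) : R :=
  match k with 0 => x | 1 => y | _ => t end.

Definition pd k f : sfield :=
  fun x y t => cderiv (slice k f x y t) (coord k x y t).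

Definition is_pd k f g := forall x y t,
  is_cderiv (slice k f x y t) (coord k x y t) (g x y t).

Lemma is_pdE k f g : is_pd k f g -> pd k f = g.
Proof.
by move=> h; do 3 (apply/funext => ?); apply: is_cderivE; apply: h.
Qed.

(* An algebra of scalar fields stable under partial derivatives; every member
   is therefore smooth. *)
Inductive elem : sfield -> Prop :=
| elem_cexp a b c d :
    elem (fun x y t => cexp (a * x%:C + b * y%:C + c * t%:C + d))
| elem_cst c : elem (fun _ _ _ => c)
| elemD f g : elem f -> elem g -> elem (fun x y t => f x y t + g x y t)
| elemM f g : elem f -> elem g -> elem (fun x y t => f x y t * g x y t)
| elem_conj f : elem f -> elem (fun x y t => (f x y t)^*%C)
| elemV f : elem f -> (forall x y t, f x y t != 0) ->
    elem (fun x y t => (f x y t)^-1).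

Lemma is_pd_cst k c : is_pd k (fun _ _ _ => c) (fun _ _ _ => 0).
Proof. by case: k => [|[|k]] x y t; apply: is_cderiv_cst. Qed.

Lemma is_pdD k f f' g g' : is_pd k f f' -> is_pd k g g' ->
  is_pd k (fun x y t => f x y t + g x y t) (fun x y t => f' x y t + g' x y t).
Proof.
by move: k => [|[|k]] hf hg x y t; apply: is_cderivD; (apply: hf || apply: hg).
Qed.

Lemma is_pdM k f f' g g' : is_pd k f f' -> is_pd k g g' ->
  is_pd k (fun x y t => f x y t * g x y t)
          (fun x y t => f' x y t * g x y t + f x y t * g' x y t).
Proof.
by move: k => [|[|k]] hf hg x y t; apply: is_cderivM; (apply: hf || apply: hg).
Qed.

Lemma is_pd_conj k f f' : is_pd k f f' ->
  is_pd k (fun x y t => (f x y t)^*%C) (fun x y t => (f' x y t)^*%C).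
Proof. by move: k => [|[|k]] hf x y t; apply: is_cderiv_conj; apply: hf. Qed.

(** The sign is written as the factor -1 so that the derivative is literally a member of [elem],
    which has constants and products but no opposite among its constructors. *)
Lemma is_pdV k f f' : (forall x y t, f x y t != 0) -> is_pd k f f' ->
  is_pd k (fun x y t => (f x y t)^-1)
          (fun x y t => - 1 * f' x y t * (f x y t)^-1 * (f x y t)^-1).
Proof.
move=> f0; move: k => [|[|k]] hf x y t; rewrite mulN1r.
- exact: (is_cderivV (f0 x y t) (hf x y t)).
- exact: (is_cderivV (f0 x y t) (hf x y t)).
- exact: (is_cderivV (f0 x y t) (hf x y t)).
Qed.

Lemma is_pd_cexp k a b c d :
  is_pd k (fun x y t => cexp (a * x%:C + b * y%:C + c * t%:C + d))
    (fun x y t => match k with 0 => a | 1 => b | _ => c end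
                  * cexp (a * x%:C + b * y%:C + c * t%:C + d)).
Proof.
move: k => [|[|k]] x y t /=.
- rewrite (_ : (fun s => _) = fun s => cexp (a * s%:C + (b * y%:C + c * t%:C + d))).
    by rewrite -!addrA; apply: is_cderiv_cexp.
  by apply/funext => s; congr cexp; ring.
- rewrite (_ : (fun s => _) = fun s => cexp (b * s%:C + (a * x%:C + c * t%:C + d))).
    rewrite (_ : a * x%:C + b * y%:C + _ + _ = b * y%:C + (a * x%:C + c * t%:C + d)).
      exact: is_cderiv_cexp.
    by ring.
  by apply/funext => s; congr cexp; ring.
- rewrite (_ : (fun s => _) = fun s => cexp (c * s%:C + (a * x%:C + b * y%:C + d))).
    rewrite (_ : a * x%:C + b * y%:C + _ + _ = c * t%:C + (a * x%:C + b * y%:C + d)).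
      exact: is_cderiv_cexp.
    by ring.
  by apply/funext => s; congr cexp; ring.
Qed.

(** Existence of the derivative and membership in the class are proved together: each rule of
    calculus exhibits a derivative made of the same constructors. *)
Lemma elem_is_pd k f : elem f -> exists2 f', elem f' & is_pd k f f'.
Proof.
elim=> {f}.
- move=> a b c d; eexists; last exact: is_pd_cexp.
  by apply: elemM; [exact: elem_cst|exact: elem_cexp].
- by move=> c; eexists; last exact: is_pd_cst; exact: elem_cst.
- move=> f g _ [f' ef hf] _ [g' eg hg]; eexists; last exact: is_pdD hf hg.
  exact: elemD.
- move=> f g ef0 [f' ef hf] eg0 [g' eg hg]; eexists; last exact: is_pdM hf hg.
  by apply: elemD; apply: elemM.
- move=> f _ [f' ef hf]; eexists; last exact: is_pd_conj hf.
  exact: elem_conj.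
- move=> f ef0 [f' ef hf] f0; eexists; last exact: (is_pdV f0 hf).
  by do ?apply: elemM => //; try exact: elemV; exact: elem_cst.
Qed.

Lemma elem_pd k f : elem f -> elem (pd k f).
Proof. by case/(elem_is_pd k) => f' ef' /is_pdE ->. Qed.

Lemma elem_pdP k f : elem f -> is_pd k f (pd k f).
Proof. by case/(elem_is_pd k) => f' ef' h; rewrite (is_pdE h). Qed.

Lemma pd_cst k c : pd k (fun _ _ _ => c) = fun _ _ _ => 0.
Proof. exact: is_pdE (is_pd_cst k c). Qed.

Lemma pdD k f g : elem f -> elem g ->
  pd k (fun x y t => f x y t + g x y t) = fun x y t => pd k f x y t + pd k g x y t.
Proof. by move=> ef eg; apply: is_pdE; apply: is_pdD; apply: elem_pdP. Qed.

Lemma pdM k f g : elem f -> elem g ->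
  pd k (fun x y t => f x y t * g x y t) =
  fun x y t => pd k f x y t * g x y t + f x y t * pd k g x y t.
Proof. by move=> ef eg; apply: is_pdE; apply: is_pdM; apply: elem_pdP. Qed.

Lemma pd_conj k f : elem f ->
  pd k (fun x y t => (f x y t)^*%C) = fun x y t => (pd k f x y t)^*%C.
Proof. by move=> ef; apply: is_pdE; apply: is_pd_conj; apply: elem_pdP. Qed.

Lemma pdV k f : elem f -> (forall x y t, f x y t != 0) ->
  pd k (fun x y t => (f x y t)^-1) =
  fun x y t => - 1 * pd k f x y t * (f x y t)^-1 * (f x y t)^-1.
Proof. by move=> ef f0; apply: is_pdE; apply: is_pdV => //; apply: elem_pdP. Qed.

Lemma pd_cexp k a b c d :
  pd k (fun x y t => cexp (a * x%:C + b * y%:C + c * t%:C + d)) =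
  fun x y t => match k with 0 => a | 1 => b | _ => c end
               * cexp (a * x%:C + b * y%:C + c * t%:C + d).
Proof. exact: is_pdE (is_pd_cexp k a b c d). Qed.

(** Induction on generators: exponentials are eigenfunctions of every partial derivative, and the
    sum, product, conjugation and inverse rules preserve the symmetry in k and l. *)
Lemma pdC k l f : elem f -> pd k (pd l f) = pd l (pd k f).
Proof.
elim=> {f}.
- move=> a b c d; have ec := elem_cexp a b c d.
  rewrite !pd_cexp !pdM ?pd_cst ?pd_cexp //; try exact: elem_cst.
  by do 3 (apply/funext => ?); ring.
- by move=> c; rewrite !pd_cst.
- move=> f g ef hf eg hg; rewrite !pdD //; try exact: elem_pd.
  by rewrite hf hg.
- move=> f g ef hf eg hg.
  have e k' f' : elem f' -> elem (pd k' f') := @elem_pd k' f'.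
  rewrite !pdM // !pdD ?pdM ?hf ?hg //; try by [apply: e|apply: elemM => //; apply: e].
  by do 3 (apply/funext => ?); ring.
- by move=> f ef hf; rewrite !pd_conj ?hf //; exact: elem_pd.
- move=> f ef hf f0.
  have e k' f' : elem f' -> elem (pd k' f') := @elem_pd k' f'.
  have ev := elemV ef f0.
  have ec k' : elem (fun x y t => -1 * pd k' f x y t).
    by apply: elemM; [exact: elem_cst|exact: e].
  have ed k' : elem (fun x y t => -1 * pd k' f x y t * (f x y t)^-1).
    exact: elemM.
  rewrite !pdV // !(pdM _ (ed _) ev) !(pdM _ (ec _) ev) !pdV //.
  rewrite !pdM ?pd_cst ?hf //; try by [exact: elem_cst|apply: e].
  by do 3 (apply/funext => ?); ring.
Qed.

Definition scontinuous f :=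
  continuous (fun p : R * R * R => complex.Re (f p.1.1 p.1.2 p.2)) /\
  continuous (fun p : R * R * R => complex.Im (f p.1.1 p.1.2 p.2)).

Lemma affine_continuous (a b c d : R) :
  continuous (fun p : R * R * R => a * p.1.1 + b * p.1.2 + c * p.2 + d).
Proof.
move=> p; apply: cvgD; last exact: cvg_cst.
have fc : continuous (fst : R * R * R -> R * R) by move=> q; apply: cvg_fst.
apply: cvgD; first apply: cvgD.
- apply: cvgM; first exact: cvg_cst.
  apply: (@continuous_comp _ _ _ fst fst); first exact: fc.
  exact: cvg_fst.
- apply: cvgM; first exact: cvg_cst.
  apply: (@continuous_comp _ _ _ fst snd); first exact: fc.
  exact: cvg_snd.
- by apply: cvgM; [exact: cvg_cst|exact: cvg_snd].
Qed.

Lemma elem_continuous f : elem f -> scontinuous f.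
Proof.
elim=> {f}.
- move=> a b c d.
  pose rr := fun p : R * R * R => complex.Re a * p.1.1 + complex.Re b * p.1.2
    + complex.Re c * p.2 + complex.Re d.
  pose ii := fun p : R * R * R => complex.Im a * p.1.1 + complex.Im b * p.1.2
    + complex.Im c * p.2 + complex.Im d.
  have hr p : complex.Re (a * p.1.1%:C + b * p.1.2%:C + c * p.2%:C + d) = rr p.
    by rewrite !(Re_add, Re_mul) /rr /=; ring.
  have hi p : complex.Im (a * p.1.1%:C + b * p.1.2%:C + c * p.2%:C + d) = ii p.
    by rewrite !(Im_add, Im_mul) /ii /=; ring.
  have cr : continuous rr := @affine_continuous _ _ _ _.
  have ci : continuous ii := @affine_continuous _ _ _ _.
  split.
    rewrite (_ : (fun p => _) = fun p => expR (rr p) * cos (ii p)).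
      move=> p; apply: cvgM.
        by apply: (@continuous_comp _ _ _ rr expR); [exact: cr|exact: continuous_expR].
      by apply: (@continuous_comp _ _ _ ii cos); [exact: ci|exact: continuous_cos].
    by apply/funext => p; rewrite /cexp hr hi.
  rewrite (_ : (fun p => _) = fun p => expR (rr p) * sin (ii p)).
    move=> p; apply: cvgM.
      by apply: (@continuous_comp _ _ _ rr expR); [exact: cr|exact: continuous_expR].
    by apply: (@continuous_comp _ _ _ ii sin); [exact: ci|exact: continuous_sin].
  by apply/funext => p; rewrite /cexp hr hi.
- by move=> c; split => p; apply: cvg_cst.
- move=> f g _ [f1 f2] _ [g1 g2]; split.
    rewrite (_ : (fun p => _) = fun p => complex.Re (f p.1.1 p.1.2 p.2)
                                         + complex.Re (g p.1.1 p.1.2 p.2)).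
      by move=> p; apply: cvgD; [exact: f1|exact: g1].
    by apply/funext => p; rewrite Re_add.
  rewrite (_ : (fun p => _) = fun p => complex.Im (f p.1.1 p.1.2 p.2)
                                       + complex.Im (g p.1.1 p.1.2 p.2)).
    by move=> p; apply: cvgD; [exact: f2|exact: g2].
  by apply/funext => p; rewrite Im_add.
- move=> f g _ [f1 f2] _ [g1 g2]; split.
    under eq_fun do rewrite Re_mul.
    move=> p; apply: cvgB; apply: cvgM.
    + exact: f1. + exact: g1. + exact: f2. + exact: g2.
  under eq_fun do rewrite Im_mul.
  move=> p; apply: cvgD; apply: cvgM.
  + exact: f1. + exact: g2. + exact: f2. + exact: g1.
- move=> f _ [f1 f2]; split.
    by under eq_fun do rewrite Re_conj.
  under eq_fun do rewrite Im_conj.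
  by move=> p; apply: cvgN; exact: f2.
- move=> f _ [f1 f2] f0.
  have cn : continuous (fun p : R * R * R =>
     (complex.Re (f p.1.1 p.1.2 p.2) * complex.Re (f p.1.1 p.1.2 p.2)
      + complex.Im (f p.1.1 p.1.2 p.2) * complex.Im (f p.1.1 p.1.2 p.2))^-1).
    move=> p; apply: cvgV; first by rewrite gt_eqF // cnorm2_gt0.
    by apply: cvgD; apply: cvgM; (exact: f1 || exact: f2).
  split.
    under eq_fun do rewrite Re_inv.
    by move=> p; apply: cvgM; [exact: f1|exact: cn].
  under eq_fun do rewrite Im_inv.
  move=> p; apply: cvgM; last exact: cn.
  by apply: cvgN; exact: f2.
Qed.

End ScalarFields.

(** * Matrices of elementary fields *)

Section MatrixFields.
Local Open Scope classical_set_scope.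
Local Open Scope ring_scope.
Local Open Scope complex_scope.
Local Open Scope sesquilinear_scope.
Variable R : realType.

Lemma elem_sum (I : Type) (r : seq I) (f : I -> sfield R) :
  (forall i, elem (f i)) -> elem (fun x y t => \sum_(i <- r) f i x y t).
Proof.
move=> ef; elim: r => [|i r IH].
  rewrite (_ : (fun x y t => _) = fun _ _ _ => 0); first exact: elem_cst.
  by do 3 (apply/funext => ?); rewrite big_nil.
rewrite (_ : (fun x y t => _) = fun x y t => f i x y t + \sum_(j <- r) f j x y t).
  exact: elemD.
by do 3 (apply/funext => ?); rewrite big_cons.
Qed.

Lemma pd_sum k (I : Type) (r : seq I) (f : I -> sfield R) :
  (forall i, elem (f i)) ->
  pd k (fun x y t => \sum_(i <- r) f i x y t) =
  fun x y t => \sum_(i <- r) pd k (f i) x y t.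
Proof.
move=> ef; elim: r => [|i r IH].
  rewrite (_ : (fun x y t => _) = fun _ _ _ => 0).
    by rewrite pd_cst; do 3 (apply/funext => ?); rewrite big_nil.
  by do 3 (apply/funext => ?); rewrite big_nil.
rewrite (_ : (fun x y t => _) = fun x y t => f i x y t + \sum_(j <- r) f j x y t).
  rewrite pdD //; last exact: elem_sum.
  by rewrite IH; do 3 (apply/funext => ?); rewrite big_cons.
by do 3 (apply/funext => ?); rewrite big_cons.
Qed.

Definition mfield p q := R -> R -> R -> 'M[R[i]]_(p, q).

Definition melem p q (F : mfield p q) := forall i j, elem (fun x y t => F x y t i j).

(* Locked, so that conversion never compares the underlying limits. *)
Fact mpd_key : unit. Proof. exact: tt. Qed.
Definition mpd : forall (k p q : nat), mfield p q -> mfield p q :=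
  locked_with mpd_key (fun k p q F x y t =>
    \matrix_(i, j) pd k (fun x y t => F x y t i j) x y t).
Arguments mpd k {p q} F.

Lemma mpd_unlock k p q (F : mfield p q) : mpd k F = fun x y t =>
  \matrix_(i, j) pd k (fun x y t => F x y t i j) x y t.
Proof. by rewrite /mpd locked_withE. Qed.

Lemma mpdE k p q (F : mfield p q) x y t i j :
  mpd k F x y t i j = pd k (fun x y t => F x y t i j) x y t.
Proof. by rewrite mpd_unlock mxE. Qed.

Lemma melem_cst p q (A : 'M[R[i]]_(p, q)) : melem (fun _ _ _ => A).
Proof. by move=> i j; apply: elem_cst. Qed.

Lemma melemD p q (F G : mfield p q) : melem F -> melem G ->
  melem (fun x y t => F x y t + G x y t).
Proof.
move=> eF eG i j.
rewrite (_ : (fun x y t => _) = fun x y t => F x y t i j + G x y t i j).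
  exact: elemD.
by do 3 (apply/funext => ?); rewrite mxE.
Qed.

Lemma melemZ p q (f : sfield R) (F : mfield p q) : elem f -> melem F ->
  melem (fun x y t => f x y t *: F x y t).
Proof.
move=> ef eF i j.
rewrite (_ : (fun x y t => _) = fun x y t => f x y t * F x y t i j).
  exact: elemM.
by do 3 (apply/funext => ?); rewrite mxE.
Qed.

Lemma melemM p q r (F : mfield p q) (G : mfield q r) : melem F -> melem G ->
  melem (fun x y t => F x y t *m G x y t).
Proof.
move=> eF eG i j.
rewrite (_ : (fun x y t => _) = fun x y t => \sum_k F x y t i k * G x y t k j).
  by apply: elem_sum => k; apply: elemM.
by do 3 (apply/funext => ?); rewrite mxE.
Qed.

Lemma melem_adj p q (F : mfield p q) : melem F ->
  melem (fun x y t => (F x y t)^t*).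
Proof.
move=> eF i j.
rewrite (_ : (fun x y t => _) = fun x y t => (F x y t j i)^*%C).
  exact: elem_conj.
by do 3 (apply/funext => ?); rewrite !mxE.
Qed.

Lemma melem_mpd k p q (F : mfield p q) : melem F -> melem (mpd k F).
Proof.
move=> eF i j.
rewrite (_ : (fun x y t => _) = pd k (fun x y t => F x y t i j)).
  exact: elem_pd.
by do 3 (apply/funext => ?); rewrite mpdE.
Qed.

Lemma mpd_cst k p q (A : 'M[R[i]]_(p, q)) :
  mpd k (fun _ _ _ => A) = fun _ _ _ => 0.
Proof.
by do 3 (apply/funext => ?); apply/matrixP => i j; rewrite !(mxE, mpdE) pd_cst.
Qed.

Lemma mpdD k p q (F G : mfield p q) : melem F -> melem G ->
  mpd k (fun x y t => F x y t + G x y t) = fun x y t => mpd k F x y t + mpd k G x y t.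
Proof.
move=> eF eG; do 3 (apply/funext => ?); apply/matrixP => i j; rewrite !(mxE, mpdE).
rewrite (_ : (fun x y t => _) = fun x y t => F x y t i j + G x y t i j).
  by rewrite pdD.
by do 3 (apply/funext => ?); rewrite mxE.
Qed.

Lemma mpdZ k p q c (F : mfield p q) : melem F ->
  mpd k (fun x y t => c *: F x y t) = fun x y t => c *: mpd k F x y t.
Proof.
move=> eF; do 3 (apply/funext => ?); apply/matrixP => i j; rewrite !(mxE, mpdE).
rewrite (_ : (fun x y t => _) = fun x y t => c * F x y t i j).
  rewrite (pdM _ (elem_cst c)) // pd_cst; by rewrite mul0r add0r.
by do 3 (apply/funext => ?); rewrite mxE.
Qed.

Lemma mpdM k p q r (F : mfield p q) (G : mfield q r) : melem F -> melem G ->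
  mpd k (fun x y t => F x y t *m G x y t) =
  fun x y t => mpd k F x y t *m G x y t + F x y t *m mpd k G x y t.
Proof.
move=> eF eG; do 3 (apply/funext => ?); apply/matrixP => i j; rewrite !(mxE, mpdE).
rewrite (_ : (fun x y t => _) = fun x y t => \sum_l F x y t i l * G x y t l j).
  rewrite pd_sum; last by move=> l; apply: elemM.
  by rewrite -big_split; apply: eq_bigr => l _; rewrite pdM // !mpdE.
by do 3 (apply/funext => ?); rewrite mxE.
Qed.

Lemma mpd_adj k p q (F : mfield p q) : melem F ->
  mpd k (fun x y t => (F x y t)^t*) = fun x y t => (mpd k F x y t)^t*.
Proof.
move=> eF; do 3 (apply/funext => ?); apply/matrixP => i j; rewrite !(mxE, mpdE).
rewrite (_ : (fun x y t => _) = fun x y t => (F x y t j i)^*%C).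
  by rewrite pd_conj.
by do 3 (apply/funext => ?); rewrite !(mxE, mpdE).
Qed.

Lemma mpdC k l p q (F : mfield p q) : melem F ->
  mpd k (mpd l F) = mpd l (mpd k F).
Proof.
move=> eF; do 3 (apply/funext => ?); apply/matrixP => i j; rewrite !(mxE, mpdE).
have h k' : (fun x y t => mpd k' F x y t i j) = pd k' (fun x y t => F x y t i j).
  by do 3 (apply/funext => ?); rewrite mpdE.
by rewrite !h pdC.
Qed.

Lemma DxE n (F : stfield R n) : Dx F = mpd 0 F. Proof. by rewrite mpd_unlock. Qed.
Lemma DyE n (F : stfield R n) : Dy F = mpd 1 F. Proof. by rewrite mpd_unlock. Qed.
Lemma DtE n (F : stfield R n) : Dt F = mpd 2 F. Proof. by rewrite mpd_unlock. Qed.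

(** The class is closed under partial derivatives, so each order of differentiability reduces to the
    previous one for the derivatives. *)
Lemma melem_smooth n (F : stfield R n) : melem F -> smooth F.
Proof.
move=> eF k; elim: k F eF => [|k IH] F eF /=.
  by move=> i j; exact: (elem_continuous (eF i j)).
split.
- by move=> i j; exact: (elem_continuous (eF i j)).
- move=> x y t; split => i j; split.
  + by have [h _] := elem_pdP 0 (eF i j) x y t; case: h.
  + by have [_ h] := elem_pdP 0 (eF i j) x y t; case: h.
  + by have [h _] := elem_pdP 1 (eF i j) x y t; case: h.
  + by have [_ h] := elem_pdP 1 (eF i j) x y t; case: h.
  + by have [h _] := elem_pdP 2 (eF i j) x y t; case: h.
  + by have [_ h] := elem_pdP 2 (eF i j) x y t; case: h.
- by rewrite DxE; exact: IH (melem_mpd 0 eF).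
- by rewrite DyE; exact: IH (melem_mpd 1 eF).
- by rewrite DtE; exact: IH (melem_mpd 2 eF).
Qed.

End MatrixFields.

(** * The Ward equation from a potential *)

Section WardPotential.
Local Open Scope ring_scope.
Local Open Scope complex_scope.
Local Open Scope sesquilinear_scope.
Variables (R : realType) (n : nat).

(* The Ward equation is the symmetry of the mixed derivatives of K. *)
Lemma ward_eq_potential (J K : stfield R n) (A0 : 'M[R[i]]_n) :
  melem J -> melem K -> (forall x y t, J x y t \is unitarymx) ->
  (forall x y t, invmx (J x y t) *m (mpd 2 J x y t + mpd 1 J x y t)
                 = mpd 0 K x y t + A0) ->
  (forall x y t, invmx (J x y t) *m mpd 0 J x y t
                 = mpd 2 K x y t - mpd 1 K x y t + A0) ->
  ward_eq J.
Proof.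
move=> eJ eK uJ hu hx.
have iJ x y t : invmx (J x y t) = (J x y t)^t* by exact: invmx_unitary.
have eJs := melem_adj eJ.
pose p k : mfield R n n := fun x y t => (J x y t)^t* *m mpd k J x y t.
have ep k : melem (p k) by apply: melemM => //; apply: melem_mpd.
have lderE k : lder J (mpd k J) = p k.
  by do 3 (apply/funext => ?); rewrite /lder iJ.
have eKd k : melem (mpd k K) by apply: melem_mpd.
have Js k x y t : mpd k (fun x y t => (J x y t)^t*) x y t
    = - (p k x y t *m (J x y t)^t*).
  have JJ : (fun x y t => (J x y t)^t* *m J x y t) = fun _ _ _ => 1%:M.
    do 3 (apply/funext => ?); rewrite -iJ mulVmx //; exact: unitarymx_unit.
  have := congr1 (fun F => mpd k F x y t) JJ.
  rewrite mpdM // mpd_cst => /eqP; rewrite addr_eq0 => /eqP h.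
  have JJ' : J x y t *m (J x y t)^t* = 1%:M by exact/unitarymxP.
  by rewrite -[LHS]mulmx1 -JJ' mulmxA h mulNmx.
have dp k l x y t : mpd k (p l) x y t =
    - (p k x y t *m p l x y t) + (J x y t)^t* *m mpd k (mpd l J) x y t.
  rewrite mpdM //; last exact: melem_mpd.
  by rewrite Js mulNmx mulmxA.
(* With d_u = d_t + d_y and d_v = d_t - d_y, [h1] and [h2] are J^{-1} J_u = K_x + A0 and J^{-1} J_x
   = K_v + A0. *)
have h1 : (fun x y t => p 2 x y t + p 1 x y t) = fun x y t => mpd 0 K x y t + A0.
  by do 3 (apply/funext => ?); rewrite -hu iJ mulmxDr.
have h2 : p 0 = fun x y t => (mpd 2 K x y t + (- 1) *: mpd 1 K x y t) + A0.
  by do 3 (apply/funext => ?); rewrite /p -iJ hx scaleN1r.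
clearbody p.
move=> x y t; rewrite !(DtE, DxE, DyE) !lderE.
have e1 k : mpd k (p 2) x y t + mpd k (p 1) x y t = mpd k (mpd 0 K) x y t.
  have := congr1 (fun F => mpd k F x y t) h1.
  by rewrite mpdD // mpdD ?mpd_cst ?addr0 //; exact: melem_cst.
have e2 : mpd 0 (p 0) x y t = mpd 2 (mpd 0 K) x y t - mpd 1 (mpd 0 K) x y t.
  have eN : melem (fun x y t => -1 *: mpd 1 K x y t).
    by apply: melemZ => //; exact: elem_cst.
  rewrite {1}h2 mpdD ?mpd_cst ?addr0; [|exact: melemD|exact: melem_cst].
  rewrite mpdD // mpdZ // scaleN1r.
  by rewrite (mpdC 0 2 eK) (mpdC 0 1 eK).
(* Once K is eliminated, the Ward equation says d_y p_t - d_t p_y = [p_t, p_y], the flatness of p =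
   J^{-1} dJ. Here u, v, w stand for J^{-1} times the second derivatives tt, ty, yy; the single v
   encodes the symmetry of the mixed one. *)
have cancel (aa bb ab ba u v w : 'M[R[i]]_n) :
    (- aa + u) - ((- aa + u + (- ab + v)) - (- ba + v + (- bb + w)))
    - (- bb + w) - (ab - ba) = 0.
  by apply/matrixP => i j; rewrite !mxE; ring.
rewrite e2 -(e1 2%N) -(e1 1%N) (dp 2 2 x y t)%N (dp 2 1 x y t)%N (dp 1 2 x y t)%N.
rewrite (dp 1 1 x y t)%N (mpdC 1 2 eJ).
exact: cancel.
Qed.

End WardPotential.

(** * Dressing matrices *)

Section LineProjections.
Local Open Scope ring_scope.
Local Open Scope complex_scope.
Local Open Scope sesquilinear_scope.
Variable R : realType.

Definition sqnorm n (v : 'cV[R[i]]_n) : R[i] := (v^t* *m v) 0 0.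

Lemma sqnorm_eq0 n (v : 'cV[R[i]]_n) : (sqnorm v == 0) = (v == 0).
Proof.
apply/eqP/eqP => [|->]; last by rewrite /sqnorm mulmx0 mxE.
rewrite /sqnorm mxE => h; apply/matrixP => i j; rewrite ord1 [RHS]mxE.
have h0 k : true -> 0 <= v^t* 0 k * v k 0.
  by move=> _; rewrite !mxE mulrC mulcJ_ge0.
have := psumr_eq0P h0 h (i := i) isT.
by rewrite !mxE => /eqP; rewrite mulf_eq0 conjc_eq0 orbb => /eqP.
Qed.

(* The Hermitian projection onto the line of v, and 0 for v = 0. *)
Definition lproj n (v : 'cV[R[i]]_n) : 'M[R[i]]_n := (sqnorm v)^-1 *: (v *m v^t*).

Lemma adjM m n p (A : 'M[R[i]]_(m, n)) (B : 'M[R[i]]_(n, p)) :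
  (A *m B)^t* = B^t* *m A^t*.
Proof. by rewrite trmx_mul map_mxM. Qed.

Lemma adjZ m n c (A : 'M[R[i]]_(m, n)) : (c *: A)^t* = c^*%C *: A^t*.
Proof. by apply/matrixP => i j; rewrite !mxE rmorphM. Qed.

Lemma adjD m n (A B : 'M[R[i]]_(m, n)) : (A + B)^t* = A^t* + B^t*.
Proof. by apply/matrixP => i j; rewrite !mxE rmorphD. Qed.

Lemma adjN m n (A : 'M[R[i]]_(m, n)) : (- A)^t* = - A^t*.
Proof. by apply/matrixP => i j; rewrite !mxE rmorphN. Qed.

Lemma adj1 n : (1%:M : 'M[R[i]]_n)^t* = 1%:M.
Proof. by rewrite trmx1 map_mx1. Qed.

Lemma sqnorm_conj n (v : 'cV[R[i]]_n) : (sqnorm v)^*%C = sqnorm v.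
Proof.
rewrite /sqnorm mxE rmorph_sum; apply: eq_bigr => i _.
by rewrite !mxE rmorphM mulrC; congr (_ * _); exact: conjcK.
Qed.

Lemma lproj_herm n (v : 'cV[R[i]]_n) : (lproj v)^t* = lproj v.
Proof. rewrite /lproj adjZ adjM trmxCK. by rewrite conjc_inv sqnorm_conj. Qed.

Lemma lproj_id n (v : 'cV[R[i]]_n) : lproj v *m v = v.
Proof.
have [->|v0] := eqVneq v 0; first by rewrite mulmx0.
rewrite -scalemxAl -mulmxA [v^t* *m v]mx11_scalar -/(sqnorm v) mul_mx_scalar.
by rewrite scalerA mulVf ?scale1r // sqnorm_eq0.
Qed.

Lemma lproj_idem n (v : 'cV[R[i]]_n) : lproj v *m lproj v = lproj v.
Proof. by rewrite {2}/lproj -scalemxAr mulmxA lproj_id. Qed.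

Lemma lprojZ n c (v : 'cV[R[i]]_n) : c != 0 -> lproj (c *: v) = lproj v.
Proof.
move=> c0; rewrite /lproj adjZ -scalemxAl -scalemxAr !scalerA; congr (_ *: _).
have -> : sqnorm (c *: v) = c^*%C * c * sqnorm v.
  by rewrite /sqnorm adjZ -scalemxAl -scalemxAr scalerA [LHS]mxE.
have [->|v0] := eqVneq (sqnorm v) 0; first by rewrite mulr0 invr0 !mul0r.
have c0' : c^*%C != 0 by rewrite conjc_eq0.
by field; rewrite c0 c0' v0.
Qed.

Lemma lproj_unitary n (S : 'M[R[i]]_n) (v : 'cV[R[i]]_n) :
  S^t* *m S = 1%:M -> lproj (S *m v) = S *m lproj v *m S^t*.
Proof.
move=> SS; rewrite /lproj /sqnorm adjM mulmxA -(mulmxA (v^t*) (S^t*)) SS mulmx1.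
by rewrite -scalemxAr -scalemxAl !mulmxA.
Qed.

(** Two Hermitian idempotents with the same range coincide: P Q = Q and Q P = P, and the adjoint of
    the second equation is P Q = P. This replaces the projection of the definitions by an explicit
    rational formula. *)
Lemma hproj_lproj n k (A : 'M[R[i]]_(n, k)) (v : 'cV[R[i]]_n) :
  (A^T :=: v^T)%MS -> hproj A = lproj v.
Proof.
move=> Av; set P := hproj A; set Q := lproj v.
have PQ : P *m Q = Q.
  have /submxP[D hD] : (v^T <= P^T)%MS by rewrite hproj_colspace Av.
  have {}hD : v = P *m D^T by rewrite -[v]trmxK hD trmx_mul trmxK.
  by rewrite /Q /lproj -scalemxAr mulmxA [in P *m v]hD mulmxA hproj_idem -hD.
have QP : Q *m P = P.
  have /submxP[D hD] : (P^T <= v^T)%MS by rewrite hproj_colspace Av.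
  have {}hD : P = v *m D^T by rewrite -[P]trmxK hD trmx_mul trmxK.
  by rewrite [in LHS]hD mulmxA lproj_id -hD.
have := congr1 (fun M : 'M[R[i]]_n => M^t*) QP.
by rewrite adjM hproj_herm lproj_herm PQ.
Qed.

(** Makes [pi_tilde] explicit: the image of a line under X is spanned by the image of a spanning
    vector. *)
Lemma hproj_mul n (X : 'M[R[i]]_n) (v : 'cV[R[i]]_n) :
  hproj (X *m hproj v) = lproj (X *m v).
Proof.
apply: hproj_lproj; rewrite !trmx_mul.
exact: eqmxMr (hproj_colspace v).
Qed.

End LineProjections.

(** * Two by two matrices *)

Section TwoByTwo.
Local Open Scope ring_scope.
Local Open Scope complex_scope.
Local Open Scope sesquilinear_scope.

Lemma sum2 (V : nmodType) (f : 'I_2 -> V) : \sum_i f i = f 0 + f 1.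
Proof. by rewrite !big_ord_recl big_ord0 addr0; congr (_ + f _); apply/val_inj. Qed.

Lemma mul2E (K : pzRingType) p q (A : 'M[K]_(p, 2)) (B : 'M[K]_(2, q)) i j :
  (A *m B) i j = A i 0 * B 0 j + A i 1 * B 1 j.
Proof. by rewrite mxE sum2. Qed.

Lemma det2 (K : comPzRingType) (A : 'M[K]_2) :
  \det A = A 0 0 * A 1 1 - A 0 1 * A 1 0.
Proof.
rewrite (expand_det_row _ 0) sum2 /cofactor !det_mx11 !mxE /=.
rewrite addn0 expr0 expr1 mul1r mulN1r mulrN.
by congr (_ * A _ _ - _ * A _ _); apply/val_inj.
Qed.

Lemma ord2P (i : 'I_2) : i = 0 \/ i = 1.
Proof. by case: i => [[|[|//]] h]; [left|right]; apply/val_inj. Qed.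

Lemma mx2P (K : Type) (A B : 'M[K]_2) : A 0 0 = B 0 0 -> A 0 1 = B 0 1 ->
  A 1 0 = B 1 0 -> A 1 1 = B 1 1 -> A = B.
Proof.
by move=> h00 h01 h10 h11; apply/matrixP => i j;
  case: (ord2P i) => ->; case: (ord2P j) => ->.
Qed.

Lemma cV2P (K : Type) (A B : 'cV[K]_2) : A 0 0 = B 0 0 -> A 1 0 = B 1 0 -> A = B.
Proof.
by move=> h0 h1; apply/matrixP => i j; rewrite (ord1 j); case: (ord2P i) => ->.
Qed.

Variable R : realType.

Lemma cabs_mul_conj (z : R[i]) : z * z^*%C = (cabs z ^+ 2)%:C.
Proof. by rewrite -sqr_normc rmorphXn /=. Qed.

Lemma lproj2E (v : 'cV[R[i]]_2) i j : lproj v i j = v i 0 * (v j 0)^*%C / sqnorm v.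
Proof. by rewrite /lproj mxE mxE big_ord1 !mxE mulrC. Qed.

Lemma sqnorm2E (v : 'cV[R[i]]_2) :
  sqnorm v = v 0 0 * (v 0 0)^*%C + v 1 0 * (v 1 0)^*%C.
Proof. by rewrite /sqnorm mul2E !mxE /= [_ * v 0 0]mulrC [_ * v 1 0]mulrC. Qed.

Lemma lproj_tr (v : 'cV[R[i]]_2) : v != 0 -> lproj v 1 1 = 1 - lproj v 0 0.
Proof.
rewrite -sqnorm_eq0 => v0; rewrite !lproj2E.
by move: v0; rewrite sqnorm2E => v0; field.
Qed.

(** The inverse is the adjugate because the determinant is 1, and the adjoint because W is unitary;
    the entries of the two are compared. *)
Lemma SU2_entries (W : 'M[R[i]]_2) : SUmx W ->
  W 1 1 = (W 0 0)^*%C /\ W 1 0 = - (W 0 1)^*%C.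
Proof.
move=> [uW dW].
have h : W^t* = \matrix_(i, j) (if i == j then W (1 - i) (1 - j) else - W i j).
  rewrite -invmx_unitary // -[LHS]mulmx1.
  apply: (canLR (mulKmx (unitarymx_unit uW))).
  move: dW; rewrite det2 => dW.
  apply: mx2P; rewrite mul2E !mxE /= ?subr0 ?subrr.
  - by rewrite -[in LHS]dW; ring.
  - by ring.
  - by ring.
  - by rewrite -[in LHS]dW; ring.
have := congr1 (fun M : 'M[R[i]]_2 => M 0 0) h; have := congr1 (fun M : 'M[R[i]]_2 => M 1 0) h.
rewrite !mxE /= subr0 => h1 h2; split; first exact: esym h2.
by apply: oppr_inj; rewrite opprK; exact: esym h1.
Qed.

End TwoByTwo.

(** * The dressing matrix as a function of the spectral parameter *)

Section Dressing.
Local Open Scope ring_scope.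
Local Open Scope complex_scope.
Local Open Scope sesquilinear_scope.
Variable R : realType.

(** Matrices a (1 - P) + b P multiply like their pairs of eigenvalues. Invertibility, unitarity and
    the value at 0 of the factors below come from this. *)
Lemma idem_mul n (P : 'M[R[i]]_n) a b c d : P *m P = P ->
  (a *: (1%:M - P) + b *: P) *m (c *: (1%:M - P) + d *: P) =
  (a * c) *: (1%:M - P) + (b * d) *: P.
Proof.
move=> PP.
have hP : (1%:M - P) *m P = 0 by rewrite mulmxBl mul1mx PP subrr.
have Ph : P *m (1%:M - P) = 0 by rewrite mulmxBr mulmx1 PP subrr.
have hh : (1%:M - P) *m (1%:M - P) = 1%:M - P by rewrite mulmxBr mulmx1 hP subr0.
move: (1%:M - P) hP Ph hh => Q hP Ph hh.
rewrite mulmxDl !mulmxDr -!scalemxAl -!scalemxAr hh hP Ph PP !scaler0 addr0 add0r.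
by rewrite !scalerA.
Qed.

Lemma idem_scalar n (P : 'M[R[i]]_n) a : a *: (1%:M - P) + a *: P = a%:M.
Proof. by rewrite -scalerDr subrK scalemx1. Qed.

Lemma hfactor_unit n (z lam : R[i]) (P : 'M[R[i]]_n) : P *m P = P ->
  lam != z -> lam != z^*%C -> hfactor z P lam \in unitmx.
Proof.
move=> PP h1 h2; set b := (lam - z) / (lam - z^*%C).
have b0 : b != 0 by rewrite mulf_neq0 ?invr_eq0 ?subr_eq0.
suff /mulmx1_unit[] : hfactor z P lam *m (1 *: (1%:M - P) + b^-1 *: P) = 1%:M by [].
rewrite /hfactor -/b -[X in (X + _) *m _]scale1r idem_mul //.
by rewrite mulfV // mulr1 idem_scalar.
Qed.

Lemma hfactor_kernel n (z : R[i]) (v : 'cV[R[i]]_n) :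
  hfactor z (lproj v) z *m v = 0.
Proof.
rewrite /hfactor subrr mul0r scale0r addr0 mulmxBl mul1mx lproj_id.
by rewrite subrr.
Qed.

(** The factor by which one transformation multiplies the Ward map on the right. Its eigenvalues
    conj z / |z| and z / |z| are unimodular with product 1. *)
Definition kfactor n (z : R[i]) (Q : 'M[R[i]]_n) : 'M[R[i]]_n :=
  (cabs z)^-1%:C *: (z^*%C *: Q + z *: (1%:M - Q)).

Lemma cabs_eq0 (z : R[i]) : (cabs z == 0) = (z == 0).
Proof.
apply/eqP/eqP => [|->]; last exact: ComplexField.Normc.normc0.
exact: ComplexField.Normc.eq0_normc.
Qed.

Lemma cabs_ge0 (z : R[i]) : 0 <= cabs z.
Proof. by case: z => a b; exact: sqrtr_ge0. Qed.

Lemma cabs_gt0 (z : R[i]) : (0 < cabs z) = (z != 0).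
Proof. by rewrite lt_def cabs_eq0 cabs_ge0 andbT. Qed.

Lemma kfactor_SU (z : R[i]) (v : 'cV[R[i]]_2) : z != 0 -> v != 0 ->
  SUmx (kfactor z (lproj v)).
Proof.
move=> z0 v0; set Q := lproj v.
have QQ : Q *m Q = Q := lproj_idem v.
have Qh : Q^t* = Q := lproj_herm v.
have c0 : (cabs z)%:C != 0 :> R[i].
  by rewrite (inj_eq (@complexI _) _ 0) cabs_eq0.
have zz : z * z^*%C = (cabs z)%:C * (cabs z)%:C.
  by rewrite cabs_mul_conj expr2 rmorphM.
have VC : (cabs z)^-1%:C = ((cabs z)%:C)^-1 :> R[i] by rewrite fmorphV.
split.
  clearbody Q; apply/unitarymxP; rewrite /kfactor adjZ adjD !adjZ adjD adjN adj1 Qh conjcK.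
  rewrite conjc_real -scalemxAl -scalemxAr [z^*%C *: Q + _]addrC.
  rewrite [z *: Q + _]addrC idem_mul // [z^*%C * z]mulrC idem_scalar.
  by rewrite !scale_scalar_mx zz VC (_ : _ * _ = 1) //; field.
(* [hd] and [Q11] say that Q has determinant 0 and trace 1; the trace uses v != 0. *)
have hd : Q 0 1 * Q 1 0 = Q 0 0 * Q 1 1 by rewrite /Q !lproj2E; ring.
have Q11 : Q 1 1 = 1 - Q 0 0 := lproj_tr v0.
clearbody Q; rewrite Q11 in hd.
rewrite det2 /kfactor !mxE /= ?mulr1n ?mulr0n Q11.
transitivity ((cabs z)^-1%:C * (cabs z)^-1%:C * (z * z^*%C) : R[i]).
  transitivity ((cabs z)^-1%:C * (cabs z)^-1%:C * (
     (z^*%C * Q 0 0 + z * (1 - Q 0 0)) * (z^*%C * (1 - Q 0 0) + z * Q 0 0)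
     - (z^*%C - z) ^+ 2 * (Q 0 1 * Q 1 0)) : R[i]); first by ring.
  by rewrite hd; ring.
by rewrite zz VC; field.
Qed.

(** At lambda = 0 the factor has eigenvalues 1 and z / conj z, which [kfactor] brings to the common
    value z / |z|. *)
Lemma kfactor_hfactor n (z : R[i]) (Q : 'M[R[i]]_n) : z != 0 -> Q *m Q = Q ->
  kfactor z Q *m hfactor z Q 0 = (z / (cabs z)%:C)%:M.
Proof.
move=> z0 QQ; rewrite /kfactor /hfactor !sub0r invrN mulrNN.
have z0' : z^*%C != 0 by rewrite conjc_eq0.
rewrite -scalemxAl [z^*%C *: Q + _]addrC -[X in _ *m (X + _)]scale1r idem_mul //.
rewrite mulrCA mulfV // mulr1 idem_scalar scale_scalar_mx fmorphV.
by rewrite mulrC.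
Qed.

Implicit Types (z : nat -> R[i]) (w : nat -> 'cV[R[i]]_2) (s : nat).

(** The matrix G_s of the extended solution G_s psi_vac. The vectors w are meant to be already
    transported by psi_vac, so that the recursion does not mention the vacuum. *)
Fixpoint dress z w s (lam : R[i]) : 'M[R[i]]_2 :=
  if s is s'.+1
  then hfactor (z s) (lproj (dress z w s' (z s) *m w s)) lam *m dress z w s' lam
  else 1%:M.

Definition dvec z w s : 'cV[R[i]]_2 := dress z w s (z s.+1) *m w s.+1.

(** The matrix U_s of J_s = J_0 U_s. *)
Fixpoint udress z w s : 'M[R[i]]_2 :=
  if s is s'.+1 then udress z w s' *m kfactor (z s) (lproj (dvec z w s'))
  else 1%:M.

(** Only the lines spanned by the vectors matter. This allows (1, q) to be traded for (1/q, 1) at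
    the end where q is large. *)
Lemma dress_scale z w w' (c : nat -> R[i]) s lam :
  (forall i, c i != 0) -> (forall i, w' i = c i *: w i) ->
  dress z w' s lam = dress z w s lam.
Proof.
move=> c0 hw; elim: s lam => [//|s IH] lam /=.
by rewrite !IH hw -scalemxAr lprojZ.
Qed.

(** A constant unitary change of basis conjugates the whole construction; it is meant for the
    exchange of the two coordinates. *)
Lemma dress_unitary z w (S : 'M[R[i]]_2) s lam : S^t* *m S = 1%:M ->
  dress z (fun i => S *m w i) s lam = S *m dress z w s lam *m S^t*.
Proof.
move=> SS; have SS' : S *m S^t* = 1%:M by apply: mulmx1C.
elim: s lam => [|s IH] lam /=; first by rewrite mulmx1.
rewrite !IH -!mulmxA [S^t* *m (S *m w _)]mulmxA SS mul1mx lproj_unitary //.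
rewrite [hfactor _ (S *m _ *m _) _](_ : _ =
  S *m hfactor (z s.+1) (lproj (dress z w s (z s.+1) *m w s.+1)) lam *m S^t*).
  by rewrite -!mulmxA [S^t* *m (S *m _)]mulmxA SS mul1mx.
move: (lproj _) => P.
rewrite /hfactor mulmxDr mulmxDl mulmxBr mulmxBl mulmx1 SS'.
by rewrite -scalemxAr -scalemxAl.
Qed.

Definition regular z s (lam : R[i]) :=
  forall i, (1 <= i <= s)%N -> lam != (z i)^*%C.

Lemma regularS z s lam : regular z s.+1 lam -> regular z s lam.
Proof. by move=> h i /andP[i1 i2]; apply: h; rewrite i1 ltnW. Qed.

Section Generic.
Variables (z : nat -> R[i]) (n : nat).
(** The case i = k says that the nodes are not real; the other cases keep the poles conj z_k away
    from the nodes. *)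
Hypothesis z_nreal : forall i k,
  (1 <= i <= n)%N -> (1 <= k <= n)%N -> z i != (z k)^*%C.
Hypothesis z_inj : forall i k,
  (1 <= i <= n)%N -> (1 <= k <= n)%N -> z i = z k -> i = k.

Lemma regular_node s i : (s <= n)%N -> (1 <= i <= n)%N -> regular z s (z i).
Proof.
by move=> sn hi k /andP[k1 k2]; apply: z_nreal; rewrite // k1 (leq_trans k2).
Qed.

Lemma regular0 s : (s <= n)%N -> regular z s 0.
Proof.
move=> sn i /andP[i1 i2]; rewrite eq_sym conjc_eq0.
have hi : (1 <= i <= n)%N by rewrite i1 (leq_trans i2).
by have := z_nreal hi hi; apply: contraNneq => ->; rewrite conjc0.
Qed.

Lemma node_neq0 i : (1 <= i <= n)%N -> z i != 0.
Proof.
move=> /andP[i1 i2]; have := regular0 i2 (i := i).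
by rewrite i1 leqnn eq_sym conjc_eq0; apply.
Qed.

Variable w : nat -> 'cV[R[i]]_2.

Lemma dress_unit s lam : regular z s lam ->
  (forall i, (1 <= i <= s)%N -> lam != z i) -> dress z w s lam \in unitmx.
Proof.
elim: s => [_ _|s IH hr hz] /=; first exact: unitmx1.
rewrite unitmx_mul IH ?andbT.
- by apply: hfactor_unit; [exact: lproj_idem|apply: hz|apply: hr]; rewrite leqnn.
- exact: regularS hr.
- by move=> i /andP[i1 i2]; apply: hz; rewrite i1 ltnW.
Qed.

(** The new node differs from the earlier nodes and from their conjugates, so the matrix applied to
    the vector is invertible there. *)
Lemma dvec_neq0 s : (s < n)%N -> w s.+1 != 0 -> dvec z w s != 0.
Proof.
move=> sn; apply: contraNneq => h.
have u : dress z w s (z s.+1) \in unitmx.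
  apply: dress_unit; first by apply: regular_node; [exact: ltnW|].
  move=> i /andP[i1 i2]; apply/eqP => /z_inj h'.
  have /(_ _ _)/esym := h'; rewrite i1 (leq_trans i2 (ltnW sn)) => /(_ sn isT) e.
  by move: i2; rewrite e ltnn.
by rewrite -[w _](mulKmx u) -/(dvec z w s) h mulmx0.
Qed.

(** The i-th factor kills its own direction at z_i, and later factors multiply on the left. *)
Lemma dress_kernel s i : (1 <= i <= s)%N -> dress z w s (z i) *m w i = 0.
Proof.
move=> /andP[i1]; elim: s => [|s IH]; first by case: i i1.
rewrite leq_eqVlt => /orP[/eqP e|lt] /=.
  by rewrite e -mulmxA hfactor_kernel.
by rewrite -mulmxA IH // mulmx0.
Qed.

(** The product telescopes, since the innermost pair [kfactor], [hfactor] at 0 is a scalar. Hence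
    G(0) is the inverse of U up to a constant phase. *)
Lemma udress_dress0 s : (s <= n)%N ->
  udress z w s *m dress z w s 0 =
  (\prod_(i < s) (z i.+1 / (cabs (z i.+1))%:C))%:M.
Proof.
elim: s => [_|s IH sn] /=; first by rewrite mulmx1 big_ord0.
rewrite -mulmxA [kfactor _ _ *m _]mulmxA -/(dvec z w s) kfactor_hfactor.
- rewrite mul_scalar_mx -scalemxAr IH; last exact: ltnW.
  by rewrite big_ord_recr /= scale_scalar_mx mulrC.
- by apply: node_neq0.
- exact: lproj_idem.
Qed.

Lemma SUmx1 : SUmx (1%:M : 'M[R[i]]_2).
Proof. by split; rewrite ?det1 // ; apply/unitarymxP; rewrite adj1 mulmx1. Qed.

Lemma SUmxM (A B : 'M[R[i]]_2) : SUmx A -> SUmx B -> SUmx (A *m B).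
Proof.
by move=> [uA dA] [uB dB]; split; [exact: mul_unitarymx|rewrite det_mulmx dA dB mulr1].
Qed.

Lemma udress_SU s : (s <= n)%N -> (forall i, (1 <= i <= n)%N -> w i != 0) ->
  SUmx (udress z w s).
Proof.
move=> sn hw; elim: s sn => [_|s IH sn] /=; first exact: SUmx1.
apply: SUmxM; first exact/IH/ltnW.
by apply: kfactor_SU; [apply: node_neq0|apply: dvec_neq0 => //; apply: hw].
Qed.

Lemma hfactorE m (x lam : R[i]) (P : 'M[R[i]]_m) : lam != x^*%C ->
  hfactor x P lam = 1%:M + ((x^*%C - x) / (lam - x^*%C)) *: P.
Proof.
move=> h; rewrite /hfactor -addrA -scaleN1r -scalerDl; congr (_ + _ *: _).
have d0 : lam - x^*%C != 0 by rewrite subr_eq0.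
by field.
Qed.

(** Clearing the s simple poles leaves polynomials. As G tends to the identity at lambda = oo, the
    off-diagonal one loses a degree, so that s nodes suffice to interpolate it. The polynomial [q]
    is carried along because each step mixes the rows. *)
Lemma dress_col_poly s : exists p q : {poly R[i]},
  [/\ (size p <= s)%N, (size q <= s.+1)%N & forall lam, regular z s lam ->
   dress z w s lam 0 1 * \prod_(i < s) (lam - (z i.+1)^*%C) = p.[lam] /\
   dress z w s lam 1 1 * \prod_(i < s) (lam - (z i.+1)^*%C) = q.[lam]].
Proof.
elim: s => [|s [p [q [sp sq hpq]]]].
  exists 0, 1; rewrite size_poly0 size_poly1; split => // lam _.
  by rewrite big_ord0 !mxE /= mul0r mul1r horner0 hornerC.
set P := lproj (dvec z w s); set c := (z s.+1)^*%C - z s.+1.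
exists (p * ('X - ((z s.+1)^*%C)%:P) + c *: (P 0 0 *: p + P 0 1 *: q)).
exists (q * ('X - ((z s.+1)^*%C)%:P) + c *: (P 1 0 *: p + P 1 1 *: q)).
have sZ (r : {poly R[i]}) a m : (size r <= m)%N -> (size (a *: r) <= m)%N.
  by apply: leq_trans; exact: size_scale_leq.
have sX (r : {poly R[i]}) (a : R[i]) m : (size r <= m)%N ->
    (size (r * ('X - a%:P))%R <= m.+1)%N.
  move=> sr; apply: leq_trans (size_polyMleq _ _) _.
  by rewrite size_XsubC addn2.
split.
- apply: leq_trans (size_polyD _ _) _; rewrite geq_max sX //=.
  apply: (sZ _ _ _ _); apply: leq_trans (size_polyD _ _) _.
  by rewrite geq_max !sZ // ltnW.
- apply: leq_trans (size_polyD _ _) _; rewrite geq_max sX //=.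
  apply: (sZ _ _ _ _); apply: leq_trans (size_polyD _ _) _.
  by rewrite geq_max !sZ // ltnW // ltnW.
move=> lam hr; have [h1 h2] := hpq _ (regularS hr).
have hz : lam != (z s.+1)^*%C by apply: hr; rewrite leqnn.
have d0 : lam - (z s.+1)^*%C != 0 by rewrite subr_eq0.
rewrite /= -/(dvec z w s) -/P hfactorE // -/c; clearbody P c.
rewrite !big_ord_recr /= !hornerE -h1 -h2 !mul2E !mxE /= ?mulr1n ?mulr0n.
move: (\prod_(i < s) _) => pr.
by split; field.
Qed.

End Generic.

Lemma lagrange_interp (F : fieldType) m (x : 'I_m -> F) (p : {poly F}) a :
  injective x -> (size p <= m)%N ->
  p.[a] = \sum_i p.[x i] * \prod_(k < m | k != i) ((a - x k) / (x i - x k)).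
Proof.
move=> xinj sp.
pose L i := \prod_(k < m | k != i) ((x i - x k)^-1 *: ('X - (x k)%:P)).
have LE i b : (L i).[b] = \prod_(k < m | k != i) ((b - x k) / (x i - x k)).
  by rewrite horner_prod; apply: eq_bigr => k _; rewrite !hornerE mulrC.
pose r := p - \sum_i p.[x i] *: L i.
suff r0 : r = 0.
  have := congr1 (fun r : {poly F} => r.[a]) r0; rewrite hornerD hornerN horner0.
  move/eqP; rewrite subr_eq0 => /eqP ->; rewrite horner_sum.
  by apply: eq_bigr => i _; rewrite hornerZ LE.
have sL i : (size (L i) <= m)%N.
  have m0 : (0 < m)%N by case: (m) i => // -[].
  rewrite size_prod; last first.
    move=> k ki; rewrite scaler_eq0 invr_eq0 subr_eq0 polyXsubC_eq0 orbF.
    by apply: contra ki => /eqP/xinj ->.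
  rewrite (eq_bigr (fun=> 2%N)); last first.
    move=> k ki; rewrite size_scale ?size_XsubC // invr_eq0 subr_eq0.
    by apply: contra ki => /eqP/xinj ->.
  rewrite sum_nat_const cardC1 card_ord.
  lia.
have sr : (size r <= m)%N.
  apply: leq_trans (size_polyD _ _) _; rewrite geq_max sp size_polyN /=.
  apply: leq_trans (size_sum _ _ _) _; apply/bigmax_leqP => i _.
  exact: leq_trans (size_scale_leq _ _) (sL i).
apply/eqP; apply: contraT => r0.
have := max_poly_roots r0 (rs := [seq x i | i <- enum 'I_m]).
rewrite size_map size_enum_ord ltnNge sr => h; apply: h; last first.
  by rewrite map_inj_uniq // enum_uniq.
apply/allP => _ /mapP[i _ ->]; apply/eqP.
rewrite hornerD hornerN horner_sum (bigD1 i) //= big1 => [|k ki].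
  rewrite hornerZ LE big1 ?mulr1 ?addr0 ?subrr // => k ki.
  rewrite mulfV // subr_eq0; apply: contra ki => /eqP/xinj -> //.
by rewrite hornerZ LE (bigD1 i) 1?eq_sym //= subrr !mul0r mulr0.
Qed.

End Dressing.

(** * Orders of smallness in n parameters *)

Section SmallParameters.
Local Open Scope ring_scope.
Local Open Scope complex_scope.
Variables (R : realType) (n : nat).
Implicit Types (f g : (nat -> R[i]) -> R[i]) (k l : nat).

Lemma cabsD (x y : R[i]) : cabs (x + y) <= cabs x + cabs y.
Proof. exact: le_normcD. Qed.

Lemma cabsM (x y : R[i]) : cabs (x * y) = cabs x * cabs y.
Proof. exact: ComplexField.Normc.normcM. Qed.

Lemma cabsN (x : R[i]) : cabs (- x) = cabs x.
Proof. exact: normcN. Qed.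

Lemma cabsV (x : R[i]) : cabs x^-1 = (cabs x)^-1.
Proof. exact: ComplexField.Normc.normcV. Qed.

Lemma cabs_conj (x : R[i]) : cabs x^*%C = cabs x.
Proof. by case: x => a b; rewrite /cabs /= sqrrN. Qed.

Lemma cabs0 : cabs (0 : R[i]) = 0.
Proof. exact: ComplexField.Normc.normc0. Qed.

(** Uniform order of vanishing at the origin in the parameters e 1, ..., e n. The radius d is at
    most 1 so that a higher order implies a lower one. *)
Definition isO k f := exists C d : R, [/\ 0 <= C, 0 < d <= 1 &
  forall e rho, 0 <= rho <= d -> (forall i, (1 <= i <= n)%N -> cabs (e i) <= rho) ->
  cabs (f e) <= C * rho ^+ k].

Lemma isO_ext k f g : (forall e, f e = g e) -> isO k f -> isO k g.
Proof. by move=> fg [C [d [C0 d0 h]]]; exists C, d; split => // e; rewrite -fg; apply: h. Qed.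

Lemma isO_cst c : isO 0 (fun=> c).
Proof.
exists (cabs c), 1; split; rewrite ?cabs_ge0 ?ltr01 ?lexx // => e rho _ _.
by rewrite expr0 mulr1.
Qed.

Lemma isO_zero k : isO k (fun=> 0).
Proof.
exists 0, 1; split; rewrite ?ltr01 ?lexx // => e rho _ _.
by rewrite cabs0 mul0r.
Qed.

Lemma isO_var i : (1 <= i <= n)%N -> isO 1 (fun e => e i).
Proof.
move=> hi; exists 1, 1; split; rewrite ?ler01 ?ltr01 ?lexx // => e rho _ h.
by rewrite mul1r expr1 h.
Qed.

Lemma isOD k f g : isO k f -> isO k g -> isO k (fun e => f e + g e).
Proof.
move=> [C [d [C0 /andP[d0 d1] hf]]] [D [c [D0 /andP[c0 c1] hg]]].
exists (C + D), (Num.min c d); split.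
- exact: addr_ge0.
- by rewrite lt_min c0 d0 ge_min c1.
move=> e rho /andP[r0]; rewrite le_min => /andP[rc rd] h.
apply: le_trans (cabsD _ _) _; rewrite mulrDl.
by apply: lerD; [apply: hf|apply: hg]; rewrite ?r0.
Qed.

Lemma isOM k l f g : isO k f -> isO l g -> isO (k + l) (fun e => f e * g e).
Proof.
move=> [C [d [C0 /andP[d0 d1] hf]]] [D [c [D0 /andP[c0 c1] hg]]].
exists (C * D), (Num.min c d); split.
- exact: mulr_ge0.
- by rewrite lt_min c0 d0 ge_min c1.
move=> e rho /andP[r0]; rewrite le_min => /andP[rc rd] h.
rewrite cabsM exprD mulrACA.
by apply: ler_pM; rewrite ?cabs_ge0 //; [apply: hf|apply: hg]; rewrite ?r0.
Qed.

Lemma isOW k l f : (k <= l)%N -> isO l f -> isO k f.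
Proof.
move=> kl [C [d [C0 /andP[d0 d1] hf]]]; exists C, d; split; rewrite ?d0 //.
move=> e rho rd h; apply: le_trans (hf _ _ rd h) _.
case/andP: rd => r0 rd; apply: ler_wpM2l => //.
by apply: ler_wiXn2l => //; exact: le_trans rd d1.
Qed.

Lemma isO_conj k f : isO k f -> isO k (fun e => (f e)^*%C).
Proof.
move=> [C [d [C0 d0 hf]]]; exists C, d; split => // e rho rd h.
by rewrite cabs_conj; apply: hf.
Qed.

Lemma isO_scale k c f : isO k f -> isO k (fun e => c * f e).
Proof. by move=> h; have := isOM (isO_cst c) h. Qed.

Lemma isOMl k f g : isO k f -> isO 0 g -> isO k (fun e => f e * g e).
Proof. by move=> hf hg; have := isOM hf hg; rewrite addn0. Qed.

Lemma isOB k f g : isO k f -> isO k g -> isO k (fun e => f e - g e).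
Proof.
move=> hf hg; apply: isOD => //.
by apply: isO_ext (isO_scale (-1) hg) => e; rewrite mulN1r.
Qed.

Lemma isO_near k f c : isO k (fun e => f e - c) -> isO 0 f.
Proof.
move=> h; have h0 := isOW (leq0n k) h.
by apply: isO_ext (isOD h0 (isO_cst c)) => e; rewrite subrK.
Qed.

Lemma isO_inv f c : c != 0 -> isO 1 (fun e => f e - c) -> isO 0 (fun e => (f e)^-1).
Proof.
move=> c0 [C [d [C0 /andP[d0 d1] hf]]].
have ac : 0 < cabs c by rewrite cabs_gt0.
(* Within this radius (C + 1) rho <= |c| / 2, which keeps |f e| above |c| / 2; C + 1 replaces C to
   avoid a zero denominator. *)
pose b := cabs c / 2 / (C + 1).
have C1 : 0 < C + 1 by rewrite ltr_wpDl.
have b0 : 0 < b by rewrite !divr_gt0.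
exists (cabs c / 2)^-1, (Num.min d b); split.
- by rewrite invr_ge0 ltW // divr_gt0.
- by rewrite lt_min d0 b0 ge_min d1.
move=> e rho /andP[r0]; rewrite le_min => /andP[rd rb] h.
have {}hf : cabs (f e - c) <= cabs c / 2.
  apply: le_trans (hf e rho _ h) _; first by rewrite r0.
  rewrite expr1; apply: (@le_trans _ _ ((C + 1) * rho)).
    by apply: ler_wpM2r => //; rewrite lerDl.
  by rewrite mulrC -ler_pdivlMr.
have tri : cabs c <= cabs (f e) + cabs (f e - c).
  have -> : c = f e + - (f e - c) by ring.
  by apply: le_trans (cabsD _ _) _; rewrite cabsN opprB addrCA subrr addr0.
rewrite cabsV expr0 mulr1 lef_pV2 ?posrE ?divr_gt0 //; lra.
Qed.

Lemma isO_sum k (I : Type) (r : seq I) (f : I -> (nat -> R[i]) -> R[i]) :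
  (forall i, isO k (f i)) -> isO k (fun e => \sum_(i <- r) f i e).
Proof.
move=> hf; elim: r => [|i r IH].
  by apply: isO_ext (isO_zero k) => e; rewrite big_nil.
by apply: isO_ext (isOD (hf i) IH) => e; rewrite big_cons.
Qed.

End SmallParameters.

(** * Expansion of the dressing matrix near the line of e_2 *)

Section DressingAsymptotics.
Local Open Scope ring_scope.
Local Open Scope complex_scope.
Variables (R : realType) (z : nat -> R[i]) (n : nat).
Hypothesis z_nreal : forall i k,
  (1 <= i <= n)%N -> (1 <= k <= n)%N -> z i != (z k)^*%C.
Hypothesis z_inj : forall i k,
  (1 <= i <= n)%N -> (1 <= k <= n)%N -> z i = z k -> i = k.

Definition near_e2 (e : nat -> R[i]) (i : nat) : 'cV[R[i]]_2 :=
  \col_(k < 2) (if k == 0 then e i else 1).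

Lemma near_e2_neq0 e i : near_e2 e i != 0.
Proof.
apply/eqP => /(congr1 (fun M : 'cV[R[i]]_2 => M 1 0)); rewrite !mxE /=.
by apply/eqP; exact: oner_neq0.
Qed.

Local Notation G s lam i k := (fun e => dress z (near_e2 e) s lam i k).

(** When every line is that of e_2, G is diagonal with entries 1 and a Blaschke product. Orders add
    under products, which propagates the grading: odd order off the diagonal, even order for the
    corrections on it. All regular lambda are treated at once because each step needs the value at
    its own node. *)
Lemma dress_graded s : (s <= n)%N -> forall lam, regular z s lam ->
  [/\ isO n 2 (fun e => G s lam 0 0 e - 1), isO n 1 (G s lam 0 1),
      isO n 1 (G s lam 1 0)
    & isO n 2 (fun e => G s lam 1 1 e
         - \prod_(i < s) ((lam - z i.+1) / (lam - (z i.+1)^*%C)))].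
Proof.
elim: s => [_ lam _|s IH sn lam hr].
  rewrite big_ord0; split => /=.
  - by apply: isO_ext (isO_zero _ _ _) => e; rewrite mxE /= subrr.
  - by apply: isO_ext (isO_zero _ _ _) => e; rewrite mxE.
  - by apply: isO_ext (isO_zero _ _ _) => e; rewrite mxE.
  - by apply: isO_ext (isO_zero _ _ _) => e; rewrite mxE /= subrr.
have hs : (1 <= s.+1 <= n)%N by [].
have rz : regular z s (z s.+1) by apply: (regular_node z_nreal) => //; exact: ltnW.
(* The limit of the second coordinate of the new direction. It is nonzero at the new node, so the
   norm of the direction stays away from 0. *)
pose B x := \prod_(i < s) ((x - z i.+1) / (x - (z i.+1)^*%C)).
have B0 : B (z s.+1) != 0.
  apply/prodf_neq0 => i _.
  have hi : (1 <= i.+1 <= n)%N by rewrite (leq_ltn_trans _ sn) //; exact: ltnW.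
  rewrite mulf_neq0 ?invr_eq0 ?subr_eq0 ?z_nreal //.
  by apply/eqP => /(z_inj hs hi)[e]; have := ltn_ord i; rewrite -e ltnn.
pose v e := dvec z (near_e2 e) s.
have v0 e : v e != 0.
  by apply: (dvec_neq0 z_nreal z_inj) => //; exact: near_e2_neq0.
have vE e k : v e k 0 = dress z (near_e2 e) s (z s.+1) k 0 * e s.+1
                        + dress z (near_e2 e) s (z s.+1) k 1.
  by rewrite /v /dvec mul2E !mxE /= mulr1.
have [a1 a2 a3 a4] := IH (ltnW sn) _ rz.
have ve := isO_var R hs.
have v1 : isO n 1 (fun e => v e 0 0).
  apply: isO_ext (isOD (isOM (isO_near a1) ve) a2) => e; by rewrite vE.
have v2 : isO n 2 (fun e => v e 1 0 - B (z s.+1)).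
  by apply: isO_ext (isOD (isOM a3 ve) a4) => e; rewrite vE addrA.
have v2n := isO_near v2.
have nO : isO n 0 (fun e => (sqnorm (v e))^-1).
  apply: (isO_inv (c := B (z s.+1) * (B (z s.+1))^*%C)).
    by rewrite mulf_neq0 ?conjc_eq0.
  have h1 := isOM v1 (isO_conj v1).
  have h2 := isOMl v2 (isO_conj v2n).
  have h3 := isO_scale (B (z s.+1)) (isO_conj v2).
  apply: isOW (_ : (1 <= 2)%N) _ => //.
  apply: isO_ext (isOD h1 (isOD h2 h3)) => e; rewrite sqnorm2E rmorphB /=.
  by ring.
pose P e := lproj (v e).
have P00 : isO n 2 (fun e => P e 0 0).
  by apply: isO_ext (isOMl (isOM v1 (isO_conj v1)) nO) => e; rewrite /P lproj2E.
have P01 : isO n 1 (fun e => P e 0 1).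
  by apply: isO_ext (isOMl (isOM v1 (isO_conj v2n)) nO) => e; rewrite /P lproj2E.
have P10 : isO n 1 (fun e => P e 1 0).
  by apply: isO_ext (isOMl (isOM v2n (isO_conj v1)) nO) => e; rewrite /P lproj2E.
have P11 e : P e 1 1 = 1 - P e 0 0 by exact: lproj_tr.
have hz : lam != (z s.+1)^*%C by apply: hr; rewrite leqnn.
have d0 : lam - (z s.+1)^*%C != 0 by rewrite subr_eq0.
set b := ((z s.+1)^*%C - z s.+1) / (lam - (z s.+1)^*%C).
(* 1 + b is the new Blaschke factor; it multiplies the lower right entry because P 1 1 tends to
   1. *)
have hb : (lam - z s.+1) / (lam - (z s.+1)^*%C) = 1 + b by rewrite /b; field.
have GE e i k : dress z (near_e2 e) s.+1 lam i k =
    dress z (near_e2 e) s lam i k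
    + b * (P e i 0 * dress z (near_e2 e) s lam 0 k
           + P e i 1 * dress z (near_e2 e) s lam 1 k).
  rewrite /= -/(dvec z (near_e2 e) s) hfactorE // -/b mulmxDl mul1mx -scalemxAl.
  by rewrite mxE [X in _ + X]mxE mul2E.
have [g1 g2 g3 g4] := IH (ltnW sn) _ (regularS hr).
have g1n := isO_near g1; have g4n := isO_near g4.
split.
- have h := isO_scale b (isOD (isOMl P00 g1n) (isOM P01 g3)).
  by apply: isO_ext (isOD g1 h) => e; rewrite GE addrAC.
- have h1 := isOW (isT : (1 <= 3)%N) (isOM P00 g2).
  have h := isO_scale b (isOD h1 (isOMl P01 g4n)).
  by apply: isO_ext (isOD g2 h) => e; rewrite GE.
- have h1 := isOW (isT : (1 <= 3)%N) (isOM P00 g3).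
  have h := isO_scale b (isOD (isOMl P10 g1n) (isOB g3 h1)).
  by apply: isO_ext (isOD g3 h) => e; rewrite GE P11; ring.
- rewrite big_ord_recr /= hb -/(B lam).
  have h1 := isO_scale b (isOB (isOM P10 g2) (isOMl P00 g4n)).
  by apply: isO_ext (isOD (isO_scale (1 + b) g4) h1) => e; rewrite GE P11 -/(B lam); ring.
Qed.

Lemma dress0_asymptotics : exists2 c : nat -> R[i], (forall i, (i < n)%N -> c i.+1 != 0) &
  isO n 2 (fun e => G n 0 0 0 e - 1) /\
  isO n 2 (fun e => G n 0 0 1 e + \sum_(i < n) c i.+1 * e i.+1).
Proof.
have r0 : regular z n 0 := regular0 z_nreal (leqnn n).
have d0 x : regular z n x -> \prod_(k < n) (x - (z k.+1)^*%C) != 0.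
  by move=> hx; apply/prodf_neq0 => k _; rewrite subr_eq0; apply: hx; rewrite ltn_ord.
pose D x := \prod_(k < n) (x - (z k.+1)^*%C).
pose L (i : nat) := \prod_(k < n | k.+1 != i) ((0 - z k.+1) / (z i - z k.+1)).
(* The Lagrange weight at 0, corrected by the denominators that were cleared at z_i and at 0. It is
   nonzero because the nodes are nonzero, distinct and different from the poles. *)
pose c i := D (z i) * L i / D 0.
have rz (i : 'I_n) : regular z n (z i.+1).
  by apply: (regular_node z_nreal) => //; rewrite ltn_ord.
have hi (i : 'I_n) : (1 <= i.+1 <= n)%N by rewrite ltn_ord.
exists c.
  move=> i lin; have /= rzi := rz (Ordinal lin).
  rewrite /c !mulf_neq0 ?invr_eq0 ?d0 //.
  apply/prodf_neq0 => k ki; rewrite mulf_neq0 ?invr_eq0 ?subr_eq0 //.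
    by rewrite eq_sym (node_neq0 z_nreal) ?ltn_ord.
  apply: contra ki => /eqP /(z_inj (hi (Ordinal lin)) (hi k)) /= e.
  by rewrite e.
have [g1 g2 _ _] := dress_graded (leqnn n) r0.
split => //.
(* An exact identity, from interpolation and the kernel relation G_01(z_i) = - e_i G_00(z_i). The
   right-hand side has order 1 + 2, of which order 2 is kept. *)
have E e : dress z (near_e2 e) n 0 0 1 + \sum_(i < n) c i.+1 * e i.+1 =
   \sum_(i < n) c i.+1 * e i.+1 * (-1) * (dress z (near_e2 e) n (z i.+1) 0 0 - 1).
  have [p [q [sp _ hp]]] := dress_col_poly z (near_e2 e) n.
  have [h0 _] := hp 0 r0.
  have xinj : injective (fun i : 'I_n => z i.+1).
    by move=> i k /(z_inj (hi i) (hi k))[e']; apply/val_inj.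
  have := lagrange_interp 0 xinj sp; rewrite -h0 => hL.
  have -> : dress z (near_e2 e) n 0 0 1 =
      - \sum_(i < n) c i.+1 * e i.+1 * dress z (near_e2 e) n (z i.+1) 0 0.
    apply: (mulIf (d0 _ r0)); rewrite hL -sumrN big_distrl /=.
    apply: eq_bigr => i _; have [<- _] := hp _ (rz i).
    have := dress_kernel z (near_e2 e) (hi i).
    move=> /(congr1 (fun M : 'cV[R[i]]_2 => M 0 0)).
    rewrite mul2E !mxE /= mulr1 => /eqP; rewrite addrC addr_eq0 => /eqP ->.
    rewrite -/(D 0) -/(D (z i.+1)) /c.
    have -> : \prod_(k < n | k != i) ((0 - z k.+1) / (z i.+1 - z k.+1)) = L i.+1.
      by apply: eq_bigl => k; rewrite eqSS.
    have D0 : D 0 != 0 by exact: d0.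
    by field.
  rewrite addrC -sumrB; apply: eq_bigr => i _; ring.
apply: isO_ext (fun e => esym (E e)) _.
apply: isO_sum => i; have [h _ _ _] := dress_graded (leqnn n) (rz i).
apply: isOW (isT : (2 <= 1 + 2)%N) _.
apply: isOM h.
apply: isO_ext (isO_scale (- c i.+1) (isO_var R (hi i))) => e; ring.
Qed.

End DressingAsymptotics.

(** * Backlund transformations *)

Section BacklundSystem.
Local Open Scope ring_scope.
Local Open Scope complex_scope.
Local Open Scope sesquilinear_scope.
Variable R : realType.

(** The triple holds the coefficients of d_x, d_y, d_t. As t = u + v and y = u - v, the derivatives
    along u and v are (0, 1, 1) and (0, -1, 1). *)
Definition dop (d : R * R * R) p q (F : mfield R p q) : mfield R p q := fun x y t =>
  d.1.1%:C *: mpd 0 F x y t + d.1.2%:C *: mpd 1 F x y t + d.2%:C *: mpd 2 F x y t.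

Lemma dopD d p q (F G : mfield R p q) x y t : melem F -> melem G ->
  dop d (fun x y t => F x y t + G x y t) x y t = dop d F x y t + dop d G x y t.
Proof.
move=> eF eG; rewrite /dop !mpdD //.
by apply/matrixP => i j; rewrite !mxE; ring.
Qed.

Lemma dopZ d p q c (F : mfield R p q) x y t : melem F ->
  dop d (fun x y t => c *: F x y t) x y t = c *: dop d F x y t.
Proof.
move=> eF; rewrite /dop !mpdZ //.
by apply/matrixP => i j; rewrite !mxE; ring.
Qed.

Lemma dopM d p q r (F : mfield R p q) (G : mfield R q r) x y t :
  melem F -> melem G -> dop d (fun x y t => F x y t *m G x y t) x y t =
  dop d F x y t *m G x y t + F x y t *m dop d G x y t.
Proof.
move=> eF eG; rewrite /dop !mpdM // !mulmxDl !mulmxDr -!scalemxAl -!scalemxAr.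
move: (mpd 0 F x y t *m G x y t) (mpd 1 F x y t *m G x y t).
move: (mpd 2 F x y t *m G x y t) (F x y t *m mpd 0 G x y t).
move: (F x y t *m mpd 1 G x y t) (F x y t *m mpd 2 G x y t) => *.
by apply/matrixP => i j; rewrite !mxE; ring.
Qed.

Lemma dop_adj d p q (F : mfield R p q) x y t : melem F ->
  dop d (fun x y t => (F x y t)^t*) x y t = (dop d F x y t)^t*.
Proof.
by move=> eF; rewrite /dop !mpd_adj // !adjD !adjZ !conjc_real.
Qed.

Lemma dop_cst d p q (A : 'M[R[i]]_(p, q)) x y t : dop d (fun _ _ _ => A) x y t = 0.
Proof. by rewrite /dop !mpd_cst !scaler0 !addr0. Qed.

(** Here P1, P2 and v1, v2 are derivatives of the projection P and of the vector v spanning its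
    line. The linear equation for v at lambda = z gives (1 - P)(z P1 - P2 - A) P = 0; the adjoint
    gives the other off-diagonal block, with conj z in place of z, and the claim is the sum of the
    two. *)
Lemma backlund_point n (z mu : R[i]) (P P1 P2 A : 'M[R[i]]_n)
    (v v1 v2 : 'cV[R[i]]_n) (r : 'rV[R[i]]_n) :
  P^t* = P -> P1^t* = P1 -> P2^t* = P2 -> A^t* = - A -> P = v *m r ->
  P *m v = v -> P1 *m P + P *m P1 = P1 -> P2 *m P + P *m P2 = P2 ->
  P1 *m v + P *m v1 = v1 -> P2 *m v + P *m v2 = v2 ->
  z *: v1 - v2 = A *m v + mu *: v ->
  z^*%C *: P1 - P2 + P *m A - A *m P - (z^*%C - z) *: (P1 *m P) = 0.
Proof.
move=> Ph P1h P2h Ah Pvr Pv d1 d2 e1 e2 ev.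
have h1 : z *: (P1 *m P) - P2 *m P = A *m P - P *m A *m P.
  have h : z *: (P1 *m v) - P2 *m v = A *m v - P *m A *m v.
    have {}e1 : P1 *m v = v1 - P *m v1 by rewrite -[X in X - _]e1 addrK.
    have {}e2 : P2 *m v = v2 - P *m v2 by rewrite -[X in X - _]e2 addrK.
    have -> : A *m v = z *: v1 - v2 - mu *: v by rewrite ev addrK.
    have hPA : P *m A *m v = z *: (P *m v1) - P *m v2 - mu *: v.
      apply: (addIr (mu *: v)); rewrite subrK scalemxAr -mulmxBr ev mulmxDr.
      by rewrite -scalemxAr Pv mulmxA.
    rewrite e1 e2 hPA; move: (P *m v1) (P *m v2) => a b.
    by apply/matrixP => i j; rewrite !mxE; ring.
  have := congr1 (fun u => u *m r) h.
  by rewrite !mulmxBl -scalemxAl -!mulmxA -Pvr.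
have h2 : z^*%C *: (P *m P1) - P *m P2 = P *m A *m P - P *m A.
  have := congr1 (fun M : 'M[R[i]]_n => M^t*) h1.
  rewrite !adjD !adjN adjZ !adjM Ph P1h P2h Ah => ->.
  by rewrite !(mulmxN, mulNmx) !mulmxA opprK addrC.
rewrite -{1}d1 -{1}d2.
move: h1 h2; move: (P1 *m P) (P *m P1) (P2 *m P) (P *m P2) => a b c d.
move: (A *m P) (P *m A) (P *m A *m P) => e f g h1 h2.
transitivity ((z *: a - c) - (e - g) + ((z^*%C *: b - d) - (g - f))).
  by apply/matrixP => i j; rewrite !mxE; ring.
by rewrite h1 h2 !subrr addr0.
Qed.

Variables (z : nat -> R[i]) (n : nat) (A0 : 'M[R[i]]_2) (mu : R[i]).
Variable w : nat -> mfield R 2 1.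
Hypothesis z_nreal : forall i k,
  (1 <= i <= n)%N -> (1 <= k <= n)%N -> z i != (z k)^*%C.
Hypothesis z_inj : forall i k,
  (1 <= i <= n)%N -> (1 <= k <= n)%N -> z i = z k -> i = k.
Hypothesis A0_skew : A0^t* = - A0.
Hypothesis w_elem : forall i, melem (w i).
Hypothesis w_neq0 : forall i x y t, w i x y t != 0.

Definition dressf s lam : mfield R 2 2 := fun x y t =>
  dress z (fun i => w i x y t) s lam.

Definition dvecf s : mfield R 2 1 := fun x y t => dvec z (fun i => w i x y t) s.

(** The linear system lambda d1 psi - d2 psi = A0 psi, taken for each vector at its node. The scalar
    mu allows for a rescaling of the vectors, such as the normalisation of a coordinate to 1. *)
Definition compatible d1 d2 := forall i, (1 <= i <= n)%N -> forall x y t,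
  z i *: dop d1 (w i) x y t - dop d2 (w i) x y t = (A0 + mu%:M) *m w i x y t.

Lemma lproj_melem (v : mfield R 2 1) : melem v -> (forall x y t, v x y t != 0) ->
  melem (fun x y t => lproj (v x y t)).
Proof.
move=> ev v0; apply: melemZ.
  apply: elemV; last by move=> x y t; rewrite sqnorm_eq0.
  by have := melemM (melem_adj ev) ev; apply.
by apply: melemM => //; exact: melem_adj.
Qed.

Lemma dress_melem s : (s <= n)%N -> forall lam, regular z s lam -> melem (dressf s lam).
Proof.
elim: s => [_ lam _|s IH sn lam hr]; first exact: melem_cst.
have hs : (1 <= s.+1 <= n)%N by [].
have hz : lam != (z s.+1)^*%C by apply: hr; rewrite leqnn.
have rz : regular z s (z s.+1) by apply: (regular_node z_nreal) => //; exact: ltnW.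
have eP : melem (fun x y t => lproj (dvecf s x y t)).
  apply: lproj_melem; first by apply: melemM => //; exact: IH (ltnW sn) _ rz.
  by move=> x y t; apply: (dvec_neq0 z_nreal z_inj).
have -> : dressf s.+1 lam = fun x y t => (1%:M
    + (((z s.+1)^*%C - z s.+1) / (lam - (z s.+1)^*%C)) *: lproj (dvecf s x y t))
    *m dressf s lam x y t.
  by do 3 (apply/funext => ?); rewrite -hfactorE.
apply: melemM; last exact: IH (ltnW sn) _ (regularS hr).
apply: melemD; first exact: melem_cst.
by apply: melemZ => //; exact: elem_cst.
Qed.

Lemma dvecf_melem s : (s < n)%N -> melem (dvecf s).
Proof.
move=> sn; apply: melemM => //; apply: dress_melem; first exact: ltnW.
by apply: (regular_node z_nreal) => //; exact: ltnW.
Qed.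

(* K is the coefficient of 1/lambda in the expansion of the dressing matrix at
   lambda = oo. *)
Lemma dress_system s : (s <= n)%N -> exists K : mfield R 2 2,
  [/\ melem K, forall x y t, (K x y t)^t* = - K x y t &
   forall d1 d2, compatible d1 d2 -> forall lam, regular z s lam -> forall x y t,
   lam *: dop d1 (dressf s lam) x y t - dop d2 (dressf s lam) x y t
   + dressf s lam x y t *m A0 = (dop d1 K x y t + A0) *m dressf s lam x y t].
Proof.
elim: s => [_|s IH sn].
  exists (fun _ _ _ => 0); split; first exact: melem_cst.
    by move=> x y t; rewrite trmx0 map_mx0 oppr0.
  move=> d1 d2 _ lam _ x y t.
  by rewrite !dop_cst scaler0 subrr !add0r mul1mx mulmx1.
have [K [eK Kh hK]] := IH (ltnW sn).
have hs : (1 <= s.+1 <= n)%N by [].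
have rz : regular z s (z s.+1) by apply: (regular_node z_nreal) => //; exact: ltnW.
set zz := z s.+1; set c := zz^*%C - zz.
pose P : mfield R 2 2 := fun x y t => lproj (dvecf s x y t).
have ev := dvecf_melem sn.
have eP : melem P.
  apply: lproj_melem => // x y t; exact: (dvec_neq0 z_nreal z_inj).
have ecP : melem (fun x y t => c *: P x y t) by apply: melemZ => //; exact: elem_cst.
exists (fun x y t => K x y t + c *: P x y t); split.
- exact: melemD.
- move=> x y t; rewrite adjD Kh adjZ lproj_herm opprD; congr (_ + _).
  by rewrite -scaleNr; congr (_ *: _); rewrite /c rmorphB /= conjcK opprB.
move=> d1 d2 hd lam hr x y t.
have hz : lam != zz^*%C by apply: hr; rewrite leqnn.
have dz : lam - zz^*%C != 0 by rewrite subr_eq0.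
set b := c / (lam - zz^*%C).
have eG := dress_melem (ltnW sn) (regularS hr).
have ePG := melemM eP eG.
have ebPG : melem (fun x y t => b *: (P x y t *m dressf s lam x y t)).
  by apply: melemZ => //; exact: elem_cst.
have GE : dressf s.+1 lam = fun x y t =>
    dressf s lam x y t + b *: (P x y t *m dressf s lam x y t).
  do 3 (apply/funext => ?).
  by rewrite {1}/dressf /= hfactorE // mulmxDl mul1mx -scalemxAl.
rewrite GE !dopD // !dopZ // !dopM //.
have h := hK _ _ hd _ (regularS hr) x y t.
have hzz := hK _ _ hd _ rz x y t.
(* Substituting G + b P G into the system, with b (lambda - conj z) = c, cancels all dependence on
   lambda and leaves exactly this identity. *)
have E : zz^*%C *: dop d1 P x y t - dop d2 P x y t
   + P x y t *m (dop d1 K x y t + A0) - (dop d1 K x y t + A0) *m P x y t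
   - (zz^*%C - zz) *: (dop d1 P x y t *m P x y t) = 0.
  (* The conditions on the derivatives come from differentiating P = P P, the Hermitian symmetry of
     P, and v = P v. *)
  have PP : P = fun x y t => P x y t *m P x y t.
    by do 3 (apply/funext => ?); rewrite lproj_idem.
  have Pa : P = fun x y t => (P x y t)^t*.
    by do 3 (apply/funext => ?); rewrite lproj_herm.
  have Pv : dvecf s = fun x y t => P x y t *m dvecf s x y t.
    by do 3 (apply/funext => ?); rewrite lproj_id.
  apply: (@backlund_point _ zz mu _ _ _ _ (dvecf s x y t)
    (dop d1 (dvecf s) x y t) (dop d2 (dvecf s) x y t)
    ((sqnorm (dvecf s x y t))^-1 *: (dvecf s x y t)^t*)).
  - exact: lproj_herm.
  - by rewrite -dop_adj // -Pa.
  - by rewrite -dop_adj // -Pa.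
  - rewrite adjD A0_skew opprD -dop_adj //.
    have -> : (fun x y t => (K x y t)^t*) = fun x y t => -1 *: K x y t.
      by do 3 (apply/funext => ?); rewrite Kh scaleN1r.
    by rewrite dopZ // scaleN1r.
  - by rewrite -scalemxAr.
  - exact: lproj_id.
  - by rewrite {5}PP dopM.
  - by rewrite {5}PP dopM.
  - by rewrite {3}Pv dopM.
  - by rewrite {3}Pv dopM.
  (* The direction v = G(z) w solves the system at the node z: the equation for G contributes A G -
     G A0, and the one for w contributes G (A0 + mu). *)
  have eGz := dress_melem (ltnW sn) rz.
  have -> : dvecf s = fun x y t => dressf s zz x y t *m w s.+1 x y t by [].
  rewrite !dopM // scalerDr opprD addrACA scalemxAl scalemxAr -mulmxBl -mulmxBr hd //.
  have -> : zz *: dop d1 (dressf s zz) x y t - dop d2 (dressf s zz) x y t =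
      (dop d1 K x y t + A0) *m dressf s zz x y t - dressf s zz x y t *m A0.
    by rewrite -hzz addrK.
  rewrite mulmxBl [(A0 + mu%:M) *m _]mulmxDl mul_scalar_mx mulmxDr -scalemxAr.
  by rewrite !mulmxA addrA subrK.
move: h E; rewrite -/c.
move: (dop d1 P x y t) (dop d2 P x y t) (dop d1 K x y t) (P x y t) => P1 P2 K1 Q.
move: (dressf s lam x y t) (dop d1 (dressf s lam) x y t) => G G1.
move: (dop d2 (dressf s lam) x y t) => G2 h E.
have hA : K1 + c *: P1 + A0 = (K1 + A0) + c *: P1 by rewrite addrAC.
rewrite hA; move: h E; move: (K1 + A0) => A h E.
have {}E : b *: ((zz^*%C *: P1 - P2 + Q *m A - A *m Q - c *: (P1 *m Q)) *m G) = 0.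
  by rewrite E mul0mx scaler0.
have h' : b *: (Q *m (lam *: G1 - G2 + G *m A0)) = b *: (Q *m (A *m G)) by rewrite h.
have bc : c = b * (lam - zz^*%C) by rewrite /b; field.
have {}E : b *: (lam *: (P1 *m G) - P2 *m G + Q *m A *m G - A *m Q *m G
           - c *: (P1 *m Q *m G)) = c *: (P1 *m G).
  move: E; rewrite !(mulmxDl, mulmxBl, mulNmx) -!scalemxAl.
  move: (P1 *m G) (P2 *m G) (Q *m A *m G) (A *m Q *m G) (P1 *m Q *m G).
  move=> a1 a2 a3 a4 a5 E; apply/eqP; rewrite -subr_eq0 -E {2}bc; apply/eqP.
  by apply/matrixP => i j; rewrite !mxE; ring.
rewrite !(mulmxDl, mulmxDr) -!(scalemxAl, scalemxAr) !mulmxA -E.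
move: h h'; rewrite !(mulmxDr, mulmxN) -!(scalemxAl, scalemxAr) !mulmxA => <-.
move: (G *m A0) (P1 *m G) (P2 *m G) (Q *m A *m G) (A *m Q *m G) (P1 *m Q *m G).
move: (Q *m G *m A0) (Q *m G1) (Q *m G2) => b1 b2 b3 a0 a1 a2 a3 a4 a5 h'.
apply/eqP; rewrite -subr_eq0; apply/eqP.
transitivity (b *: (lam *: b2 - b3 + b1) - b *: a3); last by rewrite h' subrr.
by apply/matrixP => i j; rewrite !mxE; ring.
Qed.

End BacklundSystem.

(** * Ward maps obtained by dressing *)

Section DressedWardMap.
Local Open Scope ring_scope.
Local Open Scope complex_scope.
Local Open Scope sesquilinear_scope.
Variables (R : realType) (z : nat -> R[i]) (n : nat) (A0 : 'M[R[i]]_2) (mu : R[i]).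
Variables (w : nat -> mfield R 2 1) (J0 : stfield R 2).
Hypothesis z_nreal : forall i k,
  (1 <= i <= n)%N -> (1 <= k <= n)%N -> z i != (z k)^*%C.
Hypothesis z_inj : forall i k,
  (1 <= i <= n)%N -> (1 <= k <= n)%N -> z i = z k -> i = k.
Hypothesis A0_skew : A0^t* = - A0.
Hypothesis w_elem : forall i, melem (w i).
Hypothesis w_neq0 : forall i x y t, w i x y t != 0.
Hypothesis w_u : compatible z n A0 mu w (1, 0, 0) (0, 1, 1).
Hypothesis w_x : compatible z n A0 mu w (0, -1, 1) (1, 0, 0).
Hypothesis J0_elem : melem J0.
Hypothesis J0_SU : forall x y t, SUmx (J0 x y t).
Hypothesis J0_u : forall x y t, dop (0, 1, 1) J0 x y t = J0 x y t *m A0.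
Hypothesis J0_x : forall x y t, dop (1, 0, 0) J0 x y t = J0 x y t *m A0.

Definition dressed : stfield R 2 := fun x y t =>
  J0 x y t *m udress z (fun i => w i x y t) n.

Lemma dressed_SU x y t : SUmx (dressed x y t).
Proof.
apply: SUmxM; first exact: J0_SU.
by apply: (udress_SU z_nreal z_inj) => // i _; exact: w_neq0.
Qed.

Lemma dressed_melem : melem dressed.
Proof.
apply: melemM => //; move: (leqnn n); move: {1 3}n => s.
elim: s => [_|s IH sn] /=; first exact: melem_cst.
apply: melemM; first exact/IH/ltnW.
have eP : melem (fun x y t => lproj (dvecf z w s x y t)).
  apply: lproj_melem; first exact: (dvecf_melem z_nreal z_inj w_elem w_neq0 sn).
  by move=> x y t; apply: (dvec_neq0 z_nreal z_inj).
apply: melemZ; first exact: elem_cst.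
apply: melemD; apply: melemZ => //; try exact: elem_cst.
apply: melemD; first exact: melem_cst.
rewrite (_ : (fun x y t => _) = fun x y t => -1 *: lproj (dvecf z w s x y t)).
  by apply: melemZ => //; exact: elem_cst.
by do 3 (apply/funext => ?); rewrite scaleN1r.
Qed.

(** At lambda = 0 the system reads - d2 G + G A0 = (d1 K + A0) G. Differentiating J G = kap J0 along
    d2 then cancels G A0 and leaves J^{-1} d2 J = d1 K + A0, for (d1, d2) = (d_x, d_u) and (d_v,
    d_x). *)
Lemma dressed_ward : ward_map dressed.
Proof.
have r0 : regular z n 0 := regular0 z_nreal (leqnn n).
have [K [eK Kh hK]] :=
  dress_system mu z_nreal z_inj A0_skew w_elem w_neq0 (leqnn n).
have eG := dress_melem z_nreal z_inj w_elem w_neq0 (leqnn n) r0.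
have eJ := dressed_melem.
set kap := \prod_(i < n) (z i.+1 / (cabs (z i.+1))%:C).
have JG : (fun x y t => dressed x y t *m dressf z w n 0 x y t)
    = fun x y t => kap *: J0 x y t.
  do 3 (apply/funext => ?).
  rewrite /dressed -mulmxA (udress_dress0 z_nreal) //.
  by rewrite -/kap mul_mx_scalar.
have uG x y t : dressf z w n 0 x y t \in unitmx.
  apply: dress_unit => // i hi; rewrite eq_sym; exact: (node_neq0 z_nreal).
have uJ x y t : dressed x y t \is unitarymx by case: (dressed_SU x y t).
have key d1 d2 x y t : compatible z n A0 mu w d1 d2 ->
    dop d2 J0 x y t = J0 x y t *m A0 ->
    invmx (dressed x y t) *m dop d2 dressed x y t = dop d1 K x y t + A0.
  move=> hd hJ0; have := hK _ _ hd _ r0 x y t.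
  rewrite scale0r sub0r => hG.
  have := congr1 (fun F => dop d2 F x y t) JG.
  rewrite dopM // dopZ // hJ0 scalemxAl -(congr1 (fun F => F x y t) JG).
  have -> : dop d2 (dressf z w n 0) x y t = dressf z w n 0 x y t *m A0 -
      (dop d1 K x y t + A0) *m dressf z w n 0 x y t.
    by rewrite -hG opprD opprK addrCA subrr addr0.
  rewrite mulmxBr !mulmxA addrCA -[RHS]addr0 => /addrI; rewrite -mulmxBl => h.
  have {}h : dop d2 dressed x y t = dressed x y t *m (dop d1 K x y t + A0).
    apply/eqP; rewrite -subr_eq0; apply/eqP.
    by rewrite -[LHS](mulmxK (uG x y t)) h mul0mx.
  by rewrite h mulKmx // unitarymx_unit.
split; [exact: melem_smooth|exact: dressed_SU|].
apply: (ward_eq_potential (K := K) (A0 := A0)) => // x y t.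
  have := key _ _ x y t w_u (J0_u x y t).
  rewrite /dop /= !scale1r !scale0r add0r !addr0 => <-.
  by rewrite addrC.
have := key _ _ x y t w_x (J0_x x y t).
rewrite /dop /= !scale1r !scale0r add0r !addr0 => ->.
by rewrite rmorphN1 scaleN1r [- _ + _]addrC.
Qed.

End DressedWardMap.

(** * The vacuum and its modes *)

Section ComplexExponential.
Local Open Scope ring_scope.
Local Open Scope complex_scope.
Variable R : realType.
Implicit Types x y : R[i].

Lemma conjcM x y : (x * y)^*%C = x^*%C * y^*%C.
Proof. exact: rmorphM. Qed.

Lemma conjcD x y : (x + y)^*%C = x^*%C + y^*%C.
Proof. exact: rmorphD. Qed.

Lemma conjcN x : (- x)^*%C = - x^*%C.
Proof. exact: rmorphN. Qed.

Lemma conjcB x y : (x - y)^*%C = x^*%C - y^*%C.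
Proof. exact: rmorphB. Qed.

Lemma cexpD x y : cexp (x + y) = cexp x * cexp y.
Proof.
apply: complex_ext; rewrite ?Re_mul ?Im_mul /= Re_add Im_add expRD ?cosD ?sinD.
  by ring.
by ring.
Qed.

Lemma cexp0 : cexp (0 : R[i]) = 1.
Proof. by rewrite /cexp /= expR0 cos0 sin0 mulr1 mulr0. Qed.

Lemma cexp_neq0 x : cexp x != 0.
Proof.
apply/eqP => h; have := cexpD x (- x); rewrite subrr cexp0 h mul0r => /eqP.
by rewrite oner_eq0.
Qed.

Lemma cexpN x : cexp (- x) = (cexp x)^-1.
Proof.
by apply: (mulfI (cexp_neq0 x)); rewrite -cexpD subrr cexp0 mulfV // cexp_neq0.
Qed.

Lemma cexp_conj x : (cexp x)^*%C = cexp x^*%C.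
Proof. by apply: complex_ext; rewrite /cexp ?Re_conj ?Im_conj /= ?cosN ?sinN ?mulrN. Qed.

Lemma cabs_cexp x : cabs (cexp x) = expR (complex.Re x).
Proof.
rewrite /cabs /cexp /= !exprMn -mulrDr cos2Dsin2 mulr1 sqrtr_sqr.
by rewrite ger0_norm // expR_ge0.
Qed.

Lemma cexp_2pi (k : int) : cexp ('i%C * (k%:~R * (2 * pi)%:C) : R[i]) = 1.
Proof.
have hn (p : nat) : cexp ('i%C * (p%:R * (2 * pi)%:C) : R[i]) = 1.
  elim: p => [|p IH]; first by rewrite mul0r mulr0 cexp0.
  rewrite -natr1 mulrDl mulrDr cexpD IH mul1r mul1r.
  rewrite /cexp /= !mul0r !mul1r ?mulr0 ?add0r ?addr0 ?subr0 ?subrr ?oppr0 expR0 !mul1r.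
  by rewrite mulrC mulr_natr cos2pi sin2pi.
case: k => p; first exact: hn.
by rewrite NegzE mulrNz mulNr mulrN cexpN hn invr1.
Qed.

Lemma int_realC (k : int) : (k%:~R : R)%:C = k%:~R :> R[i].
Proof. by rewrite rmorph_int. Qed.

Lemma int_conj (k : int) : (k%:~R : R[i])^*%C = k%:~R.
Proof. by rewrite rmorph_int. Qed.

End ComplexExponential.

(** * The vacuum and its linearization *)

Section Vacuum.
Local Open Scope ring_scope.
Local Open Scope complex_scope.
Local Open Scope sesquilinear_scope.
Variables (R : realType) (m : int).

(** The constant matrix -a = J_0^{-1} d_x J_0, which serves as A0. *)
Definition vac_gen : 'M[R[i]]_2 := - diag_mx (a_diag R m).

Lemma a_diag_conj i : (a_diag R m 0 i)^*%C = - a_diag R m 0 i.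
Proof.
have h : ('i%C * m%:~R : R[i])^*%C = - ('i%C * m%:~R).
  by rewrite rmorphM /= int_conj -mulNr; congr (_ * _); apply: complex_ext; rewrite /= ?oppr0.
by rewrite mxE; case: ifP => _; rewrite ?rmorphN /= h.
Qed.

Lemma vac_gen_skew : vac_gen^t* = - vac_gen.
Proof.
rewrite /vac_gen opprK; have := a_diag_conj; move: (a_diag R m) => d h.
apply/matrixP => i k; rewrite !mxE eq_sym.
case: eqP => [->|_]; rewrite ?mulr1n ?mulr0n ?oppr0; last exact: conjc0.
by rewrite rmorphN [X in - X](h k) opprK.
Qed.

Lemma J_vacE x y t i k : J_vac m x y t i k =
  cexp (- a_diag R m 0 i * x%:C + - a_diag R m 0 i * y%:C + 0 * t%:C + 0)
  * (i == k)%:R.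
Proof.
rewrite /J_vac /exp_diag mxE mxE mulr_natr; congr (_ *+ _).
by rewrite [in LHS]mxE rmorphD /=; congr cexp; ring.
Qed.

Lemma J_vac_melem : melem (@J_vac R m).
Proof.
move=> i k; rewrite (_ : (fun x y t => _) = fun x y t =>
  cexp (- a_diag R m 0 i * x%:C + - a_diag R m 0 i * y%:C + 0 * t%:C + 0)
  * (i == k)%:R); last by do 3 (apply/funext => ?); rewrite J_vacE.
by apply: elemM; [exact: elem_cexp|exact: elem_cst].
Qed.

Lemma J_vac_mpd k x y t : mpd k (@J_vac R m) x y t =
  (if (k < 2)%N then J_vac m x y t *m vac_gen else 0).
Proof.
apply/matrixP => i l; rewrite mpdE (_ : (fun x y t => _) = fun x y t =>
  cexp (- a_diag R m 0 i * x%:C + - a_diag R m 0 i * y%:C + 0 * t%:C + 0)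
  * (i == l)%:R); last by do 3 (apply/funext => ?); rewrite J_vacE.
rewrite (pdM _ (elem_cexp _ _ _ _) (elem_cst _)) pd_cexp pd_cst mulr0 addr0.
have h : (J_vac m x y t *m vac_gen) i l = - a_diag R m 0 i * J_vac m x y t i l.
  rewrite mulmxN mul_mx_diag mxE mxE J_vacE; case: eqP => [->|_] /=.
    by ring.
  by rewrite !mulr0 mul0r oppr0.
case: k => [|[|k]] /=; rewrite ?h ?J_vacE; [by ring|by ring|].
by rewrite [RHS]mxE !mul0r.
Qed.

Lemma J_vac_SU x y t : SUmx (@J_vac R m x y t).
Proof.
pose e i : R[i] := cexp (- (x + y)%:C * a_diag R m 0 i).
have he i k : J_vac m x y t i k = e i * (i == k)%:R.
  by rewrite J_vacE; congr (cexp _ * _); rewrite rmorphD /=; ring.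
have e1 i : e i * (e i)^*%C = 1.
  have hr : (- (x + y)%:C)^*%C = - (x + y)%:C :> R[i] by rewrite -rmorphN conjc_real.
  rewrite /e cexp_conj -cexpD conjcM a_diag_conj hr.
  by rewrite [X in cexp X](_ : _ = 0) ?cexp0 //; ring.
have e01 : e 0 * e 1 = 1.
  rewrite /e -cexpD [X in cexp X](_ : _ = 0) ?cexp0 //.
  by rewrite !mxE /=; ring.
move: (J_vac m x y t) he => J he; split.
  apply/unitarymxP; apply: mx2P; rewrite mul2E !mxE !he /= ?mulr1 ?mulr0 ?mul0r.
  - by rewrite addr0 e1.
  - by rewrite rmorph0 addr0 mulr0.
  - by rewrite rmorph0 add0r mulr0.
  - by rewrite add0r e1.
by rewrite det2 !he /= !mulr1 !mulr0 subr0.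
Qed.

Lemma J_vac_periodic : periodic_xy (@J_vac R m).
Proof.
have h i : cexp (- a_diag R m 0 i * (2 * pi)%:C) = 1.
  rewrite mxE; case: ifP => _.
    rewrite [X in cexp X](_ : _ = 'i%C * ((- m)%:~R * (2 * pi)%:C)) ?cexp_2pi //.
    by rewrite mulrNz; ring.
  by rewrite opprK -mulrA cexp_2pi.
have per (x' y' x y t : R) i k :
    - a_diag R m 0 i * x'%:C + - a_diag R m 0 i * y'%:C =
    - a_diag R m 0 i * x%:C + - a_diag R m 0 i * y%:C - a_diag R m 0 i * (2 * pi)%:C ->
    J_vac m x' y' t i k = J_vac m x y t i k.
  move=> e; rewrite [LHS]J_vacE [RHS]J_vacE.
  apply: (congr1 (fun r => r * (i == k)%:R)).
  rewrite -[RHS]mulr1 -[X in _ = _ * X](h i) -cexpD.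
  by apply: congr1; apply: (eq_trans (congr1 (fun r => r + 0 * t%:C + 0) e)); ring.
move=> x y t; split; apply/matrixP => i k; apply: per; rewrite rmorphD /=; ring.
Qed.

(** The limits at both ends are the vacuum up to sign, so the stationary map carries a factor c,
    later (-1)^N. *)
Definition svac (c : R[i]) : stfield R 2 := fun x y t => c *: J_vac m x y t.

Section Sign.
Variable c : R[i].
Hypothesis c2 : c * c = 1.
Hypothesis cr : c^*%C = c.

Lemma svac_melem : melem (svac c).
Proof. by apply: melemZ; [exact: elem_cst|exact: J_vac_melem]. Qed.

Lemma svac_mpd k x y t : mpd k (svac c) x y t =
  (if (k < 2)%N then svac c x y t *m vac_gen else 0).
Proof.
rewrite mpdZ ?J_vac_mpd; last exact: J_vac_melem.
by case: ifP; rewrite ?scaler0 -?scalemxAl.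
Qed.

Lemma svac_SU x y t : SUmx (svac c x y t).
Proof.
have [/unitarymxP u d] := J_vac_SU x y t; split.
  apply/unitarymxP; rewrite /svac adjZ cr -scalemxAl -scalemxAr u scalerA c2.
  by rewrite scale1r.
by rewrite detZ d expr2 c2 mulr1.
Qed.

Lemma svac_dop_u x y t : dop (0, 1, 1) (svac c) x y t = svac c x y t *m vac_gen.
Proof. by rewrite /dop /= !svac_mpd /= scale0r add0r scaler0 addr0 scale1r. Qed.

Lemma svac_dop_x x y t : dop (1, 0, 0) (svac c) x y t = svac c x y t *m vac_gen.
Proof. by rewrite /dop /= !svac_mpd /= !scale0r !addr0 scale1r. Qed.

Lemma svac_periodic : periodic_xy (svac c).
Proof.
move=> x y t; have [h1 h2] := J_vac_periodic x y t.
by split; [exact: (congr1 (fun M => c *: M) h1)|exact: (congr1 (fun M => c *: M) h2)].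
Qed.

Lemma svac_stationary : stationary (svac c).
Proof. by []. Qed.

Lemma svac_ward : ward_map_T2 (svac c).
Proof.
split; last exact: svac_periodic.
(* Zero transformations leave [svac c] unchanged, so the Ward property is the case n = 0 of
   [dressed_ward]. *)
have <- : dressed (fun=> 0) 0 (fun _ _ _ _ => const_mx 1) (svac c) = svac c.
  by do 3 (apply/funext => ?); rewrite /dressed mulmx1.
apply: (@dressed_ward R (fun=> 0) 0 vac_gen 0 (fun _ _ _ _ => const_mx 1) (svac c)).
- by move=> [|i].
- by move=> [|i].
- exact: vac_gen_skew.
- by move=> i; exact: melem_cst.
- move=> i x y t; apply/eqP => /matrixP/(_ 0 0); rewrite !mxE.
  by apply/eqP; exact: oner_neq0.
- by move=> [|i].
- by move=> [|i].
- exact: svac_melem.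
- exact: svac_SU.
- exact: svac_dop_u.
- exact: svac_dop_x.
Qed.

Lemma svac_lder k x y t : lder (svac c) (mpd k (svac c)) x y t =
  if (k < 2)%N then vac_gen else 0.
Proof.
rewrite /lder svac_mpd; case: ifP => _; last by rewrite mulmx0.
by rewrite mulKmx //; have [/unitarymx_unit] := svac_SU x y t.
Qed.

(** On an eigenvector of the commutator with the generator, every operator of the linearization acts
    on an exponential as a scalar, so one polynomial equation per eigenvector remains. *)
Lemma lin_ward_svac (B1 B2 : 'M[R[i]]_2) (p q : nat -> R[i]) (k1 k2 : R[i]) :
  comm vac_gen B1 = k1 *: B1 -> comm vac_gen B2 = k2 *: B2 ->
  p 2 ^+ 2 - p 0 * (p 0 + k1) - p 1 * (p 1 + k1) + k1 * p 2 = 0 ->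
  q 2 ^+ 2 - q 0 * (q 0 + k2) - q 1 * (q 1 + k2) + k2 * q 2 = 0 ->
  lin_ward_eq (svac c) (fun x y t =>
    cexp (p 0 * x%:C + p 1 * y%:C + p 2 * t%:C + 0) *: B1
    + cexp (q 0 * x%:C + q 1 * y%:C + q 2 * t%:C + 0) *: B2).
Proof.
move=> c1 c2' hp hq.
pose ex (r : nat -> R[i]) x y t : R[i] :=
  cexp (r 0 * x%:C + r 1 * y%:C + r 2 * t%:C + 0).
(* This two-parameter family is stable under the partial derivatives and under commutation with the
   generator. *)
pose F a b : stfield R 2 := fun x y t => (a * ex p x y t) *: B1 + (b * ex q x y t) *: B2.
have -> : (fun x y t => cexp (p 0 * x%:C + p 1 * y%:C + p 2 * t%:C + 0) *: B1
    + cexp (q 0 * x%:C + q 1 * y%:C + q 2 * t%:C + 0) *: B2) = F 1 1.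
  by do 3 (apply/funext => ?); rewrite /F !mul1r.
have eex r : elem (ex r) by exact: elem_cexp.
have ee r (B : 'M[R[i]]_2) : melem (fun x y t => ex r x y t *: B).
  by apply: melemZ => //; exact: melem_cst.
have eF a b : melem (F a b).
  apply: melemD; apply: melemZ; try exact: melem_cst.
    by apply: elemM => //; exact: elem_cst.
  by apply: elemM => //; exact: elem_cst.
have de k r (B : 'M[R[i]]_2) : (k < 3)%N ->
    mpd k (fun x y t => ex r x y t *: B) = fun x y t => r k *: (ex r x y t *: B).
  move=> k3; do 3 (apply/funext => ?); apply/matrixP => i l; rewrite mpdE.
  rewrite (_ : (fun x y t => _) = fun x y t => ex r x y t * B i l); last first.
    by do 3 (apply/funext => ?); rewrite mxE.
  rewrite (pdM _ (eex r) (elem_cst _)) pd_cst mulr0 addr0 pd_cexp !mxE.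
  by rewrite mulrA; case: k k3 => [|[|[|]]].
have dF k a b : (k < 3)%N -> mpd k (F a b) = F (p k * a) (q k * b).
  move=> k3; have -> : F a b = fun x y t =>
      a *: (ex p x y t *: B1) + b *: (ex q x y t *: B2).
    by do 3 (apply/funext => ?); rewrite /F !scalerA.
  rewrite mpdD; [|by apply: melemZ => //; exact: elem_cst..].
  rewrite !mpdZ // !de //; do 3 (apply/funext => ?).
  by rewrite /F !scalerA; congr (_ *: _ + _ *: _); ring.
have cF a b x y t : comm vac_gen (F a b x y t) = F (k1 * a) (k2 * b) x y t.
  transitivity ((a * ex p x y t) *: comm vac_gen B1 + (b * ex q x y t) *: comm vac_gen B2).
    rewrite /comm /F mulmxDr mulmxDl -!scalemxAr -!scalemxAl.
    move: (_ *m B1) (B1 *m _) (_ *m B2) (B2 *m _) => a1 a2 a3 a4.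
    by apply/matrixP => i l; rewrite !mxE; ring.
  rewrite c1 c2' /F !scalerA; congr (_ *: _ + _ *: _); ring.
have FD a b a' b' x y t : F a b x y t + F a' b' x y t = F (a + a') (b + b') x y t.
  by rewrite /F; apply/matrixP => i l; rewrite !mxE; ring.
have cov k : (k < 2)%N -> covder (svac c) (mpd k (svac c)) (F 1 1) (mpd k (F 1 1))
    = F (p k + k1) (q k + k2).
  move=> k2'; do 3 (apply/funext => ?).
  by rewrite /covder svac_lder k2' cF dF ?FD ?mulr1 // ltnW.
have covt : covder (svac c) (mpd 2 (svac c)) (F 1 1) (mpd 2 (F 1 1)) = F (p 2) (q 2).
  do 3 (apply/funext => ?).
  by rewrite /covder svac_lder /= dF // /comm mul0mx mulmx0 subrr addr0 !mulr1.
rewrite /lin_ward_eq !(DxE, DyE, DtE) => x y t.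
rewrite covt (cov 0%N) // (cov 1%N) // !dF // !svac_lder /=.
have -> : comm 0 (F (p 1 + k1) (q 1 + k2) x y t) = 0.
  by rewrite /comm mul0mx mulmx0 subrr.
have -> : comm (F (p 2) (q 2) x y t) vac_gen = - F (k1 * p 2) (k2 * q 2) x y t.
  by rewrite -cF /comm opprB.
rewrite subr0 opprK; apply/matrixP => i l; rewrite !mxE.
have hp' := congr1 (fun r => r * (ex p x y t * B1 i l)) hp.
have hq' := congr1 (fun r => r * (ex q x y t * B2 i l)) hq.
transitivity ((p 2 ^+ 2 - p 0 * (p 0 + k1) - p 1 * (p 1 + k1) + k1 * p 2)
   * (ex p x y t * B1 i l) + (q 2 ^+ 2 - q 0 * (q 0 + k2) - q 1 * (q 1 + k2) + k2 * q 2)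
   * (ex q x y t * B2 i l)); first by ring.
by rewrite hp' hq' !mul0r addr0.
Qed.

(* (gamma - i m)^2 = m^2 - (j - m)^2 - (l - m)^2 is the dispersion relation of
   the modes with values in the upper triangular root space. *)
Lemma svac_mode (d g : R[i]) (j l : int) : d != 0 ->
  (g - 'i%C * m%:~R) ^+ 2 = (m ^+ 2 - (j - m) ^+ 2 - (l - m) ^+ 2)%:~R ->
  is_mode (svac c) g (mode_field (d *: delta_mx 0 1) g j l).
Proof.
move=> d0 hg; set X := d *: delta_mx 0 1.
have ii : 'i%C * 'i%C = -1 :> R[i] by rewrite -expr2 sqr_i.
have ci : ('i%C : R[i])^*%C = - 'i%C by apply: complex_ext; rewrite /= ?oppr0.
split; first by exists X, j, l; split=> //; rewrite /mxtrace sum2 !mxE /= !mulr0 addr0.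
split.
  exists 0, 0, 0; move/matrixP/(_ 0 1); rewrite /mode_field !mxE /= !(mulr0, addr0).
  rewrite oppr0 cexp0 !mulr1 !mul1r rmorph0 mulr0 subr0.
  by apply/eqP.
have comm_delta a b : comm vac_gen (delta_mx a b) =
    (- a_diag R m 0 a + a_diag R m 0 b) *: delta_mx a b.
  rewrite /comm /vac_gen mulNmx mulmxN mul_diag_mx mul_mx_diag.
  apply/matrixP => i k; rewrite [LHS]mxE 2!(mxE _ _ i k).
  rewrite !mxE; case: (i =P a) => [->|_] /=; case: (k =P b) => [->|_] /=; by ring.
pose p k : R[i] := match k with 0 => 'i%C * j%:~R | 1 => 'i%C * l%:~R | _ => g end.
pose q k : R[i] := match k with 0 => - ('i%C * j%:~R) | 1 => - ('i%C * l%:~R) | _ => g^*%C end.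
rewrite (_ : mode_field X g j l = fun x y t =>
    cexp (p 0 * x%:C + p 1 * y%:C + p 2 * t%:C + 0) *: X
    + cexp (q 0 * x%:C + q 1 * y%:C + q 2 * t%:C + 0) *: - X^t*); last first.
  do 3 (apply/funext => ?); rewrite /mode_field scalerN.
  by congr (cexp _ *: _ - cexp _ *: _); rewrite /p /q /=; ring.
have Xt : - X^t* = (- d^*%C) *: delta_mx 1 0.
  by rewrite /X adjZ scaleNr trmx_delta map_delta_mx.
(* The eigenvalues of the commutator with -diag(i m, -i m) on the upper and the lower off-diagonal
   unit. *)
apply: (lin_ward_svac (k1 := - (2 * 'i%C * m%:~R)) (k2 := 2 * 'i%C * m%:~R)).
- rewrite /X /comm -scalemxAr -scalemxAl -scalerBr -/(comm _ _) comm_delta.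
  by rewrite !scalerA !mxE /=; congr (_ *: _); ring.
- rewrite Xt /comm -scalemxAr -scalemxAl -scalerBr -/(comm _ _) comm_delta.
  by rewrite !scalerA !mxE /=; congr (_ *: _); ring.
- rewrite /p; move: hg; rewrite !(rmorphB, rmorphXn, rmorphM) /= => hg.
  (* A multiple of i^2 + 1 = 0 is inserted so that what remains is a polynomial identity. *)
  transitivity ((g - 'i%C * m%:~R) ^+ 2 - (m%:~R ^+ 2 - (j%:~R - m%:~R) ^+ 2 - (l%:~R - m%:~R) ^+ 2)
    + ('i%C * 'i%C + 1) * (2 * m%:~R * (j%:~R + l%:~R) - j%:~R ^+ 2 - l%:~R ^+ 2 - m%:~R ^+ 2)).
    by ring.
  by rewrite hg ii addNr mul0r subrr addr0.
- have cB : (g - 'i%C * m%:~R)^*%C = g^*%C - - 'i%C * m%:~R.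
    by rewrite -ci -[in RHS](int_conj R m) -conjcM; exact: rmorphB.
  have {}hg : (g^*%C - - 'i%C * m%:~R) ^+ 2 =
      (m ^+ 2 - (j - m) ^+ 2 - (l - m) ^+ 2)%:~R.
    by rewrite -[RHS]int_conj -hg !expr2 conjcM cB.
  move: hg; rewrite /q !(rmorphB, rmorphXn, rmorphM) /= => hg.
  transitivity ((g^*%C - - 'i%C * m%:~R) ^+ 2
    - (m%:~R ^+ 2 - (j%:~R - m%:~R) ^+ 2 - (l%:~R - m%:~R) ^+ 2)
    + ('i%C * 'i%C + 1) * (2 * m%:~R * (j%:~R + l%:~R) - j%:~R ^+ 2 - l%:~R ^+ 2 - m%:~R ^+ 2)).
    by ring.
  by rewrite hg ii addNr mul0r subrr addr0.
Qed.

End Sign.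
End Vacuum.

(** * Characters of the torus *)

Section Characters.
Local Open Scope ring_scope.
Local Open Scope complex_scope.
Variable R : realType.

Definition chi (j l : int) (x y : R) : R[i] :=
  cexp ('i%C * (j%:~R * x%:C + l%:~R * y%:C)).

Lemma chiD j l x y x' y' : chi j l (x + x') (y + y') = chi j l x y * chi j l x' y'.
Proof. by rewrite /chi -cexpD; congr cexp; rewrite !rmorphD /=; ring. Qed.

Lemma chi0 j l : chi j l 0 0 = 1.
Proof. by rewrite /chi rmorph0 !mulr0 addr0 mulr0 cexp0. Qed.

Lemma cabs_chi j l x y : cabs (chi j l x y) = 1.
Proof.
rewrite cabs_cexp -!int_realC -!rmorphM -rmorphD /= mul0r mulr0 subrr.
by rewrite expR0.
Qed.

Lemma chi_periodic j l x y (p q : int) :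
  chi j l (x + p%:~R * (2 * pi)) (y + q%:~R * (2 * pi)) = chi j l x y.
Proof.
rewrite chiD -[RHS]mulr1; congr (_ * _).
rewrite /chi [X in cexp X](_ : _ = 'i%C * ((j * p + l * q)%:~R * (2 * pi)%:C)).
  exact: cexp_2pi.
by rewrite !rmorphM /= !rmorphD /= !rmorphM /= !int_realC; ring.
Qed.

Lemma cexp_ipi : cexp ('i%C * pi%:C : R[i]) = -1.
Proof.
have hr : complex.Re ('i%C * pi%:C : R[i]) = 0.
  by rewrite Re_mul /= mul0r mulr0 subrr.
have hi : complex.Im ('i%C * pi%:C : R[i]) = pi.
  by rewrite Im_mul /= mulr0 mul1r add0r.
by rewrite /cexp hr hi expR0 cospi sinpi !mul1r; apply: complex_ext; rewrite /= ?oppr0.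
Qed.

(** The quotient of the two characters is -1 at half a period along a coordinate in which the
    frequencies differ. *)
Lemma chi_neq j l j' l' : (j, l) <> (j', l') -> exists x y, chi j l x y <> chi j' l' x y.
Proof.
have key x y : chi j l x y = chi j' l' x y -> chi (j - j') (l - l') x y = 1.
  move=> e; have h : chi j l x y = chi (j - j') (l - l') x y * chi j' l' x y.
    by rewrite /chi -cexpD; congr cexp; rewrite !rmorphB /=; ring.
  have n0 : chi j' l' x y != 0 by exact: cexp_neq0.
  by apply: (mulIf n0); rewrite -h e mul1r.
have m1 : (-1 : R[i]) <> 1.
  move=> /(congr1 (@complex.Re R)) /= h.
  by lra.
have half (k k' : int) : k <> k' ->
    ((k - k')%:~R : R[i]) * (pi / (k - k')%:~R)%:C = pi%:C.
  move=> kk; rewrite -int_realC -rmorphM /= mulrC divfK //.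
  by rewrite intr_eq0 subr_eq0; apply/eqP.
move=> hne; have [e|ne] := pselect (j = j').
  have ne : l <> l' by move=> e'; apply: hne; rewrite e e'.
  exists 0, (pi / (l - l')%:~R) => /key.
  by rewrite /chi rmorph0 mulr0 add0r half // cexp_ipi.
exists (pi / (j - j')%:~R), 0 => /key.
by rewrite /chi rmorph0 mulr0 addr0 half // cexp_ipi.
Qed.

(** Artin's argument: the relation is translated by a point separating two characters, and a
    multiple of the original relation is subtracted to remove the first character. *)
Lemma chi_independent (I : eqType) (r : seq I) (j l : I -> int) (c : I -> R[i]) :
  uniq r -> {in r &, forall i k, i != k -> (j i, l i) <> (j k, l k)} ->
  (forall x y, \sum_(i <- r) c i * chi (j i) (l i) x y = 0) ->
  {in r, forall i, c i = 0}.
Proof.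
elim: r c => [//|i0 r IH] c /= /andP[i0r ur] hne h.
have cr : {in r, forall i, c i = 0}.
  move=> i ir; have i0i : i0 != i by apply: contraNneq i0r => ->.
  have [|x' [y' hx]] := @chi_neq (j i) (l i) (j i0) (l i0).
    by apply: hne; rewrite ?inE ?eqxx ?ir ?orbT // eq_sym.
  have /eqP : c i * (chi (j i) (l i) x' y' - chi (j i0) (l i0) x' y') = 0.
    apply: (IH (fun k => c k * (chi (j k) (l k) x' y' - chi (j i0) (l i0) x' y')) ur _ _ i ir).
      by move=> k k' kr k'r; apply: hne; rewrite inE ?kr ?k'r orbT.
    move=> x y; have h1 := h (x + x') (y + y'); have h2 := h x y.
    transitivity (\sum_(k <- i0 :: r) c k * chi (j k) (l k) (x + x') (y + y')
       - chi (j i0) (l i0) x' y' * \sum_(k <- i0 :: r) c k * chi (j k) (l k) x y).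
      rewrite !big_cons mulrDr opprD addrACA chiD.
      rewrite [X in X + _](_ : _ = 0) ?add0r; last by ring.
      rewrite big_distrr /= -sumrB; apply: eq_bigr => k _; rewrite chiD; ring.
    by rewrite h1 h2 mulr0 subr0.
  by rewrite mulf_eq0 subr_eq0 => /orP[/eqP //|/eqP].
move=> i; rewrite inE => /orP[/eqP ->|]; last exact: cr.
have := h 0 0; rewrite big_cons big_seq big1 ?addr0 ?chi0 ?mulr1 // => k kr.
by rewrite cr // mul0r.
Qed.

Lemma torus_repr (x : R) : exists p : int,
  (x + p%:~R * (2 * pi))%R \in `[0, 2 * pi]%R.
Proof.
have P0 : 0 < 2 * pi :> R by rewrite mulr_gt0 ?pi_gt0.
exists (- Num.floor (x / (2 * pi))).
have /andP[h1 h2] := floor_itv (x / (2 * pi)).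
move: h1 h2; set k := Num.floor _.
rewrite ler_pdivlMr // ltr_pdivrMr // rmorphD /= mulrDl mul1r => h1 h2.
rewrite mulrNz mulNr in_itv /=; apply/andP; split; lra.
Qed.

(** Periodicity brings a point where the sum does not vanish into the square over which [supT2] is
    taken. *)
Lemma chi_sum_neq0 (I : finType) (j l : I -> int) (c : I -> R[i]) i0 :
  (forall i k, i != k -> (j i, l i) <> (j k, l k)) -> c i0 != 0 ->
  exists x y : R, [/\ x \in `[0, 2 * pi]%R, y \in `[0, 2 * pi]%R
    & \sum_i c i * chi (j i) (l i) x y != 0].
Proof.
move=> hne c0; apply: contrapT => hn.
move/eqP: c0; apply.
apply: (@chi_independent _ (index_enum I) j l c) => //.
- exact: index_enum_uniq.
- by move=> i k _ _; exact: hne.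
- move=> x y; apply: contrapT => hxy; apply: hn.
  have [p hp] := torus_repr x; have [q hq] := torus_repr y.
  exists (x + p%:~R * (2 * pi)), (y + q%:~R * (2 * pi)); split => //.
  apply/eqP => h; apply: hxy; rewrite -[RHS]h.
  by apply: eq_bigr => i _; rewrite chi_periodic.
Qed.

End Characters.

(** * Convergence and tangency in terms of matrix entries *)

Section Tangency.
Local Open Scope classical_set_scope.
Local Open Scope ring_scope.
Local Open Scope complex_scope.
Local Open Scope sesquilinear_scope.
Variable R : realType.

Lemma mnorm_le (A : 'M[R[i]]_2) :
  mnorm A <= cabs (A 0 0) + cabs (A 0 1) + (cabs (A 1 0) + cabs (A 1 1)).
Proof.
have h := cabs_ge0; rewrite /mnorm !sum2.
set a := cabs _; set b := cabs _; set c := cabs _; set d := cabs _.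
have [a0 b0 c0 d0] : [/\ 0 <= a, 0 <= b, 0 <= c & 0 <= d] by split; exact: h.
rewrite -[leRHS]ger0_norm ?addr_ge0 // -sqrtr_sqr ler_sqrt ?sqr_ge0 //.
have : 0 <= a * b /\ 0 <= c * d by split; exact: mulr_ge0.
have : 0 <= (a + b) * (c + d) by rewrite mulr_ge0 ?addr_ge0.
by nra.
Qed.

Lemma mnorm_ge (A : 'M[R[i]]_2) i j : cabs (A i j) <= mnorm A.
Proof.
rewrite -[leLHS]ger0_norm ?cabs_ge0 // -sqrtr_sqr ler_sqrt; last first.
  by apply: sumr_ge0 => k _; apply: sumr_ge0 => l _; exact: sqr_ge0.
rewrite (bigD1 i) //= (bigD1 j) //= -addrA lerDl addr_ge0 //.
  by apply: sumr_ge0 => k _; exact: sqr_ge0.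
by apply: sumr_ge0 => k _; apply: sumr_ge0 => l _; exact: sqr_ge0.
Qed.

Lemma mnorm_skew (A : 'M[R[i]]_2) :
  cabs (A 1 1) = cabs (A 0 0) -> cabs (A 1 0) = cabs (A 0 1) ->
  mnorm A <= 2 * (cabs (A 0 0) + cabs (A 0 1)).
Proof. by move=> h1 h2; apply: le_trans (mnorm_le A) _; rewrite h1 h2; lra. Qed.

Lemma cabs_sum (I : Type) (r : seq I) (P : pred I) (f : I -> R[i]) :
  cabs (\sum_(i <- r | P i) f i) <= \sum_(i <- r | P i) cabs (f i).
Proof.
elim/big_ind2: _ => [|x1 x2 y1 y2 h1 h2|//]; first by rewrite cabs0.
by apply: le_trans (cabsD _ _) _; exact: lerD.
Qed.

Variables (m : int) (c : R[i]).
Hypothesis c2 : c * c = 1.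
Hypothesis cr : c^*%C = c.
Variables (T : set_system R) (FT : ProperFilter T).
Variables (W : stfield R 2).
Hypothesis W_SU : forall x y t, SUmx (W x y t).

Local Notation u0 := (svac m c).

Let J : stfield R 2 := fun x y t => u0 x y t *m W x y t.

(** The second row of W - 1 follows from the first, so only two entries have to be estimated. *)
Lemma SU2_sub1 x y t : (W x y t - 1%:M) 1 1 = ((W x y t - 1%:M) 0 0)^*%C /\
  (W x y t - 1%:M) 1 0 = - ((W x y t - 1%:M) 0 1)^*%C.
Proof.
have [h1 h2] := SU2_entries (W_SU x y t).
rewrite !mxE /= h1 h2 !subr0; split=> //.
by rewrite conjcB conjc1.
Qed.

Lemma svac_unif_cvg :
  (forall e, 0 < e -> \forall t \near T, forall x y, cabs (W x y t 0 0 - 1) <= e) ->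
  (forall e, 0 < e -> \forall t \near T, forall x y, cabs (W x y t 0 1) <= e) ->
  unif_cvg T J u0.
Proof.
move=> h0 h1 e e0; have e8 : 0 < e / 8 by rewrite divr_gt0.
near=> t => x y.
have [w1 w2] := SU2_sub1 x y t.
have -> : J x y t - u0 x y t = u0 x y t *m (W x y t - 1%:M).
  by rewrite mulmxBr mulmx1.
(* [u0] is diagonal with unimodular entries, so multiplication by it preserves absolute values. *)
have uE i k : cabs ((u0 x y t *m (W x y t - 1%:M)) i k) = cabs ((W x y t - 1%:M) i k).
  have ca : cabs c = 1.
    apply/eqP; rewrite -(@eqrXn2 _ 2) ?cabs_ge0 // expr1n; apply/eqP.
    apply: (@complexI R); rewrite -cabs_mul_conj cr c2; by [].
  rewrite /svac -scalemxAl mxE cabsM ca mul1r /J_vac /exp_diag mul_diag_mx mxE.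
  rewrite cabsM [X in X * _](_ : _ = 1) ?mul1r // mxE cabs_cexp.
  rewrite (_ : complex.Re _ = 0) ?expR0 // !mxE.
  by case: ifP => _; rewrite ?(Re_mul, Re_opp, Im_opp, Im_mul) /= -int_realC /=; ring.
apply: le_lt_trans (mnorm_skew _ _) _.
- by rewrite !uE w1 cabs_conj.
- by rewrite !uE w2 cabsN cabs_conj.
rewrite !uE !mxE /= subr0.
have a0 : cabs (W x y t 0 0 - 1) <= e / 8.
  by move: x y {w1 w2 uE}; near: t; exact: h0.
have a1 : cabs (W x y t 0 1) <= e / 8.
  by move: x y {w1 w2 uE a0}; near: t; exact: h1.
by lra.
Unshelve. all: end_near.
Qed.

Variables (n : nat) (d : 'I_n -> R[i]) (j l : 'I_n -> int) (gam : 'I_n -> R) (i0 : 'I_n).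
Variable Q : R -> Prop.
Hypothesis d_neq0 : forall i, d i != 0.
Hypothesis jl_inj : forall i k, i != k -> (j i, l i) <> (j k, l k).
Hypothesis gam2 : forall i,
  gam i ^+ 2 = (m ^+ 2 - (j i - m) ^+ 2 - (l i - m) ^+ 2)%:~R.
Hypothesis gamQ : forall i, Q (gam i).
(** Modes of any other rate are negligible against that of [i0]; several modes may share the rate of
    [i0]. *)
Hypothesis gam_slow : forall i, gam i <> gam i0 -> forall e, 0 < e ->
  \forall t \near T, expR (gam i * t) <= e * expR (gam i0 * t).

(** A root of the dispersion relation of [svac_mode]. *)
Definition growth i : R[i] := (gam i)%:C + 'i%C * m%:~R.

Hypothesis W_diag : forall e, 0 < e ->
  \forall t \near T, forall x y, cabs (W x y t 0 0 - 1) <= e * expR (gam i0 * t).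
Hypothesis W_off : forall e, 0 < e -> \forall t \near T, forall x y,
  cabs (W x y t 0 1 - \sum_i d i * (cexp (growth i * t%:C) * chi (j i) (l i) x y))
  <= e * expR (gam i0 * t).

(** The error is compared with the sup norm of eta, which therefore needs a lower bound. Keeping
    only the modes with the rate of [i0] makes eta_01 the product of one exponential in t and a
    fixed trigonometric polynomial, nonzero at some point by independence of characters. *)
Lemma svac_tangent : tangent_to T J u0
  (real_span [set eta | exists g, Q (complex.Re g) /\ is_mode u0 g eta]).
Proof.
pose sel i : R := (gam i == gam i0)%:R.
pose md i : stfield R 2 := mode_field (d i *: delta_mx 0 1) (growth i) (j i) (l i).
pose eta : stfield R 2 := fun x y t => \sum_(i < n) (sel i)%:C *: md i x y t.
pose b x y t : R[i] := \sum_i (sel i)%:C * (d i * (cexp (growth i * t%:C) * chi (j i) (l i) x y)).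
have md01 i x y t : md i x y t 0 1 = d i * (cexp (growth i * t%:C) * chi (j i) (l i) x y).
  rewrite /md /mode_field !mxE /= rmorphM /= rmorph0 !mulr0 subr0 mulr1 mulrC.
  by rewrite cexpD.
have md10 i x y t : md i x y t 1 0 = - (md i x y t 0 1)^*%C.
  rewrite md01 /md /mode_field !mxE /= mulr0 mulr0 add0r mulr1; congr (- _).
  rewrite mulrC [RHS]conjcM; congr (_ * _).
  rewrite -cexpD cexp_conj; congr cexp.
  rewrite conjcD conjcM conjc_real; congr (_ + _).
  rewrite conjcM conjcD !conjcM !int_conj !conjc_real -mulNr; congr (_ * _).
  by apply: complex_ext; rewrite /= ?oppr0.
have mdd i x y t k : md i x y t k k = 0.
  by case: (ord2P k) => ->; rewrite /md /mode_field !mxE /= ?rmorph0 ?mulr0 ?subr0 ?rmorphM ?rmorph0 /= ?mulr0 ?conjc0 ?mulr0 ?subr0.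
have sE a (A : 'M[R[i]]_2) i k : (a *: A) i k = a * A i k by rewrite mxE.
have eta01 x y t : eta x y t 0 1 = b x y t.
  rewrite /eta summxE; apply: eq_bigr => i _.
  by rewrite sE md01.
have eta10 x y t : eta x y t 1 0 = - (b x y t)^*%C.
  rewrite -eta01 /eta !summxE rmorph_sum -sumrN; apply: eq_bigr => i _.
  rewrite !sE md10 mulrN; apply: congr1; rewrite -[X in X * _]conjc_real.
  exact: esym (conjcM _ _).
have etad x y t k : eta x y t k k = 0.
  by rewrite /eta summxE big1 // => i _; rewrite sE mdd mulr0.
pose tp x y : R[i] := \sum_i ((sel i)%:C * d i) * chi (j i) (l i) x y.
have bE x y t : b x y t = cexp (growth i0 * t%:C) * tp x y.
  rewrite /b /tp big_distrr /=; apply: eq_bigr => i _; rewrite /sel.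
  case: eqP => [e|_]; last by rewrite !mul0r mulr0.
  by rewrite !mul1r /growth e mulrCA.
have cg t : cabs (cexp (growth i0 * t%:C)) = expR (gam i0 * t).
  rewrite cabs_cexp /growth -int_realC; congr expR.
  by rewrite Re_mul Re_add Re_mul /=; ring.
have [x0 [y0 [hx0 hy0 t0]]] : exists x y : R, [/\ x \in `[0, 2 * pi]%R,
    y \in `[0, 2 * pi]%R & tp x y != 0].
  apply: (chi_sum_neq0 (i0 := i0)) => //.
  by rewrite /sel eqxx mul1r.
pose tau := cabs (tp x0 y0).
have tau0 : 0 < tau by rewrite cabs_gt0.
pose D := \sum_i cabs ((sel i)%:C * d i).
have tpD x y : cabs (tp x y) <= D.
  apply: le_trans (cabs_sum _ _ _) _; apply: ler_sum => i _.
  by rewrite cabsM cabs_chi mulr1.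
exists eta; split.
- exists n, sel, md; split => // i; exists (growth i); split.
    by rewrite /growth -int_realC Re_add Re_mul /= !mul0r mulr0 subrr addr0.
  apply: svac_mode => //; rewrite /growth addrK -rmorphXn /= gam2.
  by rewrite int_realC.
- exists x0, y0, 0 => /matrixP/(_ 0 1); rewrite eta01 [RHS]mxE bE => /eqP.
  by rewrite mulf_eq0 (negbTE t0) orbF (negbTE (cexp_neq0 _)).
(* The norm is at most twice the sum of the two entries of the first row, which are bounded by e'
   and 2 e' times the exponential; the total 6 e' is below 8 e' = e tau. *)
move=> e e0; pose e' := e * tau / 8.
have e'0 : 0 < e' by rewrite divr_gt0 ?mulr_gt0.
pose Dd := 1 + \sum_i cabs (d i).
have S0 : 0 <= \sum_i cabs (d i) by apply: sumr_ge0 => i _; exact: cabs_ge0.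
have Dd0 : 0 < Dd by rewrite ltr_pwDl.
have slow : \forall t \near T, forall i, gam i <> gam i0 ->
    expR (gam i * t) <= e' / Dd * expR (gam i0 * t).
  apply: filter_forall => i.
  have [h|h] := pselect (gam i = gam i0); first by apply: filterE => t; rewrite h.
  by apply: filterS (gam_slow h (divr_gt0 e'0 Dd0)) => t + _; apply.
near=> t.
have E0 : 0 < expR (gam i0 * t) by exact: expR_gt0.
have lower : tau * expR (gam i0 * t) <= supT2 eta t.
  apply: le_trans (_ : mnorm (eta x0 y0 t) <= _).
    by apply: le_trans (mnorm_ge _ 0 1); rewrite eta01 bE cabsM cg mulrC.
  apply: ub_le_sup; last by exists (x0, y0).
  (* The supremum dominates the elements of a bounded set only, whence this explicit bound. *)
  exists (2 * (expR (gam i0 * t) * D)) => _ [[x y] _ <-] /=.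
  apply: le_trans (mnorm_skew _ _) _.
  - by rewrite !etad.
  - by rewrite eta10 eta01 cabsN cabs_conj.
  rewrite etad cabs0 add0r eta01 bE cabsM cg; apply: ler_wpM2l => //.
  by apply: ler_wpM2l; [exact: ltW|exact: tpD].
apply: ge_sup.
  by exists (mnorm (invmx (u0 x0 y0 t) *m J x0 y0 t - 1%:M - eta x0 y0 t)), (x0, y0).
move=> _ [[x y] _ <-] /=.
have -> : invmx (u0 x y t) *m J x y t = W x y t.
  by rewrite /J mulKmx //; have [/unitarymx_unit] := svac_SU m c2 cr x y t.
have [w1 w2] := SU2_sub1 x y t.
have D00 : (W x y t - 1%:M - eta x y t) 0 0 = W x y t 0 0 - 1.
  by rewrite mxE [X in _ + X]mxE etad oppr0 addr0 !mxE.
have D01 : (W x y t - 1%:M - eta x y t) 0 1 = W x y t 0 1 - b x y t.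
  by rewrite mxE [X in _ + X]mxE eta01 !mxE subr0.
apply: le_trans (mnorm_skew _ _) _.
- by rewrite D00 mxE [X in _ + X]mxE etad oppr0 addr0 w1 cabs_conj !mxE.
- rewrite D01 mxE [X in _ + X]mxE eta10 w2 opprK addrC -conjcB cabs_conj.
  by rewrite -[LHS]cabsN opprB !mxE subr0.
rewrite D00 D01.
have a0 : cabs (W x y t 0 0 - 1) <= e' * expR (gam i0 * t).
  by move: x y {w1 w2 D00 D01}; near: t; exact: W_diag.
have a1 : cabs (W x y t 0 1 - b x y t) <= 2 * e' * expR (gam i0 * t).
  rewrite -[W x y t 0 1](subrK (\sum_i d i * (cexp (growth i * t%:C) * chi (j i) (l i) x y))).
  rewrite -addrA; apply: le_trans (cabsD _ _) _; rewrite mulrDl mul1r mulrDl; apply: lerD.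
    by move: x y {w1 w2 D00 D01 a0}; near: t; exact: W_off.
  rewrite /b -sumrB; apply: le_trans (cabs_sum _ _ _) _.
  apply: (@le_trans _ _ (\sum_i cabs (d i) * (e' / Dd * expR (gam i0 * t)))).
    apply: ler_sum => i _; rewrite /sel; case: eqP => [_|h].
      by rewrite mul1r subrr cabs0 !mulr_ge0 ?cabs_ge0 ?invr_ge0 // ltW.
    rewrite mul0r subr0 cabsM; apply: ler_wpM2l; first exact: cabs_ge0.
    rewrite cabsM cabs_chi mulr1 cabs_cexp.
    apply: le_trans (_ : expR (gam i * t) <= _).
      rewrite ler_expR /growth -int_realC Re_mul Re_add Re_mul /=.
      by rewrite le_eqVlt; apply/orP; left; apply/eqP; ring.
    by move: i h; near: t; exact: slow.
  rewrite -big_distrl /= [X in X <= _](_ : _ =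
    e' * expR (gam i0 * t) * ((\sum_i cabs (d i)) / Dd)); last by ring.
  apply: ler_piMr.
    by rewrite mulr_ge0 ?ltW.
  by rewrite ler_pdivrMr // mul1r /Dd lerDr.
apply: le_trans (_ : e * (tau * expR (gam i0 * t)) <= _); last by rewrite ler_pM2l.
have -> : e * (tau * expR (gam i0 * t)) = 8 * (e' * expR (gam i0 * t)).
  by rewrite /e'; field.
have : 0 <= e' * expR (gam i0 * t) by rewrite mulr_ge0 ?ltW.
by lra.
Unshelve. all: end_near.
Qed.

End Tangency.

(** * The iterated map *)

Section Nodes.
Local Open Scope ring_scope.
Local Open Scope complex_scope.
Variable R : realType.

Definition rate (m j l : int) : R :=
  Num.sqrt (m ^+ 2 - (j - m) ^+ 2 - (l - m) ^+ 2)%:~R.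

Definition in_disc (m j l : int) := (j - m) ^+ 2 + (l - m) ^+ 2 < m ^+ 2.

Lemma rate_gt0 m j l : in_disc m j l -> 0 < rate m j l.
Proof.
by move=> h; rewrite sqrtr_gt0 ltr0z; move: h; rewrite /in_disc; lia.
Qed.

Lemma rate_sq m j l : in_disc m j l ->
  rate m j l ^+ 2 = (m ^+ 2 - (j - m) ^+ 2 - (l - m) ^+ 2)%:~R.
Proof.
by move=> h; rewrite sqr_sqrtr // ler0z; move: h; rewrite /in_disc; lia.
Qed.

(** The disc condition gives (j - m)^2 < m^2, so j lies strictly between 0 and 2 m. *)
Lemma in_disc_sign m j l : m <> 0 -> in_disc m j l -> 0 < j * m /\ 0 < j * (2 * m - j).
Proof. by move=> m0 h; move: h; rewrite /in_disc; split; nia. Qed.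

(** Since |j| = sgn(m) j, the signs of m in the modulus and in the angle cancel. *)
Lemma node_rect (m j l : int) (theta : R) (z : R[i]) : m <> 0 -> in_disc m j l ->
  cos theta = Num.sg m%:~R * (l - m)%:~R / Num.sqrt (j * (2 * m - j))%:~R ->
  sin theta = Num.sg m%:~R * Num.sqrt (1 - cos theta ^+ 2) ->
  z = (Num.sqrt ((2 * m - j)%:~R / j%:~R))%:C * cexp ('i%C * theta%:C) ->
  z = ((l - m)%:~R / j%:~R) +i* (rate m j l / j%:~R).
Proof.
move=> m0 hd hc hs ->; have [jm jd] := in_disc_sign m0 hd.
set J : R := j%:~R; set L : R := (l - m)%:~R; set g := rate m j l.
have J0 : J != 0 by rewrite intr_eq0; apply/eqP => e; move: jm; rewrite e mul0r ltxx.
set sg := Num.sg _ in hc hs.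
have sg2 : sg * sg = 1.
  rewrite /sg -expr2 sqr_sg intr_eq0; by move/eqP: m0 => ->.
have sgJ : `|J| = sg * J.
  rewrite normrEsg mulrC [RHS]mulrC; congr (_ * _).
  have M0 : 0 < J * m%:~R by rewrite -intrM ltr0z.
  have : Num.sg (J * m%:~R) = 1 by rewrite gtr0_sg.
  rewrite sgrM -/sg => h; by rewrite -[RHS]mul1r -h -mulrA sg2 mulr1.
set D := Num.sqrt _ in hc.
have D0 : 0 < D by rewrite sqrtr_gt0 ltr0z.
have D2 : D ^+ 2 = (j * (2 * m - j))%:~R by rewrite sqr_sqrtr // ler0z ltW.
have r : Num.sqrt ((2 * m - j)%:~R / J) = D / (sg * J).
  rewrite -sgJ -sqrtr_sqr -sqrtrV ?sqr_ge0 // -sqrtrM ?ler0z ?ltW //; congr Num.sqrt.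
  by rewrite intrM -/J; field.
have g2 : g ^+ 2 = D ^+ 2 - L ^+ 2.
  by rewrite rate_sq // D2 /L -!rmorphXn -rmorphB /=; congr _%:~R; ring.
have g0 : 0 < g := rate_gt0 hd.
have s2 : Num.sqrt (1 - cos theta ^+ 2) = g / D.
  rewrite -[RHS]ger0_norm ?divr_ge0 ?ltW // -sqrtr_sqr; congr Num.sqrt.
  rewrite hc !expr_div_n g2 exprMn [sg ^+ 2]expr2 sg2 mul1r.
  by field; rewrite gt_eqF.
have sg0 : sg != 0 by apply: contraTneq (oner_neq0 R) => e; rewrite -sg2 e mul0r eqxx.
have hr : complex.Re ('i%C * theta%:C : R[i]) = 0.
  by rewrite Re_mul /= mul0r mulr0 subrr.
have hi : complex.Im ('i%C * theta%:C : R[i]) = theta.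
  by rewrite Im_mul /= mulr0 mul1r add0r.
have D0' : D != 0 by rewrite gt_eqF.
rewrite /cexp hr hi expR0 !mul1r hs s2 hc r.
apply: complex_ext; rewrite ?Re_mul ?Im_mul /= -/L -/J ?mul0r ?subr0 ?addr0.
  by field; rewrite D0' sg0 J0.
by field; rewrite D0' sg0 J0.
Qed.

Section NodeRelations.
Variables (m j l : int) (z : R[i]).
Hypothesis m0 : m <> 0.
Hypothesis hd : in_disc m j l.
Hypothesis zE : z = ((l - m)%:~R / j%:~R) +i* (rate m j l / j%:~R).

Lemma node_j0 : (j%:~R : R) != 0.
Proof.
have [jm _] := in_disc_sign m0 hd; rewrite intr_eq0.
by apply/eqP => e; move: jm; rewrite e mul0r ltxx.
Qed.

Lemma node_mul : j%:~R * z = (l - m)%:~R + 'i%C * (rate m j l)%:C.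
Proof.
have J0 := node_j0.
rewrite -!int_realC zE; apply: complex_ext; rewrite ?Re_add ?Im_add ?Re_mul ?Im_mul /=.
  by field.
by field.
Qed.

Lemma node_mul_conj : j%:~R * z^*%C = (l - m)%:~R - 'i%C * (rate m j l)%:C.
Proof.
have := congr1 (fun x : R[i] => x^*%C) node_mul.
rewrite conjcM conjcD conjcM !int_conj conjc_real => ->; congr (_ + _).
by rewrite -mulNr; congr (_ * _); apply: complex_ext; rewrite /= ?oppr0.
Qed.

(** By the definition of the rate, |j z|^2 = (l - m)^2 + Gamma^2 = j (2 m - j). *)
Lemma node_norm : j%:~R * (z * z^*%C) = (2 * m - j)%:~R.
Proof.
have J0 : (j%:~R : R[i]) != 0.
  by rewrite -int_realC (inj_eq (@complexI _) _ 0) node_j0.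
apply: (mulfI J0).
transitivity ((j%:~R * z) * (j%:~R * z^*%C)); first by ring.
rewrite node_mul node_mul_conj.
transitivity ((l - m)%:~R ^+ 2 + (rate m j l ^+ 2)%:C : R[i]).
  have ii : 'i%C * 'i%C = -1 :> R[i] by rewrite -expr2 sqr_i.
  transitivity ((l - m)%:~R ^+ 2 - ('i%C * 'i%C) * (rate m j l)%:C ^+ 2 : R[i]).
    by ring.
  by rewrite ii rmorphXn /=; ring.
rewrite rate_sq // int_realC -rmorphXn -rmorphD -intrM; congr _%:~R.
by ring.
Qed.

Lemma node_rect_neq0 : z != 0.
Proof.
rewrite zE eq_complex /= negb_and; apply/orP; right.
by rewrite mulf_neq0 ?invr_eq0 ?node_j0 // gt_eqF // rate_gt0.
Qed.

Lemma node_inv : (2 * m - j)%:~R * z^-1 = j%:~R * z^*%C.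
Proof.
rewrite -node_norm; transitivity (j%:~R * z^*%C * (z * z^-1)); first by ring.
by rewrite mulfV ?mulr1 // node_rect_neq0.
Qed.

(** The sign of m decides the side of the real axis on which all nodes lie, so none is the conjugate
    of another or of itself. *)
Lemma node_Im : 0 < complex.Im z * m%:~R.
Proof.
have [jm _] := in_disc_sign m0 hd; have J0 := node_j0.
rewrite zE /= mulrAC -mulrA mulr_gt0 ?rate_gt0 //.
rewrite mulrC -[X in 0 < X](_ : (j * m)%:~R / j%:~R ^+ 2 = _).
  by rewrite divr_gt0 ?ltr0z // exprn_even_gt0.
by rewrite intrM; field.
Qed.

End NodeRelations.

(** |z|^2 = 2 m / j - 1 determines j, and then the real part determines l. *)
Lemma node_inj (m j l j' l' : int) : m <> 0 -> in_disc m j l -> in_disc m j' l' ->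
  ((l - m)%:~R / j%:~R) +i* (rate m j l / j%:~R) =
  ((l' - m)%:~R / j'%:~R) +i* (rate m j' l' / j'%:~R) :> R[i] ->
  (j, l) = (j', l').
Proof.
move=> m0 h h' e; set z := _ +i* _ in e.
have n1 := node_norm m0 h (erefl z); have n2 := node_norm m0 h' e.
have J0 := node_j0 m0 h; have J0' := node_j0 m0 h'.
have jj : j = j'.
  have : (j' * (2 * m - j))%:~R = (j * (2 * m - j'))%:~R :> R[i].
    by rewrite !intrM -n1 -n2; ring.
  move=> /eqP; rewrite eqr_int => /eqP; have [jm _] := in_disc_sign m0 h.
  by move=> h3; apply: (mulIf (introN eqP m0)); nia.
congr (_, _) => //; move: e => [e1 _]; move: e1; rewrite -jj => /(mulIf _).
by rewrite invr_eq0 => /(_ J0)/eqP; rewrite eqr_int => /eqP /addIr.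
Qed.

End Nodes.

(** * Directions transported by the vacuum *)

Section Potentials.
Local Open Scope ring_scope.
Local Open Scope complex_scope.
Local Open Scope sesquilinear_scope.
Variable R : realType.

(* q = psi_22 f / psi_11 at lambda = z: the direction psi (1, f) is that of (1, q). *)
Definition qexp (m j l : int) : sfield R := fun x y t =>
  cexp (- ('i%C * j%:~R) * x%:C + - ('i%C * l%:~R) * y%:C
        + ((rate R m j l)%:C - 'i%C * m%:~R) * t%:C + 0).

Definition wq (m j l : int) : mfield R 2 1 := fun x y t =>
  \col_(k < 2) (if k == 0 then 1 else qexp m j l x y t).

Lemma wq_elem m j l : melem (wq m j l).
Proof.
move=> i k; case: (ord2P i) => ->.
  rewrite (_ : (fun x y t => _) = fun _ _ _ => 1); first exact: elem_cst.
  by do 3 (apply/funext => ?); rewrite mxE.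
rewrite (_ : (fun x y t => _) = qexp m j l); first exact: elem_cexp.
by do 3 (apply/funext => ?); rewrite mxE.
Qed.

Lemma wq_neq0 m j l x y t : wq m j l x y t != 0.
Proof.
apply/eqP => /(congr1 (fun M : 'cV[R[i]]_2 => M 0 0)); rewrite !mxE /=.
by apply/eqP; exact: oner_neq0.
Qed.

Lemma wq_mpd m j l k x y t : mpd k (wq m j l) x y t =
  \col_(i < 2) (if i == 0 then 0 else
    match k with 0 => - ('i%C * j%:~R) | 1 => - ('i%C * l%:~R)
    | _ => (rate R m j l)%:C - 'i%C * m%:~R end * qexp m j l x y t).
Proof.
apply: cV2P; rewrite mpdE mxE /=.
  rewrite (_ : (fun x y t => _) = fun _ _ _ => 1) ?pd_cst //.
  by do 3 (apply/funext => ?); rewrite mxE.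
rewrite (_ : (fun x y t => _) = qexp m j l) ?pd_cexp //.
by do 3 (apply/funext => ?); rewrite mxE.
Qed.

Lemma qexp_periodic m j l x y t (p q : int) :
  qexp m j l (x + p%:~R * (2 * pi)) (y + q%:~R * (2 * pi)) t = qexp m j l x y t.
Proof.
have h (r : R) (k : int) : (r + k%:~R * (2 * pi))%:C = r%:C + k%:~R * (2 * pi)%:C :> R[i].
  by rewrite rmorphD rmorphM /= int_realC.
rewrite /qexp !h.
have := cexp_2pi R (- (j * p + l * q)); rewrite mulrNz intrD !intrM.
move: ((2 * pi)%:C) (x%:C) (y%:C) (t%:C) ((rate R m j l)%:C) => P X Y S g e.
rewrite -[RHS]mulr1 -[X in _ = _ * X]e -cexpD; apply: congr1.
by ring.
Qed.

Variables (m : int) (n : nat) (j l : nat -> int) (z : nat -> R[i]).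
Hypothesis m0 : m <> 0.
Hypothesis disc : forall s, (1 <= s <= n)%N -> in_disc m (j s) (l s).
Hypothesis zE : forall s, (1 <= s <= n)%N ->
  z s = ((l s - m)%:~R / (j s)%:~R) +i* (rate R m (j s) (l s) / (j s)%:~R).

Local Notation w := (fun s => wq m (j s) (l s)).

(** The value mu = i m makes A0 + mu annihilate the constant first coordinate. The second coordinate
    is the relation j z = (l - m) + i Gamma. *)
Lemma wq_compatible_u : compatible z n (vac_gen R m) ('i%C * m%:~R) w (1, 0, 0) (0, 1, 1).
Proof.
move=> s hs x y t; have hz := node_mul m0 (disc hs) (zE hs).
have ii : 'i%C * 'i%C = -1 :> R[i] by rewrite -expr2 sqr_i.
rewrite /dop /= !wq_mpd; move: hz; rewrite rmorphB /= => hz.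
apply: cV2P; rewrite [RHS]mul2E !mxE /= ?mulr1n ?mulr0n ?(rmorph0, rmorph1).
  by ring.
move: (qexp _ _ _ x y t) (rate _ _ _ _) hz => q g hz.
transitivity (- 'i%C * ((j s)%:~R * z s) * q + ('i%C * (l s)%:~R - g%:C + 'i%C * m%:~R) * q).
  by ring.
rewrite hz; transitivity ((- ('i%C * 'i%C) - 1) * g%:C * q + 2 * 'i%C * m%:~R * q); first by ring.
by rewrite ii; ring.
Qed.

(** In the second coordinate, the coefficient of q is i z ((l - m) - i Gamma) + i j = i j |z|^2 + i
    j = 2 i m. *)
Lemma wq_compatible_x : compatible z n (vac_gen R m) ('i%C * m%:~R) w (0, -1, 1) (1, 0, 0).
Proof.
move=> s hs x y t; have hz := node_mul_conj m0 (disc hs) (zE hs).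
have hn := node_norm m0 (disc hs) (zE hs).
have ii : 'i%C * 'i%C = -1 :> R[i] by rewrite -expr2 sqr_i.
rewrite /dop /= !wq_mpd; move: hz hn; rewrite !rmorphB rmorphM /= => hz hn.
apply: cV2P; rewrite [RHS]mul2E !mxE /= ?mulr1n ?mulr0n ?rmorphN1 ?(rmorph0, rmorph1).
  by ring.
move: (qexp _ _ _ x y t) (rate _ _ _ _) hz => q g hz.
transitivity ('i%C * (z s * (((l s)%:~R - m%:~R) - 'i%C * g%:C)) * q
   + ('i%C * 'i%C + 1) * z s * g%:C * q + 'i%C * (j s)%:~R * q); first by ring.
rewrite -hz ii; transitivity ('i%C * ((j s)%:~R * (z s * (z s)^*%C)) * q + 'i%C * (j s)%:~R * q).
  by ring.
by rewrite hn; ring.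
Qed.

Lemma psi_vac_dir s x y t : (1 <= s <= n)%N ->
  psi_vac m x y t (z s) *m \col_(k < 2) (if k == 0 then 1 else
    cexp ('i%C * ((2 * m - j s)%:~R - 2 * m%:~R * z s) * coord_w (z s) x y t))
  = cexp (((1 - z s) * x%:C + (1 + z s - z s ^+ 2) * coord_u y t - coord_v y t)
          * ('i%C * m%:~R)) *: w s x y t.
Proof.
move=> hs; have hz := node_mul m0 (disc hs) (zE hs).
have hzc := node_mul_conj m0 (disc hs) (zE hs).
have hV := node_inv m0 (disc hs) (zE hs).
have z0 := node_rect_neq0 m0 (disc hs) (zE hs).
rewrite /psi_vac /exp_diag mul_diag_mx; set cc := _ - coord_v y t.
apply: cV2P; rewrite !mxE /= ?mxE /=; first by [].
rewrite -!cexpD; apply: congr1; rewrite mulrN addrC; apply/eqP; rewrite subr_eq; apply/eqP.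
rewrite /cc /coord_w.
have hu : coord_u y t = (t%:C + y%:C) / 2 :> R[i].
  by rewrite /coord_u rmorphM rmorphD /= fmorphV /= rmorph_nat.
have hv : coord_v y t = (t%:C - y%:C) / 2 :> R[i].
  by rewrite /coord_v rmorphM rmorphB /= fmorphV /= rmorph_nat.
move: (coord_u y t) (coord_v y t) hu hv => u v hu hv.
have zz : z s * (z s)^-1 = 1 by rewrite mulfV.
move: hz hzc hV zz; rewrite !rmorphB rmorphM /=.
move: (z s) ((z s)^*%C) ((z s)^-1) (rate _ _ _ _) => Z Zc Zi g hz hzc hV zz.
(* The exponent is arranged so that the node relations apply to j z, (2 m - j) / z and z / z. The
   remaining powers of z are those of the exponent of psi_vac, which occurs twice because the ratio
   of its diagonal entries is involved. *)
transitivity ('i%C * ((2 * m%:~R - (j s)%:~R) * x%:C - 2 * m%:~R * Z * x%:C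
   + (2 * m%:~R * Z - (j s)%:~R * Z) * u - 2 * m%:~R * Z ^+ 2 * u
   + ((2 * m%:~R - (j s)%:~R) * Zi) * v - 2 * m%:~R * (Z * Zi) * v)); first by ring.
rewrite hV hz hzc zz hu hv.
have ii : 'i%C * 'i%C = -1 :> R[i] by rewrite -expr2 sqr_i.
transitivity (- ('i%C * (j s)%:~R) * x%:C - 'i%C * (l s)%:~R * y%:C
   - ('i%C * 'i%C) * g%:C * t%:C - 'i%C * m%:~R * t%:C
   + ((1 - Z) * x%:C + (1 + Z - Z ^+ 2) * ((t%:C + y%:C) / 2) - (t%:C - y%:C) / 2) * ('i%C * m%:~R)
   + ((1 - Z) * x%:C + (1 + Z - Z ^+ 2) * ((t%:C + y%:C) / 2) - (t%:C - y%:C) / 2) * ('i%C * m%:~R)).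
  by field.
by rewrite ii; ring.
Qed.

(** [psi_vac] carries the line of (1, f_s) to that of (1, q_s), and the scalar factor drops out of
    the projection. *)
Lemma bt_iterE s : (s <= n)%N ->
  bt_iter z (fun s => pi_exp m (j s) (z s)) (psi_vac m) (@J_vac R m) s =
  (fun x y t lam => dress z (fun i => w i x y t) s lam *m psi_vac m x y t lam,
   fun x y t => J_vac m x y t *m udress z (fun i => w i x y t) s).
Proof.
elim: s => [_|s IH sn] /=.
  congr (_, _); [do 4 (apply/funext => ?)|do 3 (apply/funext => ?)].
    by rewrite mul1mx.
  by rewrite mulmx1.
have hs : (1 <= s.+1 <= n)%N by [].
rewrite (IH (ltnW sn)) /bt_ext /bt_map.
have piE x y t : pi_tilde (z s.+1) (pi_exp m (j s.+1) (z s.+1))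
    (fun x y t lam => dress z (fun i => w i x y t) s lam *m psi_vac m x y t lam) x y t
    = lproj (dvec z (fun i => w i x y t) s).
  rewrite /pi_tilde /pi_exp hproj_mul -mulmxA (psi_vac_dir x y t hs) -scalemxAr.
  exact: lprojZ (cexp_neq0 _).
congr (_, _); [do 4 (apply/funext => ?)|do 3 (apply/funext => ?)]; rewrite piE.
  by rewrite mulmxA.
by rewrite /kfactor -mulmxA -!scalemxAr.
Qed.

End Potentials.

(** * Behaviour at one end of time *)

Section EndBehaviour.
Local Open Scope classical_set_scope.
Local Open Scope ring_scope.
Local Open Scope complex_scope.
Local Open Scope sesquilinear_scope.
Variables (R : realType) (m : int) (c : R[i]).
Hypothesis c2 : c * c = 1.
Hypothesis cr : c^*%C = c.
Variables (T : set_system R) (FT : ProperFilter T) (s : R).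
Hypothesis s_sq : s * s = 1.
(** The sign s is 1 at +oo and -1 at -oo; both ends are treated together, since the rates - s
    Gamma_i give decay along T in either case. *)
Hypothesis Ts : forall M, \forall t \near T, M < s * t.

Lemma expR_decay (a e : R) : 0 < a -> 0 < e ->
  \forall t \near T, expR (- (s * a) * t) <= e.
Proof.
move=> a0 e0; apply: filterS (Ts (- ln e / a)) => t.
rewrite ltr_pdivrMr // => h.
by rewrite -[leRHS](lnK e0) ler_expR; nra.
Qed.

Variables (n : nat) (j l : 'I_n -> int) (i0 : 'I_n) (d : 'I_n -> R[i]).
(** V collects the small parameters, 1/q_i or q_i according to the end; f0 and f1 are the remainders
    in the expansion of the entries of G(0). *)
Variables (f0 f1 : (nat -> R[i]) -> R[i]) (V : R -> R -> R -> nat -> R[i]).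
Variable W : stfield R 2.
Let g i := rate R m (j i) (l i).
Let gam i := - (s * g i).
Variable Q : R -> Prop.
Hypothesis disc : forall i, in_disc m (j i) (l i).
Hypothesis g_min : forall i, g i0 <= g i.
Hypothesis jl_inj : forall i k, i != k -> (j i, l i) <> (j k, l k).
Hypothesis d_neq0 : forall i, d i != 0.
Hypothesis gamQ : forall i, Q (gam i).
Hypothesis W_SU : forall x y t, SUmx (W x y t).
Hypothesis f0O : isO n 2 f0.
Hypothesis f1O : isO n 2 f1.
Hypothesis V_abs : forall x y t (i : 'I_n), cabs (V x y t i.+1) = expR (gam i * t).
Hypothesis W00 : forall x y t, cabs (W x y t 0 0 - 1) = cabs (f0 (V x y t)).
Hypothesis W01 : forall x y t, cabs (W x y t 0 1
  - \sum_i d i * (cexp (growth m gam i * t%:C) * chi (j i) (l i) x y))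
  = cabs (f1 (V x y t)).

Lemma gam_decay i e : 0 < e -> \forall t \near T, expR (gam i * t) <= e.
Proof. by move=> e0; apply: expR_decay => //; exact: rate_gt0. Qed.

(** With rho a bound for all the small parameters, C rho^2 is (C rho) rho and C rho tends to 0: this
    is the relative smallness that tangency requires. *)
Lemma isO_small f : isO n 2 f -> forall e, 0 < e -> \forall t \near T,
  forall x y, cabs (f (V x y t)) <= e * expR (gam i0 * t).
Proof.
move=> [C [dl [C0 /andP[dl0 dl1] h]]] e e0.
have C1 : 0 < C + 1 by rewrite ltr_wpDl.
near=> t => x y; pose rho := expR (gam i0 * t).
have r0 : 0 < rho by exact: expR_gt0.
apply: le_trans (h _ rho _ _) _.
- by rewrite ltW //= /rho; near: t; exact: gam_decay.
- move=> i /andP[i1 hi]; case: i i1 hi => // i _ hi.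
  rewrite (V_abs x y t (Ordinal hi)) ler_expR.
  have ts : 0 < s * t by near: t; exact: Ts.
  have := g_min (Ordinal hi); rewrite /gam; nra.
rewrite expr2 mulrA; apply: ler_wpM2r; first exact: ltW.
apply: (@le_trans _ _ ((C + 1) * rho)); first by apply: ler_wpM2r; [exact: ltW|lra].
rewrite -ler_pdivlMl // /rho; near: t; apply: gam_decay.
by rewrite mulr_gt0 ?invr_gt0.
Unshelve. all: end_near.
Qed.

Let J : stfield R 2 := fun x y t => svac m c x y t *m W x y t.

Lemma end_cvg : unif_cvg T J (svac m c).
Proof.
apply: svac_unif_cvg => // e e0.
  near=> t => x y; rewrite W00.
  apply: (@le_trans _ _ (e * expR (gam i0 * t))).
    by move: x y; near: t; exact: isO_small.
  by apply: ler_piMr; [exact: ltW|near: t; exact: gam_decay].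
pose S := 1 + \sum_i cabs (d i).
have S0 : 0 <= \sum_i cabs (d i) by apply: sumr_ge0 => i _; exact: cabs_ge0.
have S1 : 0 < S by rewrite ltr_pwDl.
have eS : 0 < e / S by rewrite divr_gt0.
have dec : \forall t \near T, forall i, expR (gam i * t) <= e / S.
  by apply: filter_forall => i; exact: gam_decay.
near=> t => x y.
rewrite -[W x y t 0 1](subrK (\sum_i d i * (cexp (growth m gam i * t%:C) * chi (j i) (l i) x y))).
apply: le_trans (cabsD _ _) _; rewrite W01.
have ht : forall i, expR (gam i * t) <= e / S by near: t; exact: dec.
have h1 : cabs (f1 (V x y t)) <= 1 * expR (gam i0 * t).
  by move: x y {ht}; near: t; exact: isO_small.
have h2 : cabs (\sum_i d i * (cexp (growth m gam i * t%:C) * chi (j i) (l i) x y))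
    <= (\sum_i cabs (d i)) * (e / S).
  apply: le_trans (cabs_sum _ _ _) _; rewrite big_distrl /=; apply: ler_sum => i _.
  rewrite cabsM cabsM cabs_chi mulr1; apply: ler_wpM2l; first exact: cabs_ge0.
  rewrite cabs_cexp; apply: le_trans (ht i); rewrite ler_expR.
  rewrite /growth -int_realC Re_mul Re_add Re_mul /=.
  by rewrite le_eqVlt; apply/orP; left; apply/eqP; ring.
apply: le_trans (lerD (le_trans h1 _) h2) _; first by rewrite mul1r; exact: ht.
rewrite -{1}[e / S]mul1r -mulrDl -/S mulrC divfK // gt_eqF //.
Unshelve. all: end_near.
Qed.

Lemma end_tangent : tangent_to T J (svac m c)
  (real_span [set eta | exists r, Q (complex.Re r) /\ is_mode (svac m c) r eta]).
Proof.
apply: (svac_tangent c2 cr FT W_SU (i0 := i0) (d := d) (j := j) (l := l) (gam := gam)) => //.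
- by move=> i; rewrite /gam sqrrN exprMn expr2 s_sq mul1r rate_sq.
- move=> i hne e e0.
  have gi : 0 < g i - g i0.
    rewrite subr_gt0 lt_def g_min andbT; apply/eqP => h; apply: hne.
    by rewrite /gam h.
  apply: filterS (expR_decay gi e0) => t ht.
  rewrite (_ : gam i * t = - (s * (g i - g i0)) * t + gam i0 * t); last by rewrite /gam; ring.
  by rewrite expRD ler_wpM2r // expR_ge0.
- move=> e e0; apply: filterS (isO_small f0O e0) => t ht x y.
  by rewrite W00; exact: ht.
- move=> e e0; apply: filterS (isO_small f1O e0) => t ht x y.
  by rewrite W01; exact: ht.
Qed.

End EndBehaviour.

(** * The two ends of the iterated map *)

Section Assembly.
Local Open Scope classical_set_scope.
Local Open Scope ring_scope.
Local Open Scope complex_scope.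
Local Open Scope sesquilinear_scope.
Variable R : realType.

(** G is the adjoint of W. The first two identities read W off the first row of G and serve the end
    +oo; the last two read it off the second row and serve -oo. *)
Lemma SU2_inverse (W G : 'M[R[i]]_2) : SUmx W -> W *m G = 1%:M ->
  [/\ W 0 0 = (G 0 0)^*%C, W 0 1 = - G 0 1, W 0 0 = G 1 1 & W 0 1 = (G 1 0)^*%C].
Proof.
move=> WS WG; have [h1 h2] := SU2_entries WS; have [uW _] := WS.
have GE : G = W^t*.
  by rewrite -invmx_unitary // -[G](mulKmx (unitarymx_unit uW)) WG mulmx1.
have cK (x : R[i]) : (Num.conj x)^*%C = x by exact: conjcK.
have cc (x : R[i]) : Num.conj x = x^*%C by [].
rewrite GE !mxE !cK h1 h2; split => //.
- by rewrite cc conjcN conjcK opprK.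
- by rewrite cc conjcK.
Qed.

Variables (m : int) (n : nat) (j l : nat -> int) (z : nat -> R[i]) (c : R[i]).
Hypothesis m0 : m <> 0.
Hypothesis n0 : (0 < n)%N.
Hypothesis disc : forall s, (1 <= s <= n)%N -> in_disc m (j s) (l s).
Hypothesis zE : forall s, (1 <= s <= n)%N ->
  z s = ((l s - m)%:~R / (j s)%:~R) +i* (rate R m (j s) (l s) / (j s)%:~R).
Hypothesis jl_inj : forall s k, (1 <= s <= n)%N -> (1 <= k <= n)%N ->
  (j s, l s) = (j k, l k) -> s = k.
Hypothesis c2 : c * c = 1.
Hypothesis cr : c^*%C = c.
Hypothesis kappa : \prod_(i < n) (z i.+1 / (cabs (z i.+1))%:C) = c.

Local Notation w := (fun s => @wq R m (j s) (l s)).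
Let J : stfield R 2 := fun x y t => J_vac m x y t *m udress z (fun i => w i x y t) n.
(** As c c = 1, the sign can be split between J_0 and U; with it, W tends to the identity. *)
Let W : stfield R 2 := fun x y t => c *: udress z (fun i => w i x y t) n.

Lemma nodes_nreal i k : (1 <= i <= n)%N -> (1 <= k <= n)%N -> z i != (z k)^*%C.
Proof.
move=> hi hk; apply/eqP => e.
have h1 := node_Im m0 (disc hi) (zE hi); have h2 := node_Im m0 (disc hk) (zE hk).
move: h1; rewrite e Im_conj mulNr oppr_gt0 => /lt_trans/(_ h2).
by rewrite ltxx.
Qed.

Lemma nodes_inj i k : (1 <= i <= n)%N -> (1 <= k <= n)%N -> z i = z k -> i = k.
Proof.
move=> hi hk e; apply: jl_inj => //; apply: (@node_inj R m) => //; try exact: disc.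
by rewrite -zE // -zE.
Qed.

Lemma iterated_svac x y t : J x y t = svac m c x y t *m W x y t.
Proof. by rewrite /J /svac /W -scalemxAl -scalemxAr scalerA c2 scale1r. Qed.

Lemma iterated_ward : ward_map_T2 J.
Proof.
have i1 : (1 : R[i]) * 1 = 1 by rewrite mulr1.
have v1 : @J_vac R m = svac m 1.
  by do 3 (apply/funext => ?); rewrite /svac scale1r.
split.
  have := @dressed_ward R z n (vac_gen R m) ('i%C * m%:~R) w (svac m 1)
    nodes_nreal nodes_inj (vac_gen_skew R m) (fun i => @wq_elem R m (j i) (l i))
    (fun i => @wq_neq0 R m (j i) (l i)) (wq_compatible_u m0 disc zE)
    (wq_compatible_x m0 disc zE) (svac_melem m 1) (svac_SU m i1 (conjc1 R))
    (svac_dop_u m 1) (svac_dop_x m 1).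
  by rewrite /dressed -v1.
have per x y t (p q : int) : (fun i => w i (x + p%:~R * (2 * pi)) (y + q%:~R * (2 * pi)) t)
    = fun i => w i x y t.
  by apply/funext => i; rewrite /wq qexp_periodic.
move=> x y t; have [h1 h2] := @J_vac_periodic R m x y t; split; rewrite /J ?h1 ?h2.
  by have := per x y t 1 0; rewrite mul0r mul1r addr0 => ->.
by have := per x y t 0 1; rewrite mul0r mul1r addr0 => ->.
Qed.

Lemma rotation_SU x y t : SUmx (W x y t).
Proof.
have [/unitarymxP u dU] : SUmx (udress z (fun i => w i x y t) n).
  apply: (udress_SU nodes_nreal nodes_inj) => // i _; exact: wq_neq0.
split.
  by apply/unitarymxP; rewrite /W adjZ cr -scalemxAl -scalemxAr u scalerA c2 scale1r.
by rewrite detZ dU expr2 c2 mulr1.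
Qed.

(** The phase of U G(0) is c, and W brings a second c. *)
Lemma rotation_dress x y t : W x y t *m dress z (fun i => w i x y t) n 0 = 1%:M.
Proof.
rewrite /W -scalemxAl (udress_dress0 nodes_nreal) // kappa scale_scalar_mx c2.
by [].
Qed.

Lemma qexp_neq0 i x y t : @qexp R m (j i) (l i) x y t != 0.
Proof. exact: cexp_neq0. Qed.

Lemma dress_pinfty x y t : dress z (fun i => w i x y t) n 0 =
  dress z (near_e2 (fun i => (@qexp R m (j i) (l i) x y t)^-1)) n 0.
Proof.
apply: (@dress_scale _ z _ _ (fun i => @qexp R m (j i) (l i) x y t)) => i.
  exact: qexp_neq0.
apply: cV2P; rewrite !mxE /= ?mulr1 // mulfV //; exact: qexp_neq0.
Qed.

(** At -oo the q_i are small and the lines approach that of e_1; the exchange of the coordinates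
    moves them to e_2. *)
Lemma dress_ninfty x y t :
  let G := dress z (near_e2 (fun i => @qexp R m (j i) (l i) x y t)) n 0 in
  dress z (fun i => w i x y t) n 0 1 1 = G 0 0 /\
  dress z (fun i => w i x y t) n 0 1 0 = G 0 1.
Proof.
pose S : 'M[R[i]]_2 := \matrix_(i, k) (i != k)%:R.
have SS : S^t* *m S = 1%:M.
  by apply: mx2P; rewrite mul2E !mxE /= ?rmorph0 ?rmorph1 ?mulr0 ?mul0r ?mulr1 ?addr0 ?add0r.
set G := dress z (near_e2 _) n 0.
have -> : dress z (fun i => w i x y t) n 0 = S *m G *m S^t*.
  rewrite -dress_unitary //; congr (dress z _ n 0); apply/funext => i.
  by apply: cV2P; rewrite mul2E !mxE /= ?mul0r ?mul1r ?add0r ?addr0.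
by split; rewrite !mul2E !mxE /= ?rmorph0 ?rmorph1 !(mulr0, mul0r, mulr1, mul1r, addr0, add0r).
Qed.

Lemma slowest : exists i0 : 'I_n, forall i : 'I_n,
  rate R m (j i0.+1) (l i0.+1) <= rate R m (j i.+1) (l i.+1).
Proof.
pose i1 : 'I_n := Ordinal n0.
case: (@arg_minP _ R _ i1 xpredT (fun i : 'I_n => rate R m (j i.+1) (l i.+1))) => // i0 _ h.
by exists i0 => i; exact: h.
Qed.

Lemma disc_ord (i : 'I_n) : in_disc m (j i.+1) (l i.+1).
Proof. by apply: disc; rewrite /= ltn_ord. Qed.

Lemma jl_inj_ord (i k : 'I_n) : i != k -> (j i.+1, l i.+1) <> (j k.+1, l k.+1).
Proof.
move=> ik e; have [h] : i.+1 = k.+1 by apply: jl_inj => //; rewrite /= ltn_ord.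
by move: ik; rewrite (val_inj h) eqxx.
Qed.

Lemma cabs_qexp i x y t :
  cabs (@qexp R m (j i) (l i) x y t) = expR (rate R m (j i) (l i) * t).
Proof.
rewrite cabs_cexp -!int_realC; congr expR.
by rewrite !(Re_add, Re_mul, Re_opp, Im_mul, Im_add, Im_opp) /=; ring.
Qed.

Lemma end_pinfty : unif_cvg (pinfty_nbhs R) J (svac m c) /\
  tangent_to (pinfty_nbhs R) J (svac m c) (stable_subspace (svac m c)).
Proof.
have [d d0 [hO0 hO1]] := dress0_asymptotics nodes_nreal nodes_inj.
have [i0 hi0] := slowest.
have -> : J = fun x y t => svac m c x y t *m W x y t.
  by do 3 (apply/funext => ?); exact: iterated_svac.
pose V x y t : nat -> R[i] := fun i => (@qexp R m (j i) (l i) x y t)^-1.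
have Ts M : \forall t \near pinfty_nbhs R, M < 1 * t :> R.
  by exists M; split; [exact: num_real|move=> t; rewrite mul1r].
have Vabs x y t (i : 'I_n) : cabs (V x y t i.+1) =
    expR (- (1 * rate R m (j i.+1) (l i.+1)) * t).
  by rewrite /V cabsV cabs_qexp -expRN mul1r mulNr.
have w00 x y t : cabs (W x y t 0 0 - 1) = cabs (dress z (near_e2 (V x y t)) n 0 0 0 - 1).
  have [-> _ _ _] := SU2_inverse (rotation_SU x y t) (rotation_dress x y t).
  by rewrite dress_pinfty -[in LHS](conjc1 R) -conjcB cabs_conj.
(* The signs of W_01 = - G_01 and of the expansion cancel, and 1/q_i already has the phase of a
   mode, so the coefficients are the d_i. *)
have w01 x y t : cabs (W x y t 0 1 - \sum_(i < n) d i.+1 *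
     (cexp (growth m (fun i : 'I_n => - (1 * rate R m (j i.+1) (l i.+1))) i * t%:C)
      * chi (j i.+1) (l i.+1) x y))
   = cabs (dress z (near_e2 (V x y t)) n 0 0 1 + \sum_(i < n) d i.+1 * V x y t i.+1).
  have [_ -> _ _] := SU2_inverse (rotation_SU x y t) (rotation_dress x y t).
  rewrite dress_pinfty -opprD cabsN; congr (cabs (_ + _)); apply: eq_bigr => i _.
  congr (_ * _); rewrite /V /qexp -cexpN -cexpD /growth mul1r; congr cexp.
  by rewrite rmorphN /=; ring.
split.
  exact: (end_cvg c2 cr _ Ts disc_ord hi0 rotation_SU hO0 hO1 Vabs w00 w01).
apply: (end_tangent c2 cr _ _ Ts (Q := fun r => r < 0) disc_ord hi0 jl_inj_ord
  (d := fun i : 'I_n => d i.+1) _ _ rotation_SU hO0 hO1 Vabs w00 w01).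
- by rewrite mulr1.
- by move=> i; exact: d0.
- by move=> i; rewrite mul1r oppr_lt0 rate_gt0 // disc_ord.
Qed.

Lemma end_ninfty : unif_cvg (ninfty_nbhs R) J (svac m c) /\
  tangent_to (ninfty_nbhs R) J (svac m c) (unstable_subspace (svac m c)).
Proof.
have [d d0 [hO0 hO1]] := dress0_asymptotics nodes_nreal nodes_inj.
have [i0 hi0] := slowest.
have -> : J = fun x y t => svac m c x y t *m W x y t.
  by do 3 (apply/funext => ?); exact: iterated_svac.
pose V x y t : nat -> R[i] := fun i => @qexp R m (j i) (l i) x y t.
have Ts M : \forall t \near ninfty_nbhs R, M < -1 * t :> R.
  by exists (- M); split; [exact: num_real|move=> t; rewrite mulN1r ltrNr].
have Vabs x y t (i : 'I_n) : cabs (V x y t i.+1) =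
    expR (- (-1 * rate R m (j i.+1) (l i.+1)) * t).
  by rewrite /V cabs_qexp mulN1r opprK.
have w00 x y t : cabs (W x y t 0 0 - 1) = cabs (dress z (near_e2 (V x y t)) n 0 0 0 - 1).
  have [_ _ -> _] := SU2_inverse (rotation_SU x y t) (rotation_dress x y t).
  by have [-> _] := dress_ninfty x y t.
have ci : ('i%C : R[i])^*%C = - 'i%C by apply: complex_ext; rewrite /= ?oppr0.
(* Here W_01 is the conjugate of G_10. Conjugation gives q_i the phase of a mode with growth Gamma_i
   and turns the coefficients into - conj d_i. *)
have w01 x y t : cabs (W x y t 0 1 - \sum_(i < n) - (d i.+1)^*%C *
     (cexp (growth m (fun i : 'I_n => - (-1 * rate R m (j i.+1) (l i.+1))) i * t%:C)
      * chi (j i.+1) (l i.+1) x y))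
   = cabs (dress z (near_e2 (V x y t)) n 0 0 1 + \sum_(i < n) d i.+1 * V x y t i.+1).
  have [_ _ _ ->] := SU2_inverse (rotation_SU x y t) (rotation_dress x y t).
  have [_ ->] := dress_ninfty x y t; rewrite -[RHS]cabs_conj conjcD.
  congr (cabs (_ + _)); rewrite -sumrN (rmorph_sum conjc); apply: eq_bigr => i _.
  rewrite mulNr opprK; apply: esym; apply: eq_trans (conjcM _ _) _.
  congr (_ * _); rewrite /V /qexp cexp_conj -cexpD /growth mulN1r opprK; congr cexp.
  rewrite !conjcD !conjcM conjcB !conjcN !conjcM ci !int_conj !conjc_real ?conjc0.
  by ring.
split.
  exact: (end_cvg c2 cr _ Ts disc_ord hi0 rotation_SU hO0 hO1 Vabs w00 w01).
apply: (end_tangent c2 cr _ _ Ts (Q := fun r => 0 < r) disc_ord hi0 jl_inj_ord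
  (d := fun i : 'I_n => - (d i.+1)^*%C) _ _ rotation_SU hO0 hO1 Vabs w00 w01).
- by rewrite mulN1r opprK.
- by move=> i; rewrite oppr_eq0 conjc_eq0; exact: d0.
- by move=> i; rewrite mulN1r opprK rate_gt0 // disc_ord.
Qed.

End Assembly.


(** * The constant phase *)

Section UnitProduct.
Local Open Scope ring_scope.
Local Open Scope complex_scope.

(** Each pair contributes - z conj z / |z|^2 = -1. *)
Lemma prod_phases (R : realType) (z : nat -> R[i]) N :
  (forall k, (1 <= k <= N)%N ->
    z (2 * k).-1%N != 0 /\ z (2 * k)%N = - (z (2 * k).-1%N)^*%C) ->
  \prod_(i < 2 * N) (z i.+1 / (cabs (z i.+1))%:C) = (-1) ^+ N.
Proof.
elim: N => [|N IH] h; first by rewrite muln0 big_ord0 expr0.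
rewrite mulnS !big_ord_recr /= IH; last first.
  by move=> k /andP[k1 k2]; apply: h; rewrite k1 ltnW.
have [] := h N.+1 (leqnn _); rewrite mulnS /= => z0 ->.
rewrite cabsN cabs_conj exprS -mulrA mulrC; congr (_ * _).
set x := z (2 * N).+1 in z0 *.
have a0 : (cabs x)%:C != 0 :> R[i] by rewrite (inj_eq (@complexI _) _ 0) cabs_eq0.
have xx : x * x^*%C = (cabs x)%:C * (cabs x)%:C.
  by rewrite cabs_mul_conj expr2 rmorphM.
transitivity (- (x * x^*%C) / ((cabs x)%:C * (cabs x)%:C)); first by field.
by rewrite xx; field.
Qed.

End UnitProduct.

Unset Implicit Arguments.
Set Strict Implicit.
Set Printing Implicit Defensive.

Local Open Scope complex_scope.
Local Open Scope ring_scope.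

Theorem theorem4p2 (R : realType) (m : int) (N : nat)
    (j l : nat -> int) (theta : nat -> R) (z : nat -> R[i]) :
  m <> 0 ->
  (1 <= N)%N ->
  (forall k : nat, (1 <= k <= N)%N ->
     (j (2 * k).-1%N - m) ^+ 2 + (l (2 * k).-1%N - m) ^+ 2 < m ^+ 2
     /\ m < l (2 * k).-1%N) ->
  (forall k h : nat, (1 <= k)%N -> (k < h)%N -> (h <= N)%N ->
     (j (2 * k).-1%N, l (2 * k).-1%N) <> (j (2 * h).-1%N, l (2 * h).-1%N)) ->
  (forall k : nat, (1 <= k <= N)%N ->
     j (2 * k)%N = j (2 * k).-1%N /\ l (2 * k)%N = 2 * m - l (2 * k).-1%N) ->
  (forall s : nat, (1 <= s <= 2 * N)%N ->
     [/\ cos (theta s) = Num.sg m%:~R * (l s - m)%:~R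
                           / Num.sqrt (j s * (2 * m - j s))%:~R,
         sin (theta s) = Num.sg m%:~R * Num.sqrt (1 - cos (theta s) ^+ 2)
       & z s = (Num.sqrt ((2 * m - j s)%:~R / (j s)%:~R))%:C
                 * cexp ('i%C * (theta s)%:C)]) ->
  let J2N := (bt_iter z (fun s => pi_exp m (j s) (z s))
                (psi_vac m) (J_vac m) (2 * N)).2 in
  let limJ : stfield R 2 := fun x y t => (-1) ^+ N *: J_vac m x y t in
  homoclinic J2N
  /\ unif_cvg (pinfty_nbhs R) J2N limJ
  /\ unif_cvg (ninfty_nbhs R) J2N limJ.
Proof.
move=> m0 N1 hodd hdist heven hz J2N limJ.
have odd_or_even s : (1 <= s <= 2 * N)%N -> exists2 k, (1 <= k <= N)%N &
    s = (2 * k).-1 \/ s = (2 * k)%N.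
  move=> /andP[s1 s2]; exists (uphalf s); first by lia.
  by have := odd_double_half s; case: (odd s) => /= e; [left|right]; lia.
have disc s : (1 <= s <= 2 * N)%N -> in_disc m (j s) (l s).
  move=> /odd_or_even[k hk [->|->]]; first by case: (hodd k hk).
  have [-> ->] := heven k hk; have [h _] := hodd k hk.
  by move: h; rewrite /in_disc; lia.
have zE s : (1 <= s <= 2 * N)%N ->
    z s = ((l s - m)%:~R / (j s)%:~R) +i* (rate R m (j s) (l s) / (j s)%:~R).
  by move=> hs; have [hc hsn hzs] := hz s hs; apply: node_rect hc hsn hzs => //; exact: disc.
have odd_inj k h : (1 <= k <= N)%N -> (1 <= h <= N)%N ->
    (j (2 * k).-1%N, l (2 * k).-1%N) = (j (2 * h).-1%N, l (2 * h).-1%N) -> k = h.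
  move=> /andP[k1 k2] /andP[h1 h2] e; case: (ltngtP k h) => // lt.
    by case: (hdist k h).
  by case: (hdist h k).
have jl_inj s k : (1 <= s <= 2 * N)%N -> (1 <= k <= 2 * N)%N ->
    (j s, l s) = (j k, l k) -> s = k.
  move=> /odd_or_even[a ha hs] /odd_or_even[b hb hk].
  have [ja la] := heven a ha; have [jb lb] := heven b hb.
  have [_ oa] := hodd a ha; have [_ ob] := hodd b hb.
  (* Indices of different parity cannot share l: it exceeds m for odd indices and is below m for
     even ones. *)
  case: hs => ->; case: hk => -> e.
  - by rewrite (odd_inj a b).
  - by exfalso; move: e; rewrite lb => -[_ e]; move: e oa ob; lia.
  - by exfalso; move: e; rewrite la => -[_ e]; move: e oa ob; lia.
  - rewrite (odd_inj a b) //; move: e; rewrite ja jb la lb => -[-> e].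
    by congr (_, _); move: e; lia.
pose c : R[i] := (-1) ^+ N.
have c2 : c * c = 1 by rewrite /c -expr2 sqrr_sign.
have cr : c^*%C = c by rewrite /c rmorphXn rmorphN1.
have n0 : (0 < 2 * N)%N by lia.
have kappa : \prod_(i < 2 * N) (z i.+1 / (cabs (z i.+1))%:C) = c.
  apply: prod_phases => k hk.
  have ho : (1 <= (2 * k).-1 <= 2 * N)%N by lia.
  have he : (1 <= 2 * k <= 2 * N)%N by lia.
  split; first exact: node_rect_neq0 m0 (disc _ ho) (zE _ ho).
  (* Replacing l by 2 m - l changes the sign of the real part of the node and keeps the rate, so the
     node becomes minus its conjugate. *)
  rewrite (zE _ ho) (zE _ he); have [-> ->] := heven k hk.
  set J := j _; set L := l _.
  have -> : rate R m J (2 * m - L) = rate R m J L.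
    by rewrite /rate; congr (Num.sqrt _%:~R); ring.
  apply: complex_ext; rewrite /= ?opprK //.
  by rewrite -mulNr -rmorphN; congr (_%:~R / _); ring.
have J2NE : J2N = fun x y t =>
    J_vac m x y t *m udress z (fun i => wq m (j i) (l i) x y t) (2 * N).
  by rewrite /J2N (bt_iterE m0 disc zE).
have [cvp tp] := end_pinfty m0 n0 disc zE jl_inj c2 cr kappa.
have [cvm tm] := end_ninfty m0 n0 disc zE jl_inj c2 cr kappa.
rewrite J2NE; split; last by split; [exact: cvp|exact: cvm].
split; first exact: iterated_ward m0 disc zE jl_inj.
exists limJ; split; [|exact: cvp|exact: cvm|exact: tp|exact: tm].
by split; [exact: svac_ward c2 cr|exact: svac_stationary].
Qed.
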